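(* Given any ideally triangulated, topologically finite, orientable 3-manifold $N$, there is a complete, non-compact hyperbolic cone-manifold structure on $N$ with singular locus contained in $N^{(1)}$ (the union of the ideal edges of the triangulation) and having volume exactly the number of tetrahedra in the triangulation of $N$ times the volume of the regular hyperbolic ideal tetrahedron.
   Context: An ideal triangulation of $N$ consists of a disjoint union $\widetilde{\Delta}=\bigcup_{k=1}^n\widetilde{\Delta}_k$ of standard Euclidean 3-simplices and a collection $\Phi$ of Euclidean isometries (face pairings) identifying the 2-faces of $\widetilde\Delta$ in pairs, such that $N=(\widetilde{\Delta}\setminus\widetilde{\Delta}^{(0)})/\Phi$; $N$ is oriented and all 3-simplices carry the induced orientations. $N^{(1)}$ denotes the (ideal) edges of the triangulation. The regular hyperbolic ideal tetrahedron is the ideal tetrahedron in $\mathbb{H}^3$ with shape parameter $\frac12(1+\sqrt{-3})$, i.e. all dihedral angles equal to $\pi/3$. A hyperbolic cone-manifold structure on $N$ with singular locus contained in $N^{(1)}$ is a length metric on $N$, inducing its topology, which is locally isometric to $\mathbb{H}^3$ away from $N^{(1)}$ and such that each point on an edge $e$ has a neighbourhood isometric to a neighbourhood of a point on the singular axis of the space obtained from a hyperbolic wedge of some angle $\theta_e>0$ (the cone angle, possibly larger than $2\pi$) by identifying its two sides by the rotation about the axis. It is complete if the metric is complete. *)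

(* Defs.v *)
From HB Require Import structures.
From Stdlib Require Import Relation_Operators.
From mathcomp Require Import all_boot all_order all_algebra all_fingroup.
From mathcomp Require Import all_classical all_reals all_analysis.

Set Implicit Arguments.
Unset Strict Implicit.
Unset Printing Implicit Defensive.

Import Order.TTheory GRing.Theory Num.Theory.
Import numFieldNormedType.Exports.

Local Open Scope classical_set_scope.
Local Open Scope ring_scope.

(** * Ideal triangulations *)

(* The face (k, i) is the 2-face of the k-th simplex opposite to its vertex i.
   A Euclidean isometry between two faces of standard simplices is the affine
   map extending a bijection of their vertices; the bijection is recorded as
   the permutation of {0, 1, 2, 3} that also sends the vertex opposite to the
   first face to the vertex opposite to the second one. *)
Record ideal_triangulation (n : nat) := IdealTriangulation {
  mate : 'I_n * 'I_4 -> 'I_n * 'I_4;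
  vertex_map : 'I_n * 'I_4 -> 'S_4;
  mateK : involutive mate;
  mate_neq : forall f, mate f != f;
  vertex_map_opp : forall f, vertex_map f f.2 = (mate f).2;
  vertex_map_mate : forall f, vertex_map (mate f) = ((vertex_map f)^-1)%g
}.

(* The boolean o k tells whether the orientation chosen on the k-th simplex is
   the one given by the order of its vertices. A face pairing reverses the
   orientations induced on the faces iff its permutation is odd with respect to
   positively ordered vertices on both sides. Such a choice of orientations
   prevents an edge from being glued to itself with its ends exchanged, so the
   underlying space is then automatically a 3-manifold. *)
Definition orientable (n : nat) (T : ideal_triangulation n) : Prop :=
  exists o : 'I_n -> bool, forall f : 'I_n * 'I_4,
    odd_perm (vertex_map T f) = (o f.1 == o (mate T f).1).

(* Barycentric coordinates on the standard 3-simplex without its vertices. *)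
Definition punctured_simplex (R : realType) : set 'rV[R]_4 :=
  [set p | [/\ forall i, 0 <= p 0 i, \sum_i p 0 i = 1
             & forall i, p 0 i != 1]].

Definition cells (R : realType) (n : nat) : topologicalType :=
  {k : 'I_n & set_type (@punctured_simplex R)}.

Definition bary (R : realType) (n : nat) (x : cells R n) (i : 'I_4) : R :=
  (set_val (projT2 x) : 'rV[R]_4) 0 i.

Definition face_pairing (R : realType) (n : nat) (T : ideal_triangulation n)
    (x y : cells R n) : Prop :=
  exists i : 'I_4, [/\ bary x i = 0, projT1 y = (mate T (projT1 x, i)).1
    & forall j, bary y (vertex_map T (projT1 x, i) j) = bary x j].

Definition glued (R : realType) (n : nat) (T : ideal_triangulation n) :
    rel (cells R n) :=
  fun x y => `[< clos_refl_sym_trans _ (face_pairing T) x y >].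

Section glued_equiv.
Variables (R : realType) (n : nat) (T : ideal_triangulation n).

Lemma glued_refl : reflexive (@glued R n T).
Proof. by move=> x; apply/asboolP; exact: rst_refl. Qed.

Lemma glued_sym : symmetric (@glued R n T).
Proof.
by move=> x y; apply/idP/idP => /asboolP xy; apply/asboolP; exact: rst_sym.
Qed.

Lemma glued_trans : transitive (@glued R n T).
Proof.
move=> y x z /asboolP xy /asboolP yz; apply/asboolP.
exact: rst_trans xy yz.
Qed.

Definition glued_equiv : equiv_rel (cells R n) :=
  EquivRel (@glued R n T) glued_refl glued_sym glued_trans.
End glued_equiv.

Definition ideal_space (R : realType) (n : nat) (T : ideal_triangulation n) :
    topologicalType :=
  quotient_topology {eq_quot (glued_equiv R T)}%qT.

Definition to_space (R : realType) (n : nat) (T : ideal_triangulation n)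
    (x : cells R n) : ideal_space R T :=
  (\pi_(quotient_topology {eq_quot (glued_equiv R T)}%qT) x)%qT.

(* The image of the open edge joining the vertices i != j of the k-th
   simplex. *)
Definition edge (R : realType) (n : nat) (T : ideal_triangulation n)
    (k : 'I_n) (i j : 'I_4) : set (ideal_space R T) :=
  [set to_space T x | x in
     [set x : cells R n | projT1 x = k /\ bary x i + bary x j = 1]].

Arguments edge {R n} T k i j.

Definition one_skeleton (R : realType) (n : nat) (T : ideal_triangulation n) :
    set (ideal_space R T) :=
  [set p : ideal_space R T | exists k i j, i != j /\ edge T k i j p].

Arguments one_skeleton {R n} T.

(** * Hyperbolic 3-space: the upper half-space model *)

Record H3 (R : realType) := MkH3 {
  hx : R; hy : R; ht : R; ht_gt0 : 0 < ht
}.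

Definition arcosh (R : realType) (u : R) : R := ln (u + Num.sqrt (u ^+ 2 - 1)).

Definition hdist (R : realType) (p q : H3 R) : R :=
  arcosh (1 + ((hx p - hx q) ^+ 2 + (hy p - hy q) ^+ 2 + (ht p - ht q) ^+ 2)
              / (2 * ht p * ht q)).

Definition hedist (R : realType) (p q : H3 R) : \bar R := (hdist p q)%:E.

(* The ideal tetrahedron with vertices 0, 1, oo and z = x + iy, i.e. with shape
   parameter z, as the intersection of the hyperbolic half-spaces
     a (u^2 + v^2 + t^2) + b u + c v + e >= 0
   whose closures contain oo, 0, 1 and z (in the order of the conditions
   below). *)
Definition ideal_tetrahedron (R : realType) (x y : R) : set (H3 R) :=
  [set p | forall a b c e : R,
     0 <= a -> 0 <= e -> 0 <= a + b + e ->
     0 <= a * (x ^+ 2 + y ^+ 2) + b * x + c * y + e ->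
     0 <= a * (hx p ^+ 2 + hy p ^+ 2 + ht p ^+ 2) + b * hx p + c * hy p + e].

Definition regular_ideal_tetrahedron (R : realType) : set (H3 R) :=
  ideal_tetrahedron (1 / 2) (Num.sqrt 3 / 2).

(** * Hyperbolic cones of arbitrary angle *)

(* A wedge of angle theta (possibly larger than 2 pi) in cylindrical
   coordinates around the vertical geodesic x = y = 0 of the upper half-space;
   Euclidean rotations about that line are the hyperbolic ones. *)
Record wedge (R : realType) (theta : R) := MkWedge {
  wrho : R; wphi : R; wt : R;
  wrho_ge0 : 0 <= wrho;
  wphi_bounds : 0 <= wphi <= theta;
  wt_gt0 : 0 < wt
}.

Definition wedge_dev (R : realType) (theta : R) (w : wedge theta) : H3 R :=
  MkH3 (wrho w * cos (wphi w)) (wrho w * sin (wphi w)) (wt_gt0 w).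

Definition sides_identified (R : realType) (theta : R) (w w' : wedge theta) :
    Prop :=
  [/\ wphi w = 0, wphi w' = theta, wrho w = wrho w' & wt w = wt w'].

(* Costs of the chains joining two points. Two points whose angular coordinates
   differ by at most pi lie in a common subwedge of angle at most pi, which
   embeds as a convex subset of hyperbolic space; jumping between identified
   points of the two sides is free. *)
Inductive cone_chain (R : realType) (theta : R) :
    wedge theta -> wedge theta -> R -> Prop :=
| cone_chain_step w w' : `|wphi w - wphi w'| <= pi ->
    cone_chain w w' (hdist (wedge_dev w) (wedge_dev w'))
| cone_chain_glue w w' : sides_identified w w' -> cone_chain w w' 0
| cone_chain_unglue w w' : sides_identified w w' -> cone_chain w' w 0
| cone_chain_trans w w' w'' l l' : cone_chain w w' l -> cone_chain w' w'' l' ->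
    cone_chain w w'' (l + l').

(* The metric of the wedge with its sides identified, as a pseudometric on the
   wedge: points at distance 0 (on the axis, or on the two sides) represent the
   same point of the cone. *)
Definition cone_dist (R : realType) (theta : R) (w w' : wedge theta) : \bar R :=
  ereal_inf [set l%:E | l in cone_chain w w'].

(** * Metric notions *)

(* Distances take values in the extended reals, so that points in different
   connected components can be at distance +oo. A length metric inducing the
   topology is finite on each connected component. *)

(* Some ball around p1 is isometric to the ball of the same radius around p2,
   with p1 sent to p2; d2 may be a pseudometric, in which case points at d2
   distance 0 are identified. *)
Definition locally_isometric (R : realType) (X1 X2 : Type)
    (d1 : X1 -> X1 -> \bar R) (p1 : X1) (d2 : X2 -> X2 -> \bar R) (p2 : X2) :
    Prop :=
  exists (e : R) (f : X1 -> X2),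
    [/\ 0 < e, d2 p2 (f p1) = 0%E,
        forall x y, (d1 p1 x < e%:E)%E -> (d1 p1 y < e%:E)%E ->
          d2 (f x) (f y) = d1 x y
      & forall w, (d2 p2 w < e%:E)%E ->
          exists2 x, (d1 p1 x < e%:E)%E & d2 (f x) w = 0%E].

Definition curve_length (R : realType) (X : Type) (d : X -> X -> \bar R)
    (g : R -> X) : \bar R :=
  ereal_sup [set (\sum_(0 <= m < size s)
                    d (g (nth 0%R (0%R :: s) m)) (g (nth 0%R s m)))%E
            | s in [set s : seq R | itv_partition 0 1 s]].

Definition curves_between (R : realType) (X : topologicalType) (p q : X) :
    set (R -> X) :=
  [set g : R -> X | [/\ {within `[0%R, 1%R], continuous g}, g 0 = p & g 1 = q]].

(* A length metric inducing the given topology. *)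
Record length_metric (R : realType) (X : topologicalType)
    (d : X -> X -> \bar R) : Prop := LengthMetric {
  lm_ge0 : forall p q, (0 <= d p q)%E;
  lm_eq0 : forall p q, d p q = 0%E <-> p = q;
  lm_sym : forall p q, d p q = d q p;
  lm_triangle : forall p q r, (d p r <= d p q + d q r)%E;
  lm_nbhs : forall (p : X) (U : set X), nbhs p U <->
    exists2 e : R, 0 < e & [set q | (d p q < e%:E)%E] `<=` U;
  lm_length : forall p q,
    d p q = ereal_inf [set curve_length d g | g in curves_between p q]
}.

Definition metric_complete (R : realType) (X : Type) (d : X -> X -> \bar R) :
    Prop :=
  forall u : nat -> X,
    (forall e : R, 0 < e -> exists N, forall i j,
       (N <= i)%N -> (N <= j)%N -> (d (u i) (u j) < e%:E)%E) ->
    exists l : X, forall e : R, 0 < e -> exists N, forall i,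
      (N <= i)%N -> (d (u i) l < e%:E)%E.

Definition diameter (R : realType) (X : Type) (d : X -> X -> \bar R)
    (A : set X) : \bar R :=
  ereal_sup ([set 0%E] `|` [set d xy.1 xy.2 | xy in A `*` A]).

(* Volume is the 3-dimensional Hausdorff (outer) measure of the metric, with
   the normalization (volume of the Euclidean unit ball) / 2 ^ 3 = pi / 6 for
   which it agrees with the Riemannian volume on hyperbolic 3-space. *)
Definition volume_delta (R : realType) (X : Type) (d : X -> X -> \bar R)
    (delta : R) (A : set X) : \bar R :=
  ereal_inf [set (\sum_(0 <= i <oo) ((pi / 6)%:E * diameter d (U i) ^+ 3))%E
            | U in [set U : nat -> set X | A `<=` \bigcup_i U i /\
                      forall i, (diameter d (U i) <= delta%:E)%E]].

Definition volume (R : realType) (X : Type) (d : X -> X -> \bar R)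
    (A : set X) : \bar R :=
  ereal_sup [set volume_delta d delta A | delta in [set delta : R | 0 < delta]].

(** * Hyperbolic cone-manifold structures *)

(* The singular locus is contained in the union of the edges, and the cone
   angle theta is constant along each edge. *)
Record hyperbolic_cone_structure (R : realType) (n : nat)
    (T : ideal_triangulation n)
    (d : ideal_space R T -> ideal_space R T -> \bar R) : Prop := HyperbolicConeStructure {
  hcs_length_metric : length_metric d;
  hcs_hyperbolic : forall p : ideal_space R T, ~ one_skeleton T p ->
    exists a : H3 R, locally_isometric d p (@hedist R) a;
  hcs_cone : forall (k : 'I_n) (i j : 'I_4), i != j ->
    exists2 theta : R, 0 < theta & forall p : ideal_space R T, edge T k i j p ->
      exists2 a : wedge theta, wrho a = 0 &
        locally_isometric d p (@cone_dist R theta) a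
}.

(* Main.v *)
Require Import Defs.
From Stdlib Require Import Relation_Operators.
From mathcomp Require Import all_boot all_order all_algebra all_fingroup.
From mathcomp Require Import all_classical all_reals all_analysis.
From mathcomp Require Import ring lra.

(* Realize the regular ideal tetrahedron in the projective model, so that the
   hyperbolic distance of two points of the simplex is an explicit function of
   their barycentric coordinates, invariant under all permutations of the
   vertices: every face pairing is then an isometry. The metric on the glued space
   is the infimum of the lengths of chains of segments in the cells.

   Near an interior point or a point inside a face, chains unfold to hyperbolic
   space, by a reflection across the face. Near a point of an edge, the cells are
   arranged cyclically, each one being a wedge of angle pi / 3, and they unfold to
   a wedge of angle m pi / 3, where m is the length of the cycle; orientability
   ensures that each representative of the point occurs only once in it.

   The volume is additive because tetrahedra meet along faces, which have volume
   zero: the tetrahedron is exhausted, up to its boundary, by sets at positive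
   distance from the boundary, on which the quotient metric and the hyperbolic one
   agree at small scale. *)

Set Implicit Arguments.
Unset Strict Implicit.
Unset Printing Implicit Defensive.

Import Order.TTheory GRing.Theory Num.Theory.
Import numFieldNormedType.Exports.

Local Open Scope classical_set_scope.
Local Open Scope ring_scope.

(** * Hyperbolic functions *)

Section hyperbolic_functions.
Variable R : realType.
Implicit Types x y u : R.

(** The obstacle is that near an edge both metrics to be compared, that of the glued space and that
    of the cone, are infima over chains with arbitrarily many steps. Everything is reduced to single
    steps. A point has at most 24 n representatives, all with the same barycentric coordinates up to
    order, so one radius r, controlled by the smallest positive coordinate, serves for all of them.
    A chain of cost below r is followed by representatives of its centre, which change whenever the
    chain crosses a face. The distance from the centre grows along a chain by at most its cost, so
    every intermediate point stays in the range where one step can be transferred to the other side.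
    The record [local_model] isolates what is left to check at interior, face and edge points.
    Hausdorff measures are compared through 1-Lipschitz maps: from tetrahedra onto cells for the
    upper bound, and backwards on separated cores for the lower one. *)

Definition cosh x := (expR x + expR (- x)) / 2.
Definition sinh x := (expR x - expR (- x)) / 2.

Lemma coshN x : cosh (- x) = cosh x.
Proof. by rewrite /cosh opprK addrC. Qed.

Lemma sinhN x : sinh (- x) = - sinh x.
Proof. by rewrite /sinh opprK -mulNr opprB. Qed.

Lemma coshD x y : cosh (x + y) = cosh x * cosh y + sinh x * sinh y.
Proof. rewrite /cosh /sinh opprD !expRD; by field. Qed.

Lemma sinhD x y : sinh (x + y) = sinh x * cosh y + cosh x * sinh y.
Proof. rewrite /cosh /sinh opprD !expRD; by field. Qed.

Lemma cosh2E x : cosh x ^+ 2 = 1 + sinh x ^+ 2.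
Proof.
have : expR x * expR (- x) = 1 by rewrite -expRD subrr expR0.
rewrite /cosh /sinh => h.
apply/eqP; rewrite -subr_eq0; apply/eqP.
transitivity (expR x * expR (- x) - 1); first by field.
by rewrite h subrr.
Qed.

Lemma sinh0 : sinh 0 = 0 :> R.
Proof. by rewrite /sinh oppr0 subrr mul0r. Qed.

Lemma cosh0 : cosh 0 = 1 :> R.
Proof. by rewrite /cosh oppr0 expR0; by field. Qed.

Lemma sinh_ge0 x : 0 <= x -> 0 <= sinh x.
Proof. by move=> x0; rewrite /sinh divr_ge0// subr_ge0 ler_expR; lra. Qed.

Lemma sinh_gt0 x : 0 < x -> 0 < sinh x.
Proof. by move=> x0; rewrite /sinh divr_gt0// subr_gt0 ltr_expR; lra. Qed.

Lemma cosh_gt0 x : 0 < cosh x.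
Proof. by rewrite /cosh divr_gt0// addr_gt0// expR_gt0. Qed.

Lemma cosh_ge1 x : 1 <= cosh x.
Proof.
have h := cosh2E x; have h0 := cosh_gt0 x; have := sqr_ge0 (sinh x); nra.
Qed.

Lemma sinh_le x y : x <= y -> sinh x <= sinh y.
Proof.
move=> xy; rewrite /sinh ler_pM2r// lerB// ler_expR//; lra.
Qed.

Lemma sinh_lt x y : x < y -> sinh x < sinh y.
Proof.
move=> xy; rewrite /sinh ltr_pM2r// ltrB// ltr_expR//; lra.
Qed.

Lemma le_2sinh x : 0 <= x -> x <= 2 * sinh x.
Proof.
move=> x0.
have h1 : 1 + x <= expR x by exact: expR_ge1Dx.
have h2 : expR x * expR (- x) = 1 by rewrite -expRD subrr expR0.
have h3 := expR_gt0 (- x).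
rewrite /sinh mulrC divfK//.
have h4 : expR (- x) <= 1 by nra.
lra.
Qed.

Lemma arcosh_ge0 u : 1 <= u -> 0 <= arcosh u.
Proof.
by move=> u1; rewrite /arcosh ln_ge0//; have := sqrtr_ge0 (u ^+ 2 - 1); lra.
Qed.

Lemma expR_arcosh u : 1 <= u -> expR (arcosh u) = u + Num.sqrt (u ^+ 2 - 1).
Proof.
move=> u1; rewrite /arcosh lnK// posrE.
by have := sqrtr_ge0 (u ^+ 2 - 1); lra.
Qed.

Lemma expRN_arcosh u : 1 <= u -> expR (- arcosh u) = u - Num.sqrt (u ^+ 2 - 1).
Proof.
move=> u1; rewrite expRN expR_arcosh//.
have s0 := sqrtr_ge0 (u ^+ 2 - 1).
have s2 : Num.sqrt (u ^+ 2 - 1) ^+ 2 = u ^+ 2 - 1 by rewrite sqr_sqrtr//; nra.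
apply: (@mulfI _ (u + Num.sqrt (u ^+ 2 - 1))); first by apply/eqP; lra.
rewrite divff; last by apply/eqP; lra.
transitivity (u ^+ 2 - Num.sqrt (u ^+ 2 - 1) ^+ 2); last by ring.
by rewrite s2; ring.
Qed.

Lemma cosh_arcosh u : 1 <= u -> cosh (arcosh u) = u.
Proof. by move=> u1; rewrite /cosh expR_arcosh// expRN_arcosh//; field. Qed.

Lemma sinh_arcosh u : 1 <= u -> sinh (arcosh u) = Num.sqrt (u ^+ 2 - 1).
Proof. by move=> u1; rewrite /sinh expR_arcosh// expRN_arcosh//; field. Qed.

Lemma arcosh_cosh x : 0 <= x -> arcosh (cosh x) = x.
Proof.
move=> x0; rewrite /arcosh cosh2E addrAC subrr add0r sqrtr_sqr.
rewrite ger0_norm ?sinh_ge0// -[RHS]expRK; congr ln.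
by rewrite /cosh /sinh; field.
Qed.

Lemma arcosh_le u v : 1 <= u -> u <= v -> arcosh u <= arcosh v.
Proof.
move=> u1 uv; have v1 := le_trans u1 uv.
have s1 := sqrtr_ge0 (u ^+ 2 - 1); have s2 := sqrtr_ge0 (v ^+ 2 - 1).
rewrite /arcosh ler_ln ?posrE; try lra.
by rewrite lerD// ler_wsqrtr// lerB// ler_sqr ?nnegrE; lra.
Qed.

Lemma arcosh1 : arcosh 1 = 0 :> R.
Proof. by rewrite /arcosh expr1n subrr sqrtr0 addr0 ln1. Qed.

End hyperbolic_functions.

Section four.
Definition i0 : 'I_4 := @Ordinal 4 0 isT.
Definition i1 : 'I_4 := @Ordinal 4 1 isT.
Definition i2 : 'I_4 := @Ordinal 4 2 isT.
Definition i3 : 'I_4 := @Ordinal 4 3 isT.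

Lemma forall4 (P : 'I_4 -> Prop) : P i0 -> P i1 -> P i2 -> P i3 -> forall i, P i.
Proof.
move=> h0 h1 h2 h3 [[|[|[|[|//]]]] h].
- by rewrite (_ : Ordinal h = i0)//; exact: val_inj.
- by rewrite (_ : Ordinal h = i1)//; exact: val_inj.
- by rewrite (_ : Ordinal h = i2)//; exact: val_inj.
- by rewrite (_ : Ordinal h = i3)//; exact: val_inj.
Qed.

Lemma sum4 (R : nmodType) (F : 'I_4 -> R) :
  \sum_i F i = F i0 + F i1 + F i2 + F i3.
Proof.
rewrite !big_ord_recl big_ord0 addr0 !addrA.
by congr (F _ + F _ + F _ + F _); exact: val_inj.
Qed.
End four.

(** * The projective model *)

Section minkowski.
Variable R : realType.
Implicit Types p q r u v w : 'rV[R]_4.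

Definition tsum u := \sum_i u 0 i.
Definition dot u v := \sum_i u 0 i * v 0 i.
(* The vertices of the simplex are null vectors with pairwise products 1: in the
   projective model of hyperbolic space they span a regular ideal tetrahedron,
   and the barycentric coordinates are homogeneous coordinates on it. *)
Definition mink u v := tsum u * tsum v - dot u v.
(** The future timelike vectors; up to positive scaling they are the points of hyperbolic space. *)
Definition fcone u := 0 < tsum u /\ 0 < mink u u.

Lemma tsumD u v : tsum (u + v) = tsum u + tsum v.
Proof. by rewrite /tsum -big_split; apply: eq_bigr => i _; rewrite mxE. Qed.

Lemma tsumZ a u : tsum (a *: u) = a * tsum u.
Proof. by rewrite /tsum mulr_sumr; apply: eq_bigr => i _; rewrite mxE. Qed.

Lemma dotC u v : dot u v = dot v u.
Proof. by apply: eq_bigr => i _; rewrite mulrC. Qed.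

Lemma dotDl u v w : dot (u + v) w = dot u w + dot v w.
Proof.
by rewrite /dot -big_split; apply: eq_bigr => i _; rewrite mxE mulrDl.
Qed.

Lemma dotZl a u w : dot (a *: u) w = a * dot u w.
Proof. by rewrite /dot mulr_sumr; apply: eq_bigr => i _; rewrite mxE mulrA. Qed.

Lemma minkC u v : mink u v = mink v u.
Proof. by rewrite /mink dotC mulrC. Qed.

Lemma minkDl u v w : mink (u + v) w = mink u w + mink v w.
Proof. by rewrite /mink tsumD dotDl; ring. Qed.

Lemma minkZl a u w : mink (a *: u) w = a * mink u w.
Proof. by rewrite /mink tsumZ dotZl; ring. Qed.

Lemma minkDr u v w : mink w (u + v) = mink w u + mink w v.
Proof. by rewrite minkC minkDl !(minkC w). Qed.

Lemma minkZr a u w : mink w (a *: u) = a * mink w u.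
Proof. by rewrite minkC minkZl (minkC w). Qed.

Definition minkE := (minkDl, minkDr, minkZl, minkZr).

Lemma dot_ge0 u : 0 <= dot u u.
Proof. by apply: sumr_ge0 => i _; rewrite -expr2 sqr_ge0. Qed.

Lemma dot_eq0 u : dot u u = 0 -> u = 0.
Proof.
move=> h; apply/rowP => i; rewrite mxE.
have nn (j : 'I_4) : predT j -> 0 <= u 0 j * u 0 j by rewrite -expr2 sqr_ge0.
by apply/eqP; rewrite -sqrf_eq0 expr2; have -> := psumr_eq0P nn h isT.
Qed.

Lemma dot_cs u v : dot u v ^+ 2 <= dot u u * dot v v.
Proof.
rewrite -subr_ge0 /dot !sum4.
set a0 := u 0 i0; set a1 := u 0 i1; set a2 := u 0 i2; set a3 := u 0 i3.
set b0 := v 0 i0; set b1 := v 0 i1; set b2 := v 0 i2; set b3 := v 0 i3.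
rewrite (_ : _ - _ = (a0 * b1 - a1 * b0) ^+ 2 + (a0 * b2 - a2 * b0) ^+ 2
  + (a0 * b3 - a3 * b0) ^+ 2 + (a1 * b2 - a2 * b1) ^+ 2
  + (a1 * b3 - a3 * b1) ^+ 2 + (a2 * b3 - a3 * b2) ^+ 2); last by ring.
by rewrite !addr_ge0 ?sqr_ge0.
Qed.

(* A vector orthogonal to a timelike one is spacelike: this gives the reversed
   Cauchy-Schwarz inequality and the triangle inequality. *)
Lemma mink_orth u q : fcone q -> mink u q = 0 -> 0 <= - mink u u ?= iff (u == 0).
Proof.
case=> q0 mq muq.
have cs := dot_cs u q; have du := dot_ge0 u; have dq := dot_ge0 q.
have e : dot u q = tsum u * tsum q by move: muq; rewrite /mink; lra.
rewrite e in cs.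
have [u0|u0] := eqVneq u 0.
  rewrite u0 -(scale0r (0 : 'rV[R]_4)) minkZl mul0r oppr0; split => //.
  by rewrite eqxx.
have du' : 0 < dot u u.
  by rewrite lt_neqAle du andbT eq_sym; apply: contra_neq u0; exact: dot_eq0.
have h : tsum u ^+ 2 < dot u u.
  have q2 : 0 < tsum q ^+ 2 by rewrite exprn_gt0.
  rewrite -(ltr_pM2r q2) -exprMn.
  apply: le_lt_trans cs _; rewrite ltr_pM2l//.
  by move: mq; rewrite /mink; lra.
have hlt : 0 < - mink u u by rewrite /mink; lra.
by split; [exact: ltW|rewrite lt_eqF].
Qed.

Lemma mink_cs u q : fcone q -> mink u u * mink q q <= mink u q ^+ 2.
Proof.
move=> fq; have [q0 mq] := fq.
have := (mink_orth (u := mink q q *: u + (- mink u q) *: q) fq).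
rewrite !minkE (minkC q u) => /(_ _) [|+ _]; first by ring.
rewrite (_ : - _ = mink q q * (mink u q ^+ 2 - mink u u * mink q q)); last by ring.
by rewrite pmulr_rge0// subr_ge0.
Qed.

(** In the cone [dot p p < tsum p ^+ 2], so Euclidean Cauchy-Schwarz keeps [dot p q] below
    [tsum p * tsum q]. *)
Lemma mink_gt0 p q : fcone p -> fcone q -> 0 < mink p q.
Proof.
move=> [p0 mp] [q0 mq]; rewrite /mink subr_gt0.
have cs := dot_cs p q.
apply: (le_lt_trans (ler_norm _)).
rewrite -(@ltr_pXn2r _ 2%N)// ?nnegrE//; last by rewrite mulr_ge0// ltW.
rewrite real_normK ?num_real// (le_lt_trans cs)// exprMn.
have dp := dot_ge0 p; have dq := dot_ge0 q.
rewrite /mink in mp mq; rewrite !expr2; nra.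
Qed.

Lemma fconeZ a p : 0 < a -> fcone p -> fcone (a *: p).
Proof.
by move=> a0 [p0 mp]; split; rewrite ?tsumZ ?minkE ?mulrA !mulr_gt0.
Qed.

Lemma fconeD p q : fcone p -> fcone q -> fcone (p + q).
Proof.
move=> fp fq; have := mink_gt0 fp fq; case: fp fq => [? ?] [? ?] ?.
split; first by rewrite tsumD addr_gt0.
by rewrite !minkE (minkC q p); lra.
Qed.

Lemma fcone_comb a b p q : fcone p -> fcone q -> 0 <= a -> 0 <= b -> 0 < a + b ->
  fcone (a *: p + b *: q).
Proof.
move=> fp fq; rewrite le0r => /predU1P[->|a0].
  rewrite scale0r !add0r => _ ?; exact: fconeZ.
rewrite le0r => /predU1P[->|b0] _; first by rewrite scale0r addr0; exact: fconeZ.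
by apply: fconeD; exact: fconeZ.
Qed.

(** Invariant under positive scaling of either argument, so barycentric coordinates, unit vectors
    and [hvec] can be mixed freely. *)
Definition pdist p q := arcosh (mink p q / Num.sqrt (mink p p * mink q q)).

Lemma pdistC p q : pdist p q = pdist q p.
Proof. by rewrite /pdist minkC (mulrC (mink p p)). Qed.

Lemma pdistZl a p q : 0 < a -> pdist (a *: p) q = pdist p q.
Proof.
move=> a0; rewrite /pdist !minkE.
rewrite (_ : _ * mink q q = a ^+ 2 * (mink p p * mink q q)); last by ring.
rewrite sqrtrM ?sqr_ge0// sqrtr_sqr gtr0_norm// -mulf_div divff ?mul1r//; lra.
Qed.

Lemma pdistZr a p q : 0 < a -> pdist p (a *: q) = pdist p q.
Proof. by move=> a0; rewrite pdistC pdistZl// pdistC. Qed.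

Lemma fcone_unit p : fcone p ->
  exists a p1, [/\ 0 < a, p = a *: p1, fcone p1 & mink p1 p1 = 1].
Proof.
move=> fp; have [p0 mp] := fp.
have s0 : 0 < Num.sqrt (mink p p) by rewrite sqrtr_gt0.
exists (Num.sqrt (mink p p)), ((Num.sqrt (mink p p))^-1 *: p); split => //.
- by rewrite scalerA divff ?scale1r// gt_eqF.
- by apply: fconeZ; rewrite ?invr_gt0.
- rewrite !minkE mulrA -invfM -expr2 sqr_sqrtr ?mulVf ?gt_eqF//; exact: ltW.
Qed.

Lemma pdist_unit p q : mink p p = 1 -> mink q q = 1 -> pdist p q = arcosh (mink p q).
Proof. by move=> hp hq; rewrite /pdist hp hq mulr1 sqrtr1 divr1. Qed.

Lemma mink_unit_ge1 p q : fcone p -> fcone q -> mink p p = 1 -> mink q q = 1 ->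
  1 <= mink p q.
Proof.
move=> fp fq hp hq; have := mink_gt0 fp fq; have := mink_cs p fq.
by rewrite hp hq mulr1; nra.
Qed.

Lemma pdist_arg_ge1 p q : fcone p -> fcone q ->
  1 <= mink p q / Num.sqrt (mink p p * mink q q).
Proof.
move=> fp fq; have [p0 mp] := fp; have [q0 mq] := fq.
have s0 : 0 < Num.sqrt (mink p p * mink q q) by rewrite sqrtr_gt0 mulr_gt0.
rewrite ler_pdivlMr// mul1r -(ger0_norm (ltW (mink_gt0 fp fq))).
by rewrite -sqrtr_sqr ler_wsqrtr// mink_cs.
Qed.

Lemma pdist_ge0 p q : fcone p -> fcone q -> 0 <= pdist p q.
Proof. by move=> fp fq; apply: arcosh_ge0; exact: pdist_arg_ge1. Qed.

Lemma pdist_refl p : fcone p -> pdist p p = 0.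
Proof.
move=> [_ mp]; rewrite /pdist -expr2 sqrtr_sqr gtr0_norm// divff ?gt_eqF//.
exact: arcosh1.
Qed.

(** The form is negative definite on the orthogonal complement of [q], where the ordinary
    Cauchy-Schwarz inequality holds. *)
Lemma mink_orth_cs u w q : fcone q -> mink u q = 0 -> mink w q = 0 ->
  mink u w ^+ 2 <= mink u u * mink w w.
Proof.
move=> fq uq wq; have [w1 w2] := mink_orth fq wq.
have [w0|w0] := eqVneq w 0.
  by rewrite w0 -(scale0r (0 : 'rV[R]_4)) !minkE !mul0r mulr0 expr0n.
rewrite (negbTE w0) in w2.
have wlt : 0 < - mink w w by rewrite lt_neqAle w2 w1.
have := (mink_orth (u := mink w w *: u + (- mink u w) *: w) fq).
rewrite !minkE uq wq (minkC w u) => /(_ _) [|+ _]; first by ring.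
rewrite (_ : - (_ + _) =
  (- mink w w) * (mink u u * mink w w - mink u w ^+ 2)); last by ring.
by rewrite pmulr_rge0// subr_ge0.
Qed.

(** Cauchy-Schwarz for the components of [p] and [r] orthogonal to [q] reads [(z - x * y) ^+ 2 <= (x
    ^+ 2 - 1) * (y ^+ 2 - 1)] for the three cosh of the distances, so [z] is at most the cosh of the
    sum. *)
Lemma pdist_triangle p q r : fcone p -> fcone q -> fcone r ->
  pdist p r <= pdist p q + pdist q r.
Proof.
move=> /fcone_unit[a [p1 [a0 -> fp hp]]] /fcone_unit[b [q1 [b0 -> fq hq]]].
move=> /fcone_unit[c [r1 [c0 -> fr hr]]].
rewrite !(pdistZl _ _ a0, pdistZl _ _ b0, pdistZr _ _ b0, pdistZr _ _ c0).
rewrite !pdist_unit//.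
have := mink_unit_ge1 fp fq hp hq; have := mink_unit_ge1 fq fr hq hr.
have := mink_unit_ge1 fp fr hp hr.
have := @mink_orth_cs (p1 + (- mink p1 q1) *: q1) (r1 + (- mink q1 r1) *: q1) q1 fq.
rewrite !minkE hp hq hr (minkC r1 q1) (minkC q1 p1).
move=> /(_ ltac:(ring) ltac:(ring)) cs.
set x := mink p1 q1 in cs *; set y := mink q1 r1 in cs *.
set z := mink p1 r1 in cs * => z1 y1 x1.
have X0 := arcosh_ge0 x1; have Y0 := arcosh_ge0 y1.
rewrite -[leRHS]arcosh_cosh ?addr_ge0//; apply: arcosh_le => //.
rewrite coshD !cosh_arcosh// !sinh_arcosh// -sqrtrM; last by nra.
rewrite -lerBlDl; apply: le_trans (ler_norm _) _.
rewrite -sqrtr_sqr ler_wsqrtr//; nra.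
Qed.

(** Projective segments are geodesics. For unit [p] and [q], the two partial distances have sinh
    equal to [b * S / N] and [a * S / N], where [S] is the sinh of the whole distance and [N] the
    norm of the combination; the addition formula for cosh concludes. *)
Lemma pdist_add p q a b : fcone p -> fcone q -> 0 <= a -> 0 <= b -> 0 < a + b ->
  pdist p (a *: p + b *: q) + pdist (a *: p + b *: q) q = pdist p q.
Proof.
move=> /fcone_unit[s [p1 [s0 -> fp hp]]] /fcone_unit[t [q1 [t0 -> fq hq]]].
move=> a0 b0 ab; rewrite !scalerA !(pdistZl _ _ s0) !(pdistZr _ _ t0).
have : 0 <= a * s by rewrite mulr_ge0// ltW.
have : 0 <= b * t by rewrite mulr_ge0// ltW.
have : 0 < a * s + b * t.
  move: a0; rewrite le0r => /predU1P[a0|a0].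
    by rewrite a0 mul0r add0r mulr_gt0//; lra.
  by rewrite ltr_pwDl ?mulr_gt0 ?mulr_ge0// ltW.
move: (a * s) (b * t) => {a b a0 b0 ab s0 t0 s t} a b ab b0 a0.
have := fcone_comb fp fq a0 b0 ab.
set r := a *: p1 + b *: q1 => fr; have [r0 mr] := fr.
have c1 := mink_unit_ge1 fp fq hp hq.
have mrE : mink r r = a ^+ 2 + b ^+ 2 + 2 * a * b * mink p1 q1.
  by rewrite !minkE hp hq (minkC q1); ring.
have prE : mink p1 r = a + b * mink p1 q1 by rewrite !minkE hp; ring.
have rqE : mink r q1 = a * mink p1 q1 + b by rewrite !minkE hq; ring.
have A1 := pdist_arg_ge1 fp fr; have B1 := pdist_arg_ge1 fr fq.
have A0 := pdist_ge0 fp fr; have B0 := pdist_ge0 fr fq.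
rewrite -[LHS]arcosh_cosh ?addr_ge0// (pdist_unit hp hq); congr arcosh.
rewrite coshD /pdist !cosh_arcosh// !sinh_arcosh//.
rewrite hp hq mul1r mulr1 in A1 B1 *.
set N := Num.sqrt (mink r r).
have N0 : 0 < N by rewrite sqrtr_gt0.
have NE : N ^+ 2 = mink r r by rewrite sqr_sqrtr// ltW.
set C := mink p1 q1 in c1 mrE prE rqE *.
set S := Num.sqrt (C ^+ 2 - 1).
have S0 : 0 <= S by exact: sqrtr_ge0.
have SE : S ^+ 2 = C ^+ 2 - 1 by rewrite sqr_sqrtr//; nra.
have e1 : Num.sqrt ((mink p1 r / N) ^+ 2 - 1) = b * S / N.
  rewrite -[RHS]ger0_norm -?sqrtr_sqr; last by rewrite divr_ge0 ?mulr_ge0// ltW.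
  congr Num.sqrt; rewrite !expr_div_n exprMn SE.
  apply: (@mulIf _ (N ^+ 2)); first by rewrite expf_neq0// gt_eqF.
  rewrite mulrBl !divfK ?expf_neq0 ?gt_eqF// mul1r NE mrE prE; ring.
have e2 : Num.sqrt ((mink r q1 / N) ^+ 2 - 1) = a * S / N.
  rewrite -[RHS]ger0_norm -?sqrtr_sqr; last by rewrite divr_ge0 ?mulr_ge0// ltW.
  congr Num.sqrt; rewrite !expr_div_n exprMn SE.
  apply: (@mulIf _ (N ^+ 2)); first by rewrite expf_neq0// gt_eqF.
  rewrite mulrBl !divfK ?expf_neq0 ?gt_eqF// mul1r NE mrE rqE; ring.
rewrite e1 e2 prE rqE.
apply: (@mulIf _ (N ^+ 2)); first by rewrite expf_neq0// gt_eqF.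
transitivity ((a + b * C) * (a * C + b) + a * b * S ^+ 2).
  by field; rewrite gt_eqF.
by rewrite SE NE mrE; ring.
Qed.

(* For unit vectors p and q at distance a, the arc-length parametrization of
   the geodesic from p to q (up to scaling). *)
Definition geod p q a s := sinh (a - s) *: p + sinh s *: q.

(** The product of the points of parameters [s] and [t] is [sinh a ^+ 2 * cosh (s - t)]. The signs
    of the coefficients will keep the geodesic inside the simplex. *)
Lemma pdist_geod p q s t : fcone p -> fcone q -> mink p p = 1 -> mink q q = 1 ->
  let a := pdist p q in 0 < a -> 0 <= s <= a -> 0 <= t <= a ->
  [/\ fcone (geod p q a s), 0 <= sinh (a - s), 0 <= sinh s,
      0 < sinh (a - s) + sinh s
    & pdist (geod p q a s) (geod p q a t) = `|s - t|].
Proof.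
move=> fp fq hp hq a a0.
have aE : mink p q = cosh a.
  by rewrite /a pdist_unit// cosh_arcosh// mink_unit_ge1.
have key s' : 0 <= s' <= a -> [/\ 0 <= sinh (a - s'), 0 <= sinh s',
    0 < sinh (a - s') + sinh s' & fcone (geod p q a s')].
  move=> /andP[s0 sa].
  have h1 : 0 <= sinh (a - s') by rewrite sinh_ge0//; lra.
  have h2 : 0 <= sinh s' by rewrite sinh_ge0.
  have h3 : 0 < sinh (a - s') + sinh s'.
    have [s'0|s'0] := eqVneq s' 0.
      by rewrite s'0 subr0 sinh0 addr0 sinh_gt0.
    by rewrite ltr_wpDl// sinh_gt0// lt_neqAle eq_sym s'0.
  by split => //; exact: fcone_comb.
move=> /key[hs1 hs2 hs3 fs] /key[ht1 ht2 ht3 ft]; split => //.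
have E s' t' : mink (geod p q a s') (geod p q a t') = sinh a ^+ 2 * cosh (s' - t').
  rewrite /geod !minkE hp hq (minkC q p) aE !sinhD !coshD !sinhN !coshN.
  set S := sinh a; set c := cosh s'; set d := cosh t'.
  set x := sinh s'; set y := sinh t'.
  transitivity ((S * c - cosh a * x) * (S * d - cosh a * y) + x * y
   + cosh a * ((S * c - cosh a * x) * y + x * (S * d - cosh a * y))); first by ring.
  transitivity (S ^+ 2 * (c * d) + (1 - cosh a ^+ 2) * x * y); first by ring.
  by rewrite cosh2E -/S; ring.
rewrite /pdist !E !subrr cosh0 !mulr1 -expr2 sqrtr_sqr ger0_norm ?sqr_ge0//.
rewrite mulrAC divff ?mul1r; last by rewrite expf_neq0// gt_eqF// sinh_gt0.
rewrite -[RHS]arcosh_cosh//; congr arcosh.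
by have [_|_] := ger0P (s - t); rewrite ?coshN.
Qed.

Lemma sinh_pdist2 p q : fcone p -> fcone q ->
  sinh (pdist p q) ^+ 2 * (mink p p * mink q q) = mink p q ^+ 2 - mink p p * mink q q.
Proof.
move=> fp fq; have [p0 mp] := fp; have [q0 mq] := fq.
have A1 := pdist_arg_ge1 fp fq.
have mpq : 0 < mink p p * mink q q by rewrite mulr_gt0.
rewrite /pdist sinh_arcosh// sqr_sqrtr; last by nra.
rewrite expr_div_n sqr_sqrtr; last exact: ltW.
by rewrite mulrBl divfK ?gt_eqF// mul1r.
Qed.

Lemma mink_bary p : tsum p = 1 -> mink p p = 1 - dot p p.
Proof. by move=> h; rewrite /mink h mulr1. Qed.

(** The Gram determinant in terms of the displacement. It compares hyperbolic and Euclidean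
    distances: the Euclidean one is bounded uniformly ([dist_le_sinh]), the hyperbolic one only
    where [mink] stays away from 0, that is, away from the ideal vertices ([sinh_le_dist]). *)
Lemma mink_diff p q : tsum p = 1 -> tsum q = 1 ->
  mink p q ^+ 2 - mink p p * mink q q =
  dot p (q - p) ^+ 2 + mink p p * dot (q - p) (q - p).
Proof.
move=> tp tq; rewrite /mink tp tq.
have -> : dot p (q - p) = dot p q - dot p p.
  by rewrite dotC dotDl -scaleN1r dotZl dotC; ring.
have -> : dot (q - p) (q - p) = dot q q - 2 * dot p q + dot p p.
  rewrite dotDl -scaleN1r dotZl !(dotC _ (_ + _)) !dotDl dotZl dotZl (dotC q p); ring.
ring.
Qed.

Lemma dist_le_sinh p q : fcone p -> fcone q -> tsum p = 1 -> tsum q = 1 ->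
  dot (q - p) (q - p) <= sinh (pdist p q) ^+ 2.
Proof.
move=> fp fq tp tq; have := sinh_pdist2 fp fq; rewrite mink_diff//.
have [_ mp] := fp; have [_ mq] := fq.
have := dot_ge0 q; have := sqr_ge0 (dot p (q - p)); have := dot_ge0 (q - p).
have := mink_bary tq; set D := dot (q - p) _ ; set X := sinh _ ^+ 2 => e1 h1 h2 h3 e2.
have h4 : mink p p * D <= mink p p * (X * mink q q) by nra.
rewrite ler_pM2l// in h4; apply: le_trans h4 _.
have : 0 <= X by exact: sqr_ge0.
nra.
Qed.

Lemma coord_le_sinh p q i : fcone p -> fcone q -> tsum p = 1 -> tsum q = 1 ->
  `|p 0 i - q 0 i| <= sinh (pdist p q).
Proof.
move=> fp fq tp tq; have := dist_le_sinh fp fq tp tq => h.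
rewrite -(@ler_pXn2r _ 2%N)// ?nnegrE ?sinh_ge0 ?pdist_ge0//.
apply: le_trans h; rewrite real_normK ?num_real// /dot (bigD1 i)//= !mxE.
rewrite -sqrrN opprB expr2 lerDl; apply: sumr_ge0 => j _.
by rewrite -expr2 sqr_ge0.
Qed.

Lemma sinh_le_dist p q : fcone p -> fcone q -> tsum p = 1 -> tsum q = 1 ->
  sinh (pdist p q) ^+ 2 * (mink p p * mink q q) <= dot (q - p) (q - p).
Proof.
move=> fp fq tp tq; rewrite sinh_pdist2// mink_diff//.
have cs := dot_cs p (q - p); rewrite mink_bary//; lra.
Qed.

End minkowski.

(** * The upper half-space as a projective model *)

Section upper_half_space.
Variable R : realType.
Implicit Types (w : H3 R) (u : 'rV[R]_4) (s : 'S_4).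

Local Notation s3 := (Num.sqrt (3 : R)).

Lemma s3_gt0 : 0 < s3.
Proof. by rewrite sqrtr_gt0. Qed.

Lemma s3_sqr : s3 ^+ 2 = 3.
Proof. by rewrite sqr_sqrtr. Qed.

(* The four ideal vertices are, in this order, 0, oo, exp (i pi / 3) and 1. *)
Definition hvec w : 'rV[R]_4 := \row_i nth 0
  [:: 1 - hx w - hy w / s3; hx w ^+ 2 + hy w ^+ 2 + ht w ^+ 2 - hx w - hy w / s3;
      2 * hy w / s3; hx w - hy w / s3] i.

Lemma hvec0 w : hvec w 0 i0 = 1 - hx w - hy w / s3. Proof. by rewrite mxE. Qed.
Lemma hvec1 w : hvec w 0 i1 =
  hx w ^+ 2 + hy w ^+ 2 + ht w ^+ 2 - hx w - hy w / s3.
Proof. by rewrite mxE. Qed.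
Lemma hvec2 w : hvec w 0 i2 = 2 * hy w / s3. Proof. by rewrite mxE. Qed.
Lemma hvec3 w : hvec w 0 i3 = hx w - hy w / s3. Proof. by rewrite mxE. Qed.
Definition hvecE := (hvec0, hvec1, hvec2, hvec3).

Lemma mink_hvec w w' : mink (hvec w) (hvec w') =
  (hx w - hx w') ^+ 2 + (hy w - hy w') ^+ 2 + ht w ^+ 2 + ht w' ^+ 2.
Proof.
have h := s3_sqr; have h0 := s3_gt0; rewrite /mink /tsum /dot !sum4 !hvecE.
(* Writing [hy] as a multiple of [s3] leaves only squares of [s3], so that [ring] can finish. *)
have -> : hy w = s3 * (hy w / s3) by rewrite mulrC divfK ?gt_eqF.
have -> : hy w' = s3 * (hy w' / s3) by rewrite mulrC divfK ?gt_eqF.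
set a := hy w / s3; set b := hy w' / s3.
rewrite (_ : s3 * a / s3 = a); last by rewrite mulrAC divff ?mul1r ?gt_eqF.
rewrite (_ : s3 * b / s3 = b); last by rewrite mulrAC divff ?mul1r ?gt_eqF.
rewrite (_ : 2 * (s3 * a) / s3 = 2 * a); last by field; rewrite gt_eqF.
rewrite (_ : 2 * (s3 * b) / s3 = 2 * b); last by field; rewrite gt_eqF.
clearbody a b; rewrite -!mulrBr !exprMn h; ring.
Qed.

Lemma mink_hvec_diag w : mink (hvec w) (hvec w) = 2 * ht w ^+ 2.
Proof. by rewrite mink_hvec !subrr; ring. Qed.

Lemma tsum_hvec_gt0 w : 0 < tsum (hvec w).
Proof.
rewrite /tsum sum4 !hvecE; have h := s3_sqr; have h0 := s3_gt0.
have -> : hy w = s3 * (hy w / s3) by rewrite mulrC divfK ?gt_eqF.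
set a := hy w / s3.
rewrite (_ : s3 * a / s3 = a); last by field; rewrite gt_eqF.
rewrite (_ : 2 * (s3 * a) / s3 = 2 * a); last by field; rewrite gt_eqF.
rewrite exprMn h; have := ht_gt0 w.
have := sqr_ge0 (hx w - 1 / 2); have := sqr_ge0 (a - 1 / 6); nra.
Qed.

Lemma fcone_hvec w : fcone (hvec w).
Proof.
split; first exact: tsum_hvec_gt0.
by rewrite mink_hvec_diag mulr_gt0// exprn_gt0// ht_gt0.
Qed.

Lemma hdistE w w' : hdist w w' = pdist (hvec w) (hvec w').
Proof.
have h := ht_gt0 w; have h' := ht_gt0 w'.
rewrite /hdist /pdist; congr arcosh.
rewrite !mink_hvec_diag mink_hvec.
rewrite (_ : 2 * ht w ^+ 2 * _ = (2 * ht w * ht w') ^+ 2); last by ring.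
rewrite sqrtr_sqr gtr0_norm ?mulr_gt0//.
by field; rewrite !gt_eqF.
Qed.

Lemma H3_eq w w' : hx w = hx w' -> hy w = hy w' -> ht w = ht w' -> w = w'.
Proof.
by case: w w' => [x y t h] [x' y' t' h'] /= ? ? ?; subst; congr MkH3;
  exact: bool_irrelevance.
Qed.

Lemma hvec_inj : injective hvec.
Proof.
move=> w w' e; have h0 := s3_gt0.
have e1 := congr1 (fun u : 'rV[R]_4 => u 0 i1) e.
have e2 := congr1 (fun u : 'rV[R]_4 => u 0 i2) e.
have e3 := congr1 (fun u : 'rV[R]_4 => u 0 i3) e.
rewrite /= !hvecE in e1 e2 e3.
have ey : hy w = hy w'.
  by apply: (mulfI (x := 2)) => //; apply: (mulIf (x := s3^-1)).
have ex : hx w = hx w' by move: e3; rewrite ey; lra.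
apply: H3_eq => //.
move: e1; rewrite ey ex => e1.
have e4 : ht w ^+ 2 = ht w' ^+ 2 by lra.
by apply/eqP; rewrite -(@eqrXn2 _ 2%N)// ?ltW ?ht_gt0// e4.
Qed.

(** The left side is the product of [hvec w] with the null vector of the vertex oo; this
    normalization selects [hvec w] on its ray. *)
Lemma hvec_norm w : hvec w 0 i0 + hvec w 0 i2 + hvec w 0 i3 = 1.
Proof. rewrite !hvecE; have := s3_gt0 => ?; by field; rewrite gt_eqF. Qed.

Lemma hvecZ_inj c w w' : hvec w = c *: hvec w' -> w = w'.
Proof.
move=> e; have := hvec_norm w; rewrite e !mxE -!mulrDr.
have /= := hvec_norm w'; rewrite !mxE => -> /eqP; rewrite mulr1 => /eqP c1.
by apply: hvec_inj; rewrite e c1 scale1r.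
Qed.

Lemma fcone_coord u i : fcone u -> u 0 i < tsum u.
Proof.
move=> [t0 m0]; rewrite /mink in m0.
have : u 0 i ^+ 2 <= dot u u.
  rewrite /dot (bigD1 i)//= expr2 lerDl; apply: sumr_ge0 => j _.
  by rewrite -expr2 sqr_ge0.
by nra.
Qed.

Lemma hvec_surj u : fcone u -> exists w c, 0 < c /\ hvec w = c *: u.
Proof.
move=> fu; have [t0 m0] := fu.
have A0 : 0 < u 0 i0 + u 0 i2 + u 0 i3.
  by have := fcone_coord i1 fu; rewrite /tsum sum4; lra.
set A := _ + _ + _ in A0.
have tt : 0 < Num.sqrt (mink u u / 2) / A by rewrite divr_gt0// sqrtr_gt0 divr_gt0.
(* [hvec2] and [hvec3] are solved for the normalized vector [u / A]; the height is forced by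
   [mink_hvec_diag]. *)
exists (@MkH3 R ((u 0 i3 + u 0 i2 / 2) / A) (s3 / 2 * u 0 i2 / A) _ tt), A^-1.
rewrite invr_gt0; split => //; have h0 := s3_gt0.
have An : A != 0 by rewrite gt_eqF.
have sn : s3 != 0 by rewrite gt_eqF.
apply/rowP; apply: forall4; rewrite hvecE !mxE /=.
- by rewrite /A in An *; field; rewrite sn An.
- rewrite !expr_div_n sqr_sqrtr; last by rewrite divr_ge0// ltW.
  rewrite !exprMn s3_sqr /mink /tsum /dot !sum4 /A; rewrite /A in An.
  by field; rewrite sn An.
- by field; rewrite sn An.
- by field; rewrite sn An.
Qed.

(** The coordinates are themselves four of the half-space conditions, one for each face. Conversely,
    any of the defining forms is linear in [hvec w], its coefficients being its values at the four
    vertices, which are nonnegative. *)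
Lemma tetrahedronE w :
  @regular_ideal_tetrahedron R w <-> forall i, 0 <= hvec w 0 i.
Proof.
have h0 := s3_gt0; have h2 := s3_sqr.
split => [H|H a b c e a0 e0 abe abce].
- have q4 : (s3 / 2) ^+ 2 = 3 / 4 by rewrite expr_div_n h2; field.
  have k : s3^-1 * (s3 / 2) = 1 / 2 by field; rewrite gt_eqF.
  have q0 : 0 <= s3^-1 * (s3 / 2) by rewrite k.
  set P := hx w ^+ 2 + hy w ^+ 2 + ht w ^+ 2 in H *.
  apply: forall4; rewrite hvecE -?/P.
  + rewrite (_ : _ - _ = 0 * P + (- 1) * hx w + (- s3^-1) * hy w + 1); last by ring.
    by apply: H; rewrite ?q4 ?mulNr ?k; lra.
  + rewrite (_ : _ - _ = 1 * P + (- 1) * hx w + (- s3^-1) * hy w + 0); last by ring.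
    by apply: H; rewrite ?q4 ?mulNr ?k; lra.
  + rewrite (_ : _ / _ = 0 * P + 0 * hx w + (2 * s3^-1) * hy w + 0); last by ring.
    by apply: H; rewrite -?(mulrA 2) ?k; lra.
  + rewrite (_ : _ - _ = 0 * P + 1 * hx w + (- s3^-1) * hy w + 0); last by ring.
    by apply: H; rewrite ?q4 ?mulNr ?k; lra.
- rewrite (_ : _ + e = hvec w 0 i1 * a + hvec w 0 i0 * e +
    hvec w 0 i3 * (a + b + e) + hvec w 0 i2 *
      (a * ((1 / 2) ^+ 2 + (s3 / 2) ^+ 2) + b * (1 / 2) + c * (s3 / 2) + e)).
    by rewrite !addr_ge0// mulr_ge0.
  rewrite !hvecE expr_div_n (expr_div_n s3) h2.
  by field; rewrite gt_eqF.
Qed.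

Lemma tsum_perm s u : tsum (col_perm s u) = tsum u.
Proof.
rewrite /tsum [RHS](reindex_inj (@perm_inj _ s)).
by apply: eq_bigr => i _; rewrite mxE.
Qed.

Lemma mink_perm s u u' : mink (col_perm s u) (col_perm s u') = mink u u'.
Proof.
rewrite /mink !tsum_perm; congr (_ - _).
rewrite /dot [RHS](reindex_inj (@perm_inj _ s)).
by apply: eq_bigr => i _; rewrite !mxE.
Qed.

Lemma fcone_perm s u : fcone u -> fcone (col_perm s u).
Proof. by rewrite /fcone tsum_perm mink_perm. Qed.

Lemma pdist_perm s u u' : pdist (col_perm s u) (col_perm s u') = pdist u u'.
Proof. by rewrite /pdist !mink_perm. Qed.

Lemma hdist_ge0 w w' : 0 <= hdist w w'.
Proof. by rewrite hdistE pdist_ge0//; exact: fcone_hvec. Qed.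

Lemma hdistC w w' : hdist w w' = hdist w' w.
Proof. by rewrite !hdistE pdistC. Qed.

Lemma hdist_refl w : hdist w w = 0.
Proof. by rewrite hdistE pdist_refl//; exact: fcone_hvec. Qed.

Lemma hdist_triangle w w' w'' : hdist w w'' <= hdist w w' + hdist w' w''.
Proof. by rewrite !hdistE; apply: pdist_triangle; exact: fcone_hvec. Qed.

End upper_half_space.

(** * The standard simplex without its vertices *)

Section punctured.
Variable R : realType.
Implicit Types p q : 'rV[R]_4.
Local Notation punct := (@punctured_simplex R).

Lemma punct_tsum p : punct p -> tsum p = 1.
Proof. by case. Qed.

Lemma punct_lt1 p i : punct p -> p 0 i < 1.
Proof.
case=> p0 p1 pn; rewrite lt_neqAle pn/= -p1 (bigD1 i)//= lerDl.
by apply: sumr_ge0 => j _.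
Qed.

(** Each square [p 0 i * p 0 i] is at most [p 0 i], strictly when the coordinate is positive, so
    [dot p p < 1]: in the closed simplex only the vertices are null. *)
Lemma punct_fcone p : punct p -> fcone p.
Proof.
move=> pp; have [p0 p1 _] := pp.
split; first by rewrite punct_tsum.
have h i : p 0 i * p 0 i <= p 0 i by rewrite ler_piMr// ltW// punct_lt1.
have h' i : 0 < p 0 i -> p 0 i * p 0 i < p 0 i.
  by move=> pi; rewrite gtr_pMr// punct_lt1.
rewrite mink_bary// /dot; move: p1; rewrite !sum4 => p1.
have := p0 i0; rewrite le0r => /predU1P[e0|/h']; last first.
  by have := h i1; have := h i2; have := h i3; lra.
have := p0 i1; rewrite le0r => /predU1P[e1|/h']; last first.
  by have := h i0; have := h i2; have := h i3; lra.
have := p0 i2; rewrite le0r => /predU1P[e2|/h']; last first.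
  by have := h i0; have := h i1; have := h i3; lra.
have := punct_lt1 i3 pp; move: p1; rewrite e0 e1 e2; lra.
Qed.

Lemma fcone_punct p : tsum p = 1 -> (forall i, 0 <= p 0 i) -> fcone p -> punct p.
Proof.
move=> tp p0 fp; split => // i; rewrite lt_eqF//.
by rewrite -tp fcone_coord.
Qed.

Lemma punct_perm s p : punct p -> punct (col_perm s p).
Proof.
move=> pp; have [p0 p1 pn] := pp.
split => [i||i]; rewrite ?mxE//.
by have := tsum_perm s p; rewrite (punct_tsum pp).
Qed.

End punctured.

Lemma col_perm_inj (R : realType) (s : 'S_4) : injective (@col_perm R 1 4 s).
Proof.
move=> u v /(congr1 (col_perm s^-1%g)).
by rewrite -!col_permM !mulVg !col_perm1.
Qed.

Lemma sinh_small (R : realType) (m : R) : 0 < m -> exists2 r : R, 0 < r & sinh r <= m.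
Proof.
move=> m0; exists (ln (1 + m)); first by rewrite ln_gt0//; lra.
rewrite /sinh expRN lnK ?posrE; last by lra.
have h : (1 + m) * (1 + m)^-1 = 1 by rewrite divff//; lra.
have h' : 0 < (1 + m)^-1 by rewrite invr_gt0; lra.
nra.
Qed.

(** Provides one radius for finitely many constraints: coordinates of a point, representatives of a
    class, pairs of sectors. *)
Lemma pos_min (R : realType) (I : finType) (P : I -> R -> Prop) :
  (forall (i : I) a b, 0 < b -> b <= a -> P i a -> P i b) ->
  (forall i : I, exists2 a, 0 < a & P i a) ->
  exists2 a, 0 < a & forall i : I, P i a.
Proof.
move=> Pd Pe; have [f f0 fP] : exists2 f : I -> R, forall i : I, 0 < f i & forall i : I, P i (f i).
  have [f h] := choice (fun i => let: ex_intro2 a h h' := Pe i in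
    ex_intro (fun a => 0 < a /\ P i a) a (conj h h')).
  by exists f => i; have [] := h i.
exists (\big[Num.min/1]_i f i).
  by apply: (big_ind (fun a : R => 0 < a)) => // a b a0 b0; rewrite lt_min a0 b0.
move=> i; apply: (Pd i _ _ _ _ (fP i)).
  by apply: (big_ind (fun a : R => 0 < a)) => // a b a0 b0; rewrite lt_min a0 b0.
exact: bigmin_le.
Qed.

(** * The glued space *)

Section chain_infimum.
Variables (R : realType) (A : Type) (C : A -> A -> R -> Prop).
Hypothesis C_ge0 : forall x y l, C x y l -> 0 <= l.
Hypothesis C_sym : forall x y l, C x y l -> C y x l.
Hypothesis C_trans : forall x y z l l', C x y l -> C y z l' -> C x z (l + l').

(** Common form of the glued metric [gdist] and of [cone_dist], which share the lemmas of this
    section. *)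
Definition chain_inf x y : \bar R := ereal_inf [set l%:E | l in C x y].

Lemma chain_inf_le x y l : C x y l -> (chain_inf x y <= l%:E)%E.
Proof. by move=> c; apply: ereal_inf_lbound; exists l. Qed.

Lemma chain_inf_lt x y l : (chain_inf x y < l)%E -> exists2 l', C x y l' & (l'%:E < l)%E.
Proof. by move=> /ereal_inf_lt[_ [l' c <-]]; exists l'. Qed.

Lemma chain_inf_ge0 x y : (0 <= chain_inf x y)%E.
Proof.
by apply: le_ereal_inf_tmp => _ [l c <-]; rewrite lee_fin; exact: C_ge0 c.
Qed.

Lemma chain_infC x y : chain_inf x y = chain_inf y x.
Proof.
by congr ereal_inf; apply/seteqP; split => _ [l /C_sym c <-]; exists l.
Qed.

Lemma chain_inf_triangle x y z :
  (chain_inf x z <= chain_inf x y + chain_inf y z)%E.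
Proof.
have h1 := chain_inf_ge0 x y; have h2 := chain_inf_ge0 y z.
have [e1|] := eqVneq (chain_inf x y) +oo%E.
  by rewrite e1 addye ?leey// gt_eqF// (lt_le_trans _ h2)// ltNy0.
have [e2|] := eqVneq (chain_inf y z) +oo%E.
  by rewrite e2 addey ?leey// gt_eqF// (lt_le_trans _ h1)// ltNy0.
case E1 : (chain_inf x y) h1 => [a| |]//.
case E2 : (chain_inf y z) h2 => [b| |]// h2 h1 _ _.
apply/lee_addgt0Pr => e e0.
have [l c l1] : exists2 l, C x y l & (l%:E < (a + e / 2)%:E)%E.
  by apply: chain_inf_lt; rewrite E1 lte_fin; lra.
have [l' c' l2] : exists2 l, C y z l & (l%:E < (b + e / 2)%:E)%E.
  by apply: chain_inf_lt; rewrite E2 lte_fin; lra.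
rewrite !lte_fin in l1 l2.
apply: le_trans (chain_inf_le (C_trans c c')) _.
by rewrite -!EFinD lee_fin; lra.
Qed.

End chain_infimum.

(** * Chains in the cells and the glued metric *)

Section cells.
Variables (R : realType) (n : nat) (T : ideal_triangulation n).
Local Notation cell := (cells R n).
Local Notation punct := (@punctured_simplex R).
Implicit Types (x y z : cell) (p : 'rV[R]_4) (i j : 'I_4).

Definition coords x : 'rV[R]_4 := set_val (projT2 x).

Lemma baryE x i : bary x i = coords x 0 i. Proof. by []. Qed.

Lemma coords_punct x : punct (coords x).
Proof. by apply/set_mem; exact: (valP (projT2 x)). Qed.

Definition mkcell (k : 'I_n) p (pp : punct p) : cell :=
  existT _ k (SigSub (mem_set pp) : set_type punct).

Lemma projT1_mkcell k p (pp : punct p) : projT1 (mkcell k pp) = k.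
Proof. by []. Qed.

Lemma coords_mkcell k p (pp : punct p) : coords (mkcell k pp) = p.
Proof. by []. Qed.

Lemma cell_eq x y : projT1 x = projT1 y -> coords x = coords y -> x = y.
Proof.
case: x y => [k p] [k' p']; rewrite /coords/= => e; subst k' => e.
by congr existT; apply: val_inj.
Qed.

Lemma coords_fcone x : fcone (coords x).
Proof. exact: punct_fcone (coords_punct x). Qed.

Lemma coords_tsum x : tsum (coords x) = 1.
Proof. exact: punct_tsum (coords_punct x). Qed.

Lemma coords_ge0 x i : 0 <= coords x 0 i.
Proof. by have [] := coords_punct x. Qed.

Lemma coords_lt1 x i : coords x 0 i < 1.
Proof. exact: punct_lt1 (coords_punct x). Qed.

Hint Resolve coords_fcone coords_tsum coords_ge0 : core.

Definition cdist x y := pdist (coords x) (coords y).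

Lemma cdistC x y : cdist x y = cdist y x. Proof. exact: pdistC. Qed.

Lemma cdist_ge0 x y : 0 <= cdist x y. Proof. exact: pdist_ge0. Qed.

Lemma cdist_refl x : cdist x x = 0. Proof. exact: pdist_refl. Qed.

Lemma cdist_triangle x y z : cdist x z <= cdist x y + cdist y z.
Proof. exact: pdist_triangle. Qed.

Lemma bary_le_sinh x y i : `|bary x i - bary y i| <= sinh (cdist x y).
Proof. by rewrite !baryE; apply: coord_le_sinh. Qed.

Lemma cdist_eq0 x y : projT1 x = projT1 y -> cdist x y = 0 -> x = y.
Proof.
move=> k e; apply: cell_eq => //; apply/rowP => i.
have := bary_le_sinh x y i; rewrite e sinh0 normr_le0 subr_eq0 => /eqP.
by [].
Qed.

Definition paired i x y := [/\ bary x i = 0, projT1 y = (mate T (projT1 x, i)).1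
  & coords x = col_perm (vertex_map T (projT1 x, i)) (coords y)].

Lemma pairedP x y : face_pairing T x y <-> exists i, paired i x y.
Proof.
split=> -[i [b k v]]; exists i; split => //.
  by apply/rowP => j; rewrite mxE; have := v j; rewrite !baryE => ->.
by move=> j; rewrite (baryE x) v mxE.
Qed.

Lemma paired_sym i x y : paired i x y -> paired (mate T (projT1 x, i)).2 y x.
Proof.
move=> [b k v].
have e : (projT1 y, (mate T (projT1 x, i)).2) = mate T (projT1 x, i).
  by rewrite k -surjective_pairing.
rewrite /paired e mateK vertex_map_mate; split => //.
- have := vertex_map_opp T (projT1 x, i) => /= <-.
  by move: b; rewrite !baryE v mxE.
- by rewrite v -col_permM mulVg col_perm1.
Qed.

Lemma face_pairing_sym x y : face_pairing T x y -> face_pairing T y x.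
Proof. by move=> /pairedP[i /paired_sym h]; apply/pairedP; eexists; exact: h. Qed.

Lemma paired_ex i x : bary x i = 0 -> exists y, paired i x y.
Proof.
move=> b.
have pp := punct_perm (vertex_map T (projT1 x, i))^-1%g (coords_punct x).
exists (mkcell (mate T (projT1 x, i)).1 pp); split => //.
by rewrite coords_mkcell -col_permM mulgV col_perm1.
Qed.

(** A face pairing is the restriction of a coordinate permutation, which preserves [mink]. *)
Lemma paired_cdist i x y x' y' : projT1 x = projT1 x' ->
  paired i x y -> paired i x' y' -> cdist y y' = cdist x x'.
Proof.
by move=> k [_ _ v] [_ _ v']; rewrite /cdist v v' -k pdist_perm.
Qed.

Lemma paired_proj i x y x' y' : projT1 x = projT1 x' ->
  paired i x y -> paired i x' y' -> projT1 y = projT1 y'.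
Proof. by move=> k [_ kx _] [_ kx' _]; rewrite kx kx' k. Qed.

Inductive chain : cell -> cell -> R -> Prop :=
| chain_step x y : projT1 x = projT1 y -> chain x y (cdist x y)
| chain_glue x y : face_pairing T x y -> chain x y 0
| chain_trans x y z l l' : chain x y l -> chain y z l' -> chain x z (l + l').

Lemma chain_refl x : chain x x 0.
Proof. by rewrite -(cdist_refl x); exact: chain_step. Qed.

Lemma chain_sym x y l : chain x y l -> chain y x l.
Proof.
elim=> [{}x {}y k|{}x {}y g|{}x {}y z {}l l' _ h _ h'].
- by rewrite cdistC; exact: chain_step.
- by apply: chain_glue; exact: face_pairing_sym.
- by rewrite addrC; apply: chain_trans h.
Qed.

Lemma chain_ge0 x y l : chain x y l -> 0 <= l.
Proof.
by elim=> [*|*|*]; rewrite ?cdist_ge0 ?addr_ge0.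
Qed.

Lemma glued_chain x y : glued T x y -> chain x y 0.
Proof.
move=> /asboolP; elim=> [{}x {}y g|{}x|{}x {}y _|{}x {}y z _ h _ h'].
- exact: chain_glue.
- exact: chain_refl.
- exact: chain_sym.
- by rewrite -(addr0 0); exact: chain_trans h h'.
Qed.

Lemma chain_lip (F : cell -> R) :
  (forall x y, face_pairing T x y -> F x = F y) ->
  (forall x y, projT1 x = projT1 y -> `|F x - F y| <= cdist x y) ->
  forall x y l, chain x y l -> `|F x - F y| <= l.
Proof.
move=> Fg Fs x y l; elim=> [{}x {}y k|{}x {}y g|{}x {}y z {}l l' _ h _ h'].
- exact: Fs.
- by rewrite (Fg _ _ g) subrr normr0.
- by apply: le_trans (lerD h h'); rewrite -{1}(subrK (F y) (F x)) -addrA ler_normD.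
Qed.

(** A representative of a class is thus determined by its cell and a permutation. This finiteness
    yields uniform radii, by [pos_min] over ['I_n * 'S_4]. *)
Lemma glued_perm x y : glued T x y -> exists s : 'S_4, coords x = col_perm s (coords y).
Proof.
move=> /asboolP; elim=> [{}x {}y /pairedP[i [_ _ ->]]|{}x|{}x {}y _ [s e]
  |{}x {}y z _ [s ->] _ [s' ->]].
- by eexists.
- by exists 1%g; rewrite col_perm1.
- by exists s^-1%g; rewrite e -col_permM mulVg col_perm1.
- by exists (s * s')%g; rewrite col_permM.
Qed.

Definition gdist x y : \bar R := chain_inf chain x y.

Lemma gdist_le x y l : chain x y l -> (gdist x y <= l%:E)%E.
Proof. exact: chain_inf_le. Qed.

Lemma gdist_lt x y l : (gdist x y < l%:E)%E -> exists2 l', chain x y l' & l' < l.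
Proof. by move=> h; have [l' c] := chain_inf_lt h; rewrite lte_fin; exists l'. Qed.

Lemma gdist_ge0 x y : (0 <= gdist x y)%E.
Proof. exact: chain_inf_ge0 chain_ge0 _ _. Qed.

Lemma gdist_glued0 x y : glued T x y -> gdist x y = 0%E.
Proof.
move=> /glued_chain/gdist_le h; apply/eqP; rewrite eq_le h/=.
exact: gdist_ge0.
Qed.

Lemma gdistC x y : gdist x y = gdist y x.
Proof. exact: chain_infC chain_sym _ _. Qed.

Lemma gdist_triangle x y z : (gdist x z <= gdist x y + gdist y z)%E.
Proof. exact: chain_inf_triangle chain_ge0 chain_trans _ _ _. Qed.

Local Notation X := (ideal_space R T).

Definition space_rep (P : X) : cell := generic_quotient.repr P.

Lemma space_repK P : to_space T (space_rep P) = P.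
Proof. exact: reprK. Qed.

Lemma to_spaceP x y : to_space T x = to_space T y <-> glued T x y.
Proof.
split=> [/eqmodP //|h]; exact/eqmodP.
Qed.

Lemma space_rep_glued x : glued T (space_rep (to_space T x)) x.
Proof. by apply/to_spaceP; rewrite space_repK. Qed.

Definition sdist (P Q : X) : \bar R := gdist (space_rep P) (space_rep Q).

Lemma sdistE x y : sdist (to_space T x) (to_space T y) = gdist x y.
Proof.
have gx := space_rep_glued x; have gy := space_rep_glued y.
have tri a b c d : glued T a b -> glued T c d -> (gdist a c <= gdist b d)%E.
  move=> ab cd; apply: le_trans (gdist_triangle _ b _) _.
  rewrite (gdist_glued0 ab) add0e; apply: le_trans (gdist_triangle _ d _) _.
  by rewrite (gdistC d) (gdist_glued0 cd) adde0.
by apply/eqP; rewrite eq_le !tri// glued_sym.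
Qed.

Lemma sdist_step x y : projT1 x = projT1 y ->
  (sdist (to_space T x) (to_space T y) <= (cdist x y)%:E)%E.
Proof. by move=> k; rewrite sdistE; apply: gdist_le; exact: chain_step. Qed.

Lemma sdist_ge0 P Q : (0 <= sdist P Q)%E. Proof. exact: gdist_ge0. Qed.

Lemma sdistC P Q : sdist P Q = sdist Q P. Proof. exact: gdistC. Qed.

Lemma sdist_triangle P Q S : (sdist P S <= sdist P Q + sdist Q S)%E.
Proof. exact: gdist_triangle. Qed.

Lemma sdist_refl P : sdist P P = 0%E.
Proof. exact/gdist_glued0/glued_refl. Qed.

(** Within this radius of a representative, any face met also contains the representative, so the
    crossing of that face can be imitated at the representative. *)
Definition good_radius x0 (r : R) := 0 < r /\ forall x q i, glued T x0 x ->
  projT1 x = projT1 q -> cdist x q < r -> bary q i = 0 -> bary x i = 0.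

Lemma good_radius_le x0 r r' : 0 < r' -> r' <= r -> good_radius x0 r -> good_radius x0 r'.
Proof.
by move=> r0 rr [_ h]; split => // x q i g k c; apply: h => //; exact: lt_le_trans rr.
Qed.

Lemma good_radius_ex x0 : exists r, good_radius x0 r.
Proof.
have [m m0 hm] : exists2 m, 0 < m & forall i, bary x0 i = 0 \/ m <= bary x0 i.
  apply: pos_min => [i a b b0 ba [|h]|i]; [by left|by right; exact: le_trans h|].
  have := coords_ge0 x0 i; rewrite le0r => /predU1P[h|h]; first by exists 1; rewrite // ; left.
  by exists (bary x0 i) => //; right.
have [r r0 rm] := sinh_small m0.
exists r; split => // x q i /glued_perm[s e] k c q0.
have := hm (s^-1%g i); rewrite !baryE e mxE permKV => -[//|h].
have := bary_le_sinh x q i; rewrite q0 subr0.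
have := sinh_lt c; move: h; rewrite -baryE.
by move=> h1 h2 h3; have := ler_norm (bary x i); lra.
Qed.

(** The representative [x] is carried along the chain: kept during a step in a cell, and replaced at
    a gluing by its image under the same pairing, at an unchanged distance. *)
Lemma chain_near x0 r x q q' l : good_radius x0 r -> chain q q' l ->
  glued T x0 x -> projT1 x = projT1 q -> cdist x q + l < r ->
  exists x', [/\ glued T x0 x', projT1 x' = projT1 q' & cdist x' q' <= cdist x q + l].
Proof.
move=> gr c; elim: c x => [{}q {}q' k|{}q {}q' /pairedP[i pq]|{}q q1 {}q' {}l l' c h c' h'] x g kx lr.
- exists x; split => //; first by rewrite kx.
  exact: cdist_triangle.
- have [q0 _ _] := pq.
  have x0i : bary x i = 0 by apply: (proj2 gr) q0 => //; move: lr; rewrite addr0.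
  have [x' px] := paired_ex x0i.
  exists x'; split; last by rewrite addr0 (paired_cdist kx px pq).
    apply: glued_trans g _; apply/asboolP/rst_step/pairedP; exists i; exact: px.
  exact: paired_proj kx px pq.
- have l0 := chain_ge0 c'; have [x' [g' k' le']] := h x g kx ltac:(lra).
  have [x'' [g'' k'' le'']] := h' x' g' k' ltac:(lra).
  by exists x''; split => //; lra.
Qed.

Lemma sdist_near x0 r q : good_radius x0 r ->
  (sdist (to_space T x0) (to_space T q) < r%:E)%E ->
  exists x, [/\ glued T x0 x, projT1 x = projT1 q & cdist x q < r].
Proof.
move=> gr; rewrite sdistE => /gdist_lt[l c lr].
have [|x [g k le]] := chain_near gr c (glued_refl T x0) erefl.
  by rewrite cdist_refl add0r.
by exists x; split => //; move: le; rewrite cdist_refl; lra.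
Qed.

Lemma sdist_eq0 P Q : sdist P Q = 0%E <-> P = Q.
Proof.
split=> [|->]; last exact: sdist_refl.
rewrite -(space_repK P) -(space_repK Q); move: (space_rep P) (space_rep Q) => x y h.
have [r gr] := good_radius_ex x.
(* [r'] lies below the distances from [y] to the representatives of [x] in its cell other than [y]
   itself. *)
have [r' r'0 rP] : exists2 r', 0 < r' & forall ks : 'I_n * 'S_4,
    forall x', glued T x x' -> projT1 x' = ks.1 -> col_perm ks.2 (coords x') = coords x ->
    projT1 x' = projT1 y -> cdist x' y < r' -> x' = y.
  apply: pos_min => [ks a b _ ba h' x' g k e ky c|ks].
    by apply: h' => //; exact: lt_le_trans ba.
  have [[x' [g k e ky ne]]|H] := pselect (exists x', [/\ glued T x x', projT1 x' = ks.1,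
      col_perm ks.2 (coords x') = coords x, projT1 x' = projT1 y & x' <> y]).
    exists (cdist x' y).
      rewrite lt_neqAle cdist_ge0 andbT eq_sym; apply/eqP => /(cdist_eq0 ky).
      by [].
    move=> x'' g' k' e' ky' c; exfalso.
    move: c; rewrite (_ : x'' = x') ?ltxx//; apply: cell_eq; first by rewrite k.
    by move: e'; rewrite -e => /col_perm_inj.
  exists 1 => // x' g k e ky _; apply: contrapT => ne; apply: H; exists x'.
  by split.
have m0 : 0 < Num.min r r' by rewrite lt_min r'0 (proj1 gr).
have gm : good_radius x (Num.min r r').
  by apply: good_radius_le gr => //; rewrite ge_min lexx.
have [|x' [g k c]] := sdist_near (q := y) gm; first by rewrite h lte_fin.
have [s e] := glued_perm g.
apply/to_spaceP; rewrite -(rP (projT1 x', s) x')//.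
by move: c; rewrite lt_min => /andP[].
Qed.

End cells.

(** * Topology, non-compactness and completeness *)

Section topology.
Variables (R : realType) (n : nat) (T : ideal_triangulation n).
Local Notation cell := (cells R n).
Local Notation punct := (@punctured_simplex R).
Local Notation X := (ideal_space R T).
Implicit Types (x y z : cell) (p q : 'rV[R]_4).

Lemma nbhs_rV4 p (U : set 'rV[R]_4) : nbhs p U <->
  exists2 e : R, 0 < e & forall q, (forall i, `|p 0 i - q 0 i| < e) -> U q.
Proof.
split => [/nbhs_ballP[e /= e0 h]|[e e0 h]].
  exists e => // q hq; apply: h; split => // i j /=; rewrite ord1.
  exact: hq.
apply/nbhs_ballP; exists e => // q [_ hq]; apply: h => i.
exact: (hq 0 i).
Qed.

Lemma nbhs_cell x (U : set cell) : nbhs x U <->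
  exists2 e : R, 0 < e & forall y, projT1 y = projT1 x ->
    (forall i, `|bary x i - bary y i| < e) -> U y.
Proof.
split.
  case: x => k p [/= W [[V oV <-] Vp] VU].
  have /nbhs_rV4[e e0 h] : nbhs (set_val p) V by exact: open_nbhs_nbhs.
  exists e => // -[k' q] /= kk; subst k' => hq.
  by apply: VU; apply: h.
move=> [e e0 h]; case: x h => k p h.
have hn : nbhs (set_val p : 'rV[R]_4) [set q | forall i, `|set_val p 0 i - q 0 i| < e].
  by apply/nbhs_rV4; exists e.
have hp : nbhs p (set_val @^-1` [set q : 'rV[R]_4 | forall i, `|set_val p 0 i - q 0 i| < e]).
  exact: (@initial_continuous _ _ (set_val : set_type punct -> 'rV[R]_4) p).
apply: (@existT_continuous _ _ k p); apply: filterS hp => q hq.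
by apply: h.
Qed.

Lemma dot_close p q (e : R) : e <= 1 -> (forall i, `|q 0 i| <= 1) ->
  (forall i, `|p 0 i - q 0 i| <= e) -> `|dot p p - dot q q| <= 12 * e.
Proof.
move=> e1 q1 pq.
have h i : `|p 0 i * p 0 i - q 0 i * q 0 i| <= 3 * e.
  have -> : p 0 i * p 0 i - q 0 i * q 0 i = (p 0 i - q 0 i) * (p 0 i - q 0 i + 2 * q 0 i) by ring.
  rewrite normrM mulrC ler_pM//; apply: le_trans (ler_normD _ _) _.
  rewrite normrM ger0_norm//; have := pq i; have := q1 i; lra.
rewrite /dot !sum4.
have -> (a b c d a' b' c' d' : R) : a + b + c + d - (a' + b' + c' + d') =
  (a - a') + (b - b') + (c - c') + (d - d') by ring.
apply: le_trans (ler_normD _ _) _; have := h i3 => h3.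
apply: (@le_trans _ _ (3 * e + 3 * e + 3 * e + 3 * e)); last by lra.
rewrite lerD//; apply: le_trans (ler_normD _ _) _; rewrite lerD//.
by apply: le_trans (ler_normD _ _) _; rewrite lerD.
Qed.

(** [sinh_le_dist] gives [sinh (pdist p q) * m <= 2 * e], where 2 is the square root of the number
    of coordinates; [le_2sinh] gives the other factor 2. *)
Lemma pdist_lip p q (m e : R) : punct p -> punct q -> 0 < m -> m <= mink p p ->
  m <= mink q q -> (forall i, `|p 0 i - q 0 i| <= e) -> pdist p q <= 4 * e / m.
Proof.
move=> pp pq m0 mp mq he.
have fp := punct_fcone pp; have fq := punct_fcone pq.
have e0 : 0 <= e by apply: le_trans (he i0).
have d0 := pdist_ge0 fp fq.
have h := sinh_le_dist fp fq (punct_tsum pp) (punct_tsum pq).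
have hd : dot (q - p) (q - p) <= 4 * e ^+ 2.
  have hi i : (q - p) 0 i * (q - p) 0 i <= e ^+ 2.
    rewrite !mxE -expr2 -sqrrN opprB -real_normK ?num_real//.
    by rewrite ler_sqr ?nnegrE.
  by rewrite /dot sum4; have := hi i0; have := hi i1; have := hi i2; have := hi i3; lra.
have s0 := sinh_ge0 d0.
have hs : sinh (pdist p q) ^+ 2 * m ^+ 2 <= (2 * e) ^+ 2.
  rewrite (_ : (2 * e) ^+ 2 = 4 * e ^+ 2); last by ring.
  apply: le_trans hd; apply: le_trans h.
  rewrite ler_wpM2l ?sqr_ge0// expr2; apply: ler_pM => //; exact: ltW.
have hs' : sinh (pdist p q) * m <= 2 * e.
  have a0 : 0 <= sinh (pdist p q) * m by rewrite mulr_ge0// ltW.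
  have b0 : 0 <= 2 * e by lra.
  by rewrite -(@ler_pXn2r _ 2%N) ?nnegrE// exprMn.
rewrite ler_pdivlMr//; have := le_2sinh d0; nra.
Qed.

Lemma coord_norm_le1 x i : `|coords x 0 i| <= 1.
Proof. by rewrite ger0_norm ?coords_ge0// ltW// coords_lt1. Qed.

Lemma cdist_cont x (e : R) : 0 < e -> exists2 r : R, 0 < r & forall y,
  (forall i, `|bary x i - bary y i| < r) -> cdist x y < e.
Proof.
move=> e0; have [_ m0] := coords_fcone x; set m := mink _ _ in m0.
have m1 : m <= 1 by rewrite /m mink_bary ?coords_tsum//; have := dot_ge0 (coords x); lra.
(* By [dot_close], [12 * r <= m / 2] keeps [mink] above [m / 2] at [y]; the bound of [pdist_lip] is
   then [8 * r / m < e]. *)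
pose r := Num.min (m / 24) (e * m / 9).
have r0 : 0 < r by rewrite /r lt_min !divr_gt0// mulr_gt0.
have r1 : r <= m / 24 by rewrite /r ge_min lexx.
have r2 : r <= e * m / 9 by rewrite /r ge_min lexx orbT.
exists r => // y h.
have hy : m / 2 <= mink (coords y) (coords y).
  have hr i : `|coords y 0 i - coords x 0 i| <= r by rewrite distrC; apply/ltW/h.
  have := @dot_close (coords y) (coords x) r ltac:(lra) (coord_norm_le1 x) hr.
  rewrite /m !mink_bary ?coords_tsum// ler_norml => /andP[_] h2.
  move: r1; rewrite /m mink_bary ?coords_tsum//; lra.
have m2 : 0 < m / 2 by lra.
apply: le_lt_trans (pdist_lip (coords_punct x) (coords_punct y) m2 _ hy (e := r) _) _.
- by rewrite -/m; lra.
- by move=> i; apply/ltW/h.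
- by rewrite ltr_pdivrMr//; nra.
Qed.

Lemma sdist_ball_nbhs (P : X) (e : R) : 0 < e -> nbhs P [set Q | (sdist P Q < e%:E)%E].
Proof.
move=> e0; apply: open_nbhs_nbhs; split; last by rewrite /= sdist_refl lte_fin.
rewrite /open/= /quotient_open openE => y /= hy.
rewrite /interior; apply/nbhs_cell.
have [r hr re] : exists2 r : R, sdist P (to_space T y) = r%:E & r < e.
  have := sdist_ge0 P (to_space T y); move: hy; rewrite /to_space.
  by case: (sdist P _) => [r| |]// + _; rewrite lte_fin; exists r.
have [d d0 hd] := cdist_cont y (e := e - r) ltac:(lra).
exists d => // z kz hz.
change (sdist P (to_space T z) < e%:E)%E.
apply: le_lt_trans (sdist_triangle _ (to_space T y) _) _.
rewrite hr -lteBrDl//; apply: le_lt_trans (sdist_step _ _) _; first by [].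
by rewrite -EFinB lte_fin; exact: hd.
Qed.

(** An open set contains the image of a small ball around each of the finitely many representatives
    of [P]; by [sdist_near], a point close to [P] lies in the image of one of these balls. *)
Lemma nbhs_spaceP (P : X) (U : set X) : nbhs P U <->
  exists2 e : R, 0 < e & [set Q | (sdist P Q < e%:E)%E] `<=` U.
Proof.
split; last by move=> [e e0 eU]; apply: filterS eU _; exact: sdist_ball_nbhs.
rewrite nbhsE => -[V [oV VP] VU].
rewrite -(space_repK P); set x0 := space_rep P.
have [r gr] := good_radius_ex T x0.
have VE x : glued T x0 x -> V (to_space T x).
  by move=> /to_spaceP <-; rewrite space_repK.
have [r' r'0 rP] : exists2 r', 0 < r' & forall ks : 'I_n * 'S_4,
    forall x, glued T x0 x -> projT1 x = ks.1 -> col_perm ks.2 (coords x) = coords x0 ->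
    forall q : cell, projT1 x = projT1 q -> cdist x q < r' -> V (to_space T q).
  apply: pos_min => [ks a b _ ba h x g k e q kq c|ks].
    by apply: (h x) => //; exact: lt_le_trans ba.
  have [[x [g k e]]|H] := pselect (exists x, [/\ glued T x0 x, projT1 x = ks.1
      & col_perm ks.2 (coords x) = coords x0]).
    have : nbhs x (to_space T @^-1` V).
      apply: open_nbhs_nbhs; split; last exact: VE.
      exact: oV.
    move=> /nbhs_cell[d d0 hd].
    have [s s0 sd] := sinh_small d0.
    exists s => // x' g' k' e' q kq c.
    have xx : x' = x.
      apply: cell_eq; first by rewrite k.
      by move: e'; rewrite -e => /col_perm_inj.
    rewrite -{}xx in hd; apply: hd => // i.
    by apply: le_lt_trans (bary_le_sinh _ _ _) _; apply: lt_le_trans sd; exact: sinh_lt.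
  exists 1 => // x g k e; exfalso; apply: H; exists x.
  by split.
have m0 : 0 < Num.min r r' by rewrite lt_min r'0 (proj1 gr).
have gm : good_radius T x0 (Num.min r r').
  by apply: good_radius_le gr => //; rewrite ge_min lexx.
exists (Num.min r r') => // Q /=; rewrite -(space_repK Q) => /(sdist_near gm).
move=> [x [g k c]]; apply: VU.
have [s e] := glued_perm g.
apply: (rP (projT1 x, s) x) => //.
by move: c; rewrite lt_min => /andP[].
Qed.

Definition barycenter : 'rV[R]_4 := const_mx (1 / 4).

Lemma tsum_center : tsum barycenter = 1.
Proof. by rewrite /tsum sum4 !mxE; field. Qed.

Lemma mink_center p : mink barycenter p = 3 / 4 * tsum p.
Proof.
rewrite /mink tsum_center mul1r.
have -> : dot barycenter p = 1 / 4 * tsum p.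
  by rewrite /dot /tsum mulr_sumr; apply: eq_bigr => i _; rewrite mxE.
by field.
Qed.

Lemma fcone_center : fcone barycenter.
Proof. by split; rewrite ?mink_center tsum_center; lra. Qed.

(* The distance to the centre of the tetrahedron depends symmetrically on the
   barycentric coordinates, hence descends to a 1-Lipschitz function on the glued
   space; its sublevel sets are compact, whence completeness. *)
Definition height x := pdist barycenter (coords x).

Lemma height_paired x y : face_pairing T x y -> height x = height y.
Proof.
move=> /pairedP[i [_ _ e]]; rewrite /height e.
rewrite -[in LHS](_ : col_perm (vertex_map T (projT1 x, i)) barycenter = barycenter) ?pdist_perm//.
by apply/rowP => j; rewrite !mxE.
Qed.

Lemma height_lip x y l : chain T x y l -> `|height x - height y| <= l.
Proof.
apply: chain_lip; first exact: height_paired.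
move=> {}x {}y k; have fx := coords_fcone x; have fy := coords_fcone y.
have := pdist_triangle fcone_center fx fy; have := pdist_triangle fcone_center fy fx.
rewrite /height /cdist (pdistC (coords y)) => h1 h2.
by rewrite ler_norml; apply/andP; split; lra.
Qed.

Lemma cosh_height x : cosh (height x) ^+ 2 * mink (coords x) (coords x) = 3 / 4.
Proof.
have fx := coords_fcone x; have [_ mx] := fx.
rewrite /height cosh_arcosh; last exact: pdist_arg_ge1 fcone_center fx.
rewrite !mink_center tsum_center coords_tsum.
rewrite expr_div_n sqr_sqrtr; last by rewrite mulr_ge0 ?ltW//; lra.
by field; rewrite gt_eqF.
Qed.

Lemma height_ge0 x : 0 <= height x.
Proof. by apply: pdist_ge0; [exact: fcone_center|exact: coords_fcone]. Qed.

Lemma cosh_le (a b : R) : 0 <= a -> a <= b -> cosh a <= cosh b.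
Proof.
move=> a0 ab; have b0 := le_trans a0 ab.
rewrite -(@ler_pXn2r _ 2%N) ?nnegrE ?(ltW (cosh_gt0 _))// !cosh2E lerD2l.
by rewrite ler_pXn2r ?nnegrE ?sinh_ge0// sinh_le.
Qed.

(** A bounded height keeps the point away from the ideal vertices, where [mink] vanishes. *)
Lemma height_bound x (B : R) : height x <= B ->
  3 / 4 / cosh B ^+ 2 <= mink (coords x) (coords x).
Proof.
move=> hB; have [_ mx] := coords_fcone x.
rewrite -(cosh_height x) ler_pdivrMr ?exprn_gt0 ?cosh_gt0// mulrC ler_pM2l//.
rewrite ler_pXn2r ?nnegrE ?(ltW (cosh_gt0 _))// cosh_le//; exact: height_ge0.
Qed.

Lemma sdist_height P Q (l : R) : (sdist (T := T) P Q < l%:E)%E ->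
  height (space_rep Q) <= height (space_rep P) + l.
Proof.
move=> /gdist_lt[l' /height_lip c ll].
move: c; rewrite ler_norml => /andP[h1 h2]; lra.
Qed.

Lemma height_unbounded (k : 'I_n) (B : R) : 0 <= B ->
  exists P : X, B <= height (space_rep P).
Proof.
(* The point below tends to a vertex along an edge; there [mink p p = 2 * e * (1 - e)], which is
   less than the bound [3 / 4 / cosh B ^+ 2] of [height_bound]. *)
move=> B0; pose e : R := 1 / (4 * cosh B ^+ 2).
have c1 : 1 <= cosh B ^+ 2 by rewrite exprn_ege1// cosh_ge1.
have c0 : 0 < cosh B ^+ 2 by lra.
have e0 : 0 < e by rewrite divr_gt0// mulr_gt0.
have eE : e * (4 * cosh B ^+ 2) = 1 by rewrite /e divfK// gt_eqF// mulr_gt0.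
have e1 : e <= 1 / 4 by nra.
pose p : 'rV[R]_4 := \row_i nth 0 [:: 1 - e; e; 0; 0] i.
have pp : punct p.
  split; [|by rewrite sum4 !mxE/=; ring|].
    by apply: forall4; rewrite mxE/=; lra.
  by apply: forall4; rewrite mxE/=; apply/eqP; lra.
exists (to_space T (mkcell k pp)); rewrite leNgt; apply/negP => h.
have := space_rep_glued T (mkcell k pp) => /glued_chain/height_lip.
rewrite normr_le0 subr_eq0 => /eqP hE.
have := height_bound (x := mkcell k pp) (B := B); rewrite -hE => /(_ (ltW h)).
rewrite coords_mkcell mink_bary ?punct_tsum// /dot sum4 !mxE/= ler_pdivrMr//.
nra.
Qed.

(** A sequence whose j-th term has height at least j cannot cluster, since the height is bounded on
    every unit ball. *)
Lemma space_not_compact (n_gt0 : (0 < n)%N) : ~ compact [set: X].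
Proof.
move=> cX; have [u uP] := choice (fun j : nat =>
  height_unbounded (Ordinal n_gt0) (ler0n R j)).
have [L [_ cL]] := cX (u @ \oo) _ filterT.
have := cL _ _ _ (sdist_ball_nbhs L ltr01).
set N := Num.truncn (height (space_rep L) + 1).
move=> /(_ [set Q | exists2 j, (N < j)%N & Q = u j]) [|Q /= [[j Nj ->]]].
  by exists N.+1 => // j /= Nj; exists j.
move=> /sdist_height; have := uP j.
have := real_truncnS_gt (num_real (height (space_rep L) + 1)); rewrite -/N => h1.
have : N.+1%:R <= j%:R :> R by rewrite ler_nat.
lra.
Qed.

Lemma space_complete : metric_complete (@sdist R n T).
Proof.
move=> u uC; have [N hN] := uC 1 ltr01.
pose x i := space_rep (u i).
pose B := height (x N) + 1; pose m := 3 / 4 / cosh B ^+ 2.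
have m0 : 0 < m by rewrite !divr_gt0 ?exprn_gt0 ?cosh_gt0.
have xm i : (N <= i)%N -> m <= mink (coords (x i)) (coords (x i)).
  by move=> Ni; apply/height_bound/sdist_height/hN.
(* Pigeonhole: some cell contains infinitely many of the chosen representatives. *)
have [k kP] : exists k, forall M, exists2 i, (M <= i)%N & projT1 (x i) = k.
  apply: contrapT => /forallNP H.
  have H' k : exists M, forall i, (M <= i)%N -> projT1 (x i) <> k.
    apply: contrapT => /forallNP h; apply: (H k) => M.
    apply: contrapT => h'; apply: (h M) => i Mi e; apply: h'.
    by exists i.
  have [f fP] := choice H'.
  apply: (fP (projT1 (x (\max_k f k))) (\max_k f k)) => //.
  exact: leq_bigmax.
(* A compact part of the simplex that avoids the vertices, so that a cluster point of coordinates in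
   it is again a point of a cell. *)
pose A : set 'rV[R]_4 := [set p : 'rV[R]_4 | [/\ forall i, 0 <= p 0 i, tsum p = 1 & m <= mink p p]].
have A1 p i : A p -> `|p 0 i| <= 1.
  move=> [p0 p1 _]; rewrite ger0_norm// -p1 /tsum (bigD1 i)//= lerDl.
  by apply: sumr_ge0 => j _.
have Acl : closed A.
  move=> p Ap.
  have key (e : R) : 0 < e -> e <= 1 -> exists2 q, A q & forall i, `|p 0 i - q 0 i| <= e.
    move=> e0 e1.
    have /Ap[q [Aq /= hq]] : nbhs p [set q : 'rV[R]_4 | forall i, `|p 0 i - q 0 i| < e].
      by apply/nbhs_rV4; exists e.
    by exists q => // i; exact: ltW.
  have sm (e : R) : 0 < e -> exists e', [/\ 0 < e', e' <= 1 & 12 * e' <= e].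
    move=> e0; exists (Num.min 1 (e / 12)); rewrite lt_min ge_min lexx ltr01 divr_gt0//.
    by split => //; rewrite mulrC -ler_pdivlMr// ge_min lexx orbT.
  have t1 : tsum p = 1.
    apply/eqP; rewrite -subr_eq0 -normr_le0; apply/ler_addgt0Pr => e /sm[e' [e'0 e'1 e'e]].
    have [q [_ q1 _] hq] := key _ e'0 e'1; rewrite add0r -q1 /tsum -sumrB.
    apply: le_trans (ler_norm_sum _ _ _) _; rewrite sum4.
    by have := hq i0; have := hq i1; have := hq i2; have := hq i3; lra.
  split => // [i|].
    apply/ler_addgt0Pr => e /sm[e' [e'0 e'1 e'e]].
    have [q [q0 _ _] hq] := key _ e'0 e'1.
    by have := hq i; have := q0 i; rewrite ler_norml => ? /andP[]; lra.
  apply/ler_addgt0Pr => e /sm[e' [e'0 e'1 e'e]].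
  have [q Aq hq] := key _ e'0 e'1; have [_ q1 mq] := Aq.
  have := dot_close e'1 (fun i => A1 q i Aq) hq; rewrite ler_norml => /andP[_].
  by move: mq; rewrite !mink_bary//; lra.
have Aco : compact A.
  pose box := [set v : 'rV[R]_4 | forall i, `[(-1)%R, 1%R]%classic (v ord0 i)].
  apply: (@subclosed_compact _ A box) => //.
    by apply: (@rV_compact R 4 (fun=> `[(-1)%R, 1%R]%classic)) => i; exact: segment_compact.
  by move=> p Ap i /=; rewrite in_itv/= -ler_norml A1.
(* The cluster point is taken along the indices in [D] only; since the sequence is Cauchy, it is the
   limit of the whole sequence. *)
pose D := [set i | projT1 (x i) = k].
have wP : ProperFilter (within D \oo).
  apply: Build_ProperFilter_ex => P; rewrite /within/= => -[M _ hM].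
  have [i Mi ki] := kP M; exists i; exact: hM.
have [|p [Ap pcl]] := Aco ((fun i => coords (x i)) @ within D \oo) _.
  exists N => // i /= Ni Di; split; [exact: coords_ge0|exact: coords_tsum|exact: xm].
have [p0 p1 mp] := Ap.
have pp : punct p by apply: fcone_punct => //; split; [rewrite p1|exact: lt_le_trans mp].
pose L := mkcell k pp; exists (to_space T L) => e e0.
have [M hM] := uC (e / 2) ltac:(by rewrite divr_gt0).
exists M => i Mi.
have [d d0 hd] := cdist_cont L (e := e / 2) ltac:(by rewrite divr_gt0).
have [|q [[j [Mj kj ej]] /= hq]] := pcl [set coords (x j) | j in [set j | (M <= j)%N /\ projT1 (x j) = k]]
    [set q : 'rV[R]_4 | forall i, `|p 0 i - q 0 i| < d] _ (proj2 (nbhs_rV4 _ _) (ex_intro2 _ _ d d0 (fun q h => h))).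
  by exists M => // j /= Mj Dj; exists j.
have Lj : (sdist (to_space T L) (u j) < (e / 2)%:E)%E.
  rewrite -(space_repK (u j)); apply: le_lt_trans (sdist_step _ _) _ => //.
  by rewrite lte_fin; apply: hd => l; rewrite !baryE -/(x j) ej.
rewrite sdistC (splitr e) EFinD.
apply: le_lt_trans (sdist_triangle _ (u j) _) _.
by apply: lteD => //; exact: hM.
Qed.
End topology.

(** * Curves and the length property *)

Section length.
Variables (R : realType) (n : nat) (T : ideal_triangulation n).
Local Notation cell := (cells R n).
Local Notation punct := (@punctured_simplex R).
Local Notation X := (ideal_space R T).

Definition arc (P Q : X) (a : R) := 0 <= a /\ exists g : R -> X,
  [/\ g 0 = P, g a = Q & forall s t, 0 <= s -> s <= t -> t <= a ->
    (sdist (g s) (g t) <= (t - s)%:E)%E].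

Lemma arc_trans P Q S a b : arc P Q a -> arc Q S b -> arc P S (a + b).
Proof.
move=> [a0 [g [g0 ga gl]]] [b0 [h [h0 hb hl]]].
split; first by rewrite addr_ge0.
exists (fun s => if s <= a then g s else h (s - a)); split.
- by rewrite a0.
- case: ifPn => [ab|_]; last by rewrite addrAC subrr add0r.
  have b00 : b = 0 by lra.
  by rewrite b00 addr0 ga -hb b00 h0.
- move=> s t s0 st tab; have [ta|ta] := leP t a.
    by rewrite (le_trans st ta); exact: gl.
  have [sa|sa] := leP s a; last first.
    by rewrite (_ : t - s = t - a - (s - a)); [apply: hl; lra|ring].
  apply: le_trans (sdist_triangle _ Q _) _.
  rewrite (_ : t - s = (a - s) + (t - a - 0)); last by ring.
  rewrite EFinD; apply: leeD; first by rewrite -ga; exact: gl.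
  by rewrite -h0; apply: hl; lra.
Qed.

Lemma arc_refl P : arc P P 0.
Proof.
split => //; exists (fun=> P); split => // s t _ st _.
by rewrite sdist_refl lee_fin subr_ge0.
Qed.

Lemma punct_comb (p q : 'rV[R]_4) (a b : R) : punct p -> punct q -> 0 <= a -> 0 <= b ->
  0 < a + b -> exists c, 0 < c /\ punct (c *: (a *: p + b *: q)).
Proof.
move=> pp pq a0 b0 ab; have [p0 p1 _] := pp; have [q0 q1 _] := pq.
have tE : tsum (a *: p + b *: q) = a + b.
  by rewrite tsumD !tsumZ (punct_tsum pp) (punct_tsum pq) !mulr1.
exists (a + b)^-1; rewrite invr_gt0; split => //; apply: fcone_punct.
- by rewrite tsumZ tE mulVf// gt_eqF.
- move=> i; rewrite !mxE; apply: mulr_ge0; first by rewrite invr_ge0 ltW.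
  by rewrite addr_ge0// mulr_ge0.
- by apply: fconeZ; [rewrite invr_gt0|apply: fcone_comb => //; exact: punct_fcone].
Qed.

Lemma arc_step (x y : cell) : projT1 x = projT1 y ->
  arc (to_space T x) (to_space T y) (cdist x y).
Proof.
move=> k; have [a0|a0] := eqVneq (cdist x y) 0.
  by rewrite a0 (cdist_eq0 k a0); exact: arc_refl.
have a1 : 0 < cdist x y by rewrite lt_neqAle eq_sym a0 cdist_ge0.
split; first exact: ltW.
have [b [p [b0 pE fp hp]]] := fcone_unit (coords_fcone x).
have [c [q [c0 qE fq hq]]] := fcone_unit (coords_fcone y).
set a := cdist x y in a0 a1 *.
have aE : pdist p q = a by rewrite /a /cdist pE qE pdistZl// pdistZr.
(* The geodesic is computed between unit vectors, then each of its points is rescaled to barycentric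
   coordinates, the factor [d] being invisible to [pdist]. *)
have G s : 0 <= s <= a -> exists z : cell, projT1 z = projT1 x /\
    exists2 d, 0 < d & coords z = d *: geod p q a s.
  move=> sa; have [|||_ h1 h2 h3 _] := @pdist_geod _ p q s s fp fq hp hq _ _ _.
  - by rewrite aE.
  - by rewrite aE.
  - by rewrite aE.
  rewrite aE in h1 h3.
  have pE' : p = b^-1 *: coords x by rewrite pE scalerA mulVf ?scale1r// gt_eqF.
  have qE' : q = c^-1 *: coords y by rewrite qE scalerA mulVf ?scale1r// gt_eqF.
  have [|||d [d0 pd]] := @punct_comb (coords x) (coords y) (sinh (a - s) * b^-1)
    (sinh s * c^-1) (coords_punct x) (coords_punct y).
  - by rewrite mulr_ge0// invr_ge0 ltW.
  - by rewrite mulr_ge0// invr_ge0 ltW.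
  - move: h1; rewrite le0r => /predU1P[e|e].
      by move: h3; rewrite e add0r mul0r add0r => ?; rewrite mulr_gt0// invr_gt0.
    apply: ltr_pwDl; first by rewrite mulr_gt0// invr_gt0.
    by rewrite mulr_ge0// invr_ge0 ltW.
  exists (mkcell (projT1 x) pd); split => //; exists d => //.
  by rewrite coords_mkcell /geod pE' qE' !scalerA.
have [g gP] : exists g : R -> cell, forall s, 0 <= s <= a -> projT1 (g s) = projT1 x /\
    exists2 d, 0 < d & coords (g s) = d *: geod p q a s.
  have C (s : R) : exists z : cell, 0 <= s <= a -> projT1 z = projT1 x /\
      exists2 d, 0 < d & coords z = d *: geod p q a s.
    have [/G[z hz]|_] := boolP (0 <= s <= a); first by exists z.
    by exists x.
  have [g gP] := choice C; by exists g.
have gd s t : 0 <= s <= a -> 0 <= t <= a -> cdist (g s) (g t) = `|s - t|.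
  move=> sa ta; have [_ [d d0 e]] := gP _ sa; have [_ [d' d'0 e']] := gP _ ta.
  rewrite /cdist e e' pdistZl// pdistZr//.
  by have [|||_ _ _ _] := @pdist_geod _ p q s t fp fq hp hq; rewrite aE.
have ends s z : 0 <= s <= a -> projT1 z = projT1 x ->
    (exists2 d, 0 < d & coords z = d *: geod p q a s) -> g s = z.
  move=> sa kz [d d0 e]; have [kg [d' d'0 e']] := gP _ sa.
  apply: cell_eq; first by rewrite kg.
  have : tsum (coords (g s)) = tsum (coords z) by rewrite !coords_tsum.
  rewrite e e' !tsumZ => /mulIf -> //.
  by have := coords_tsum z; rewrite e tsumZ => /eqP; apply: contraTneq => ->; rewrite mulr0 eq_sym oner_eq0.
have al : 0 <= a by exact: ltW.
have a00 : 0 <= (0 : R) <= a by rewrite lexx.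
have aa : 0 <= a <= a by rewrite lexx andbT.
have S0 : 0 < sinh a by exact: sinh_gt0.
exists (fun s => to_space T (g s)); split.
- congr to_space; apply: ends => //; exists (b / sinh a); first by rewrite divr_gt0.
  rewrite /geod subr0 sinh0 scale0r addr0 scalerA divfK ?gt_eqF//.
- congr to_space; apply: ends => //; exists (c / sinh a); first by rewrite divr_gt0.
  rewrite /geod subrr sinh0 scale0r add0r scalerA divfK ?gt_eqF//.
- move=> s t s0 st ta.
  have hs : 0 <= s <= a by rewrite s0 (le_trans st).
  have ht : 0 <= t <= a by rewrite ta (le_trans s0).
  apply: le_trans (sdist_step _ _) _.
    by have [-> _] := gP _ hs; have [-> _] := gP _ ht.
  by rewrite gd// distrC ger0_norm// subr_ge0.
Qed.

Lemma chain_arc (x y : cell) l : chain T x y l -> arc (to_space T x) (to_space T y) l.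
Proof.
elim=> [{}x {}y k|{}x {}y g|{}x {}y z {}l l' _ h _ h'].
- exact: arc_step.
- rewrite (_ : to_space T x = to_space T y); first exact: arc_refl.
  by apply/to_spaceP/asboolP/rst_step.
- exact: arc_trans h h'.
Qed.

Lemma curve_length_ge (Y : Type) (d : Y -> Y -> \bar R) (g : R -> Y) :
  (d (g 0%R) (g 1%R) <= curve_length d g)%E.
Proof.
apply: ereal_sup_ubound; exists [:: 1%R]; first exact: itv_partition1.
by rewrite /= big_nat1.
Qed.

Lemma arc_curve P Q a : arc P Q a ->
  exists2 g, curves_between P Q g & (curve_length (@sdist R n T) g <= a%:E)%E.
Proof.
move=> [a0 [g [g0 ga gl]]].
have lip (s t : R) : 0 <= s -> s <= t -> t <= 1 ->
    (sdist (g (a * s)%R) (g (a * t)%R) <= (a * (t - s))%R%:E)%E.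
  move=> s0 st t1; rewrite mulrBr; apply: gl.
  - by rewrite mulr_ge0.
  - by rewrite ler_wpM2l.
  - by rewrite ler_piMr.
exists (fun s => g (a * s)).
  split; rewrite ?mulr0 ?mulr1//.
  apply/subspace_continuousP => s /= s01 U /nbhs_spaceP[e e0 eU].
  (* The Lipschitz constant [a] may be 0, hence [a + 1]. *)
  rewrite /= /within /=; apply/nbhs_ballP; exists (e / (a + 1)) => /=.
    by rewrite divr_gt0//; lra.
  move=> t /=; rewrite /ball/= => st t01; apply: eU => /=.
  have lip' : (sdist (g (a * s)%R) (g (a * t)%R) <= (a * `|s - t|)%R%:E)%E.
    move: s01 t01; rewrite !in_itv/= => /andP[s0 s1] /andP[t0 t1].
    have [ts|st'] := leP t s.
      by rewrite sdistC ger0_norm ?subr_ge0//; exact: lip.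
    by rewrite distrC ger0_norm ?subr_ge0 ?(ltW st')//; apply: lip => //; exact: ltW.
  apply: le_lt_trans lip' _; rewrite lte_fin.
  move: st; rewrite ltr_pdivlMr; last by lra.
  have := normr_ge0 (s - t); nra.
apply: ge_ereal_sup => _ [s [ps ls] <-].
have key (s' : seq R) (x : R) : 0 <= x -> path <%R x s' -> last x s' <= 1 ->
    (\sum_(0 <= m < size s') sdist (g (a * nth 0 (x :: s') m)%R)
       (g (a * nth 0 s' m)%R) <= (a * (last x s' - x))%R%:E)%E.
  elim: s' x => [|t s' ih] x x0 /=.
    by rewrite big_nil subrr mulr0.
  move=> /andP[xt pt] l1; rewrite big_nat_recl//=.
  have tl : t <= last t s'.
    have := pt; elim: (s') (t) => //= b s'' ihs c /andP[cb /ihs]; exact: le_trans (ltW cb).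
  have {}ih := ih t (le_trans x0 (ltW xt)) pt l1.
  rewrite (_ : a * (last t s' - x) = a * (t - x) + a * (last t s' - t)); last by ring.
  rewrite EFinD; apply: leeD; last exact: ih.
  by apply: lip => //; [exact: ltW|exact: le_trans l1].
have := key s 0 (lexx 0) ps; rewrite (eqP ls) subr0 mulr1; exact.
Qed.

Lemma sdist_length P Q :
  sdist P Q = ereal_inf [set curve_length (@sdist R n T) g | g in curves_between P Q].
Proof.
apply/eqP; rewrite eq_le; apply/andP; split.
  apply: le_ereal_inf_tmp => _ [g [_ <- <-] <-]; exact: curve_length_ge.
apply: le_ereal_inf_tmp => _ [l /chain_arc h <-].
rewrite !space_repK in h; have [g gPQ gl] := arc_curve h.
by apply: ereal_inf_le; exists (curve_length (@sdist R n T) g) => //; exists g.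
Qed.

Lemma space_length_metric : length_metric (@sdist R n T).
Proof.
split.
- exact: sdist_ge0.
- exact: sdist_eq0.
- exact: sdistC.
- exact: sdist_triangle.
- exact: nbhs_spaceP.
- exact: sdist_length.
Qed.

End length.

(** * Local isometries *)

Section local_model.
Variables (R : realType) (n : nat) (T : ideal_triangulation n).
Local Notation cell := (cells R n).
Local Notation X := (ideal_space R T).

Definition near_rep (I : Type) (x : I -> cell) (r : R) (s : I) (q : cell) :=
  projT1 (x s) = projT1 q /\ cdist (x s) q < r.

(* A pseudometric space M modelling the glued space around the class of x0: I
   indexes the points x s glued to x0, and Rel s q w says that w is the point
   of M developed from the point q of the cell of x s. *)
Record local_model (M : Type) (dM : M -> M -> \bar R) (a : M) (x0 : cell) (r : R)
    (I : Type) (x : I -> cell) (Rel : I -> cell -> M -> Prop) : Prop := LocalModel {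
  lmod_ge0 : forall w w', (0 <= dM w w')%E;
  lmod_sym : forall w w', dM w w' = dM w' w;
  lmod_tri : forall w w' w'', (dM w w'' <= dM w w' + dM w' w'')%E;
  lmod_gt0 : 0 < r;
  lmod_base : exists s, x s = x0;
  lmod_glued : forall s, to_space T (x s) = to_space T x0;
  lmod_ex : forall s q, near_rep x r s q -> exists w, Rel s q w;
  lmod_dist : forall s q w, near_rep x r s q -> Rel s q w ->
    dM a w = (cdist (x s) q)%:E;
  lmod_step : forall s q q' w w', near_rep x r s q -> near_rep x r s q' ->
    Rel s q w -> Rel s q' w' -> (dM w w' <= (cdist q q')%:E)%E;
  lmod_glue : forall s q q', near_rep x r s q -> face_pairing T q q' ->
    exists s', [/\ near_rep x r s' q', cdist (x s') q' = cdist (x s) q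
      & forall w w', Rel s q w -> Rel s' q' w' -> dM w w' = 0%E];
  lmod_uniq : forall s s' q, near_rep x r s q -> near_rep x r s' q -> s = s';
  lmod_surj : forall w, (dM a w < r%:E)%E ->
    exists s q, near_rep x r s q /\ Rel s q w;
  lmod_back : forall s s' q q' w w', near_rep x r s q -> near_rep x r s' q' ->
    Rel s q w -> Rel s' q' w' -> (dM a w + dM w w' < r%:E)%E ->
    (sdist (to_space T q) (to_space T q') <= dM w w')%E
}.

(** Following a short chain sheet by sheet ([walk]) bounds [dM] by its cost, and [lmod_back] gives
    the reverse inequality. The radius is divided by 3 because a competing chain between two points
    of the small ball either costs at least [r / 3 + r / 3], where the detour through the centre is
    already shorter, or stays within distance [r] of the centre. *)
Lemma local_model_isometric (M : Type) (dM : M -> M -> \bar R) (a : M) (x0 : cell)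
    (r : R) (I : Type) (x : I -> cell) (Rel : I -> cell -> M -> Prop) :
  local_model dM a x0 r x Rel ->
  locally_isometric (@sdist R n T) (to_space T x0) dM a.
Proof.
move=> L; have r0 := lmod_gt0 L.
have walk q q' l : chain T q q' l -> forall s, near_rep x r s q -> cdist (x s) q + l < r ->
    exists s', [/\ near_rep x r s' q', cdist (x s') q' <= cdist (x s) q + l
      & forall w w', Rel s q w -> Rel s' q' w' -> (dM w w' <= l%:E)%E].
  elim=> [{}q {}q' k|{}q {}q' g|{}q q1 {}q' {}l l' c h c' h'] s nq lr.
  - have nq' : near_rep x r s q'.
      split; first by rewrite -k; case: nq.
      exact: le_lt_trans (cdist_triangle _ _ _) lr.
    exists s; split => //; first exact: cdist_triangle.
    by move=> w w'; exact: (lmod_step L).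
  - have [s' [nq' e h]] := lmod_glue L nq g.
    exists s'; split => //; first by rewrite e addr0.
    by move=> w w' hw hw'; rewrite (h _ _ hw hw').
  - have l0 := chain_ge0 c'; have [s1 [n1 le1 d1]] := h s nq ltac:(lra).
    have [s2 [n2 le2 d2]] := h' s1 n1 ltac:(lra).
    exists s2; split => //; first by lra.
    move=> w w' hw hw'; have [w1 hw1] := lmod_ex L n1.
    apply: le_trans (lmod_tri L _ w1 _) _; rewrite EFinD.
    by apply: leeD; [exact: d1|exact: d2].
have [s0 xs0] := lmod_base L.
have n0 : near_rep x r s0 x0 by split; rewrite xs0// cdist_refl.
have U q l s : chain T x0 q l -> l < r -> near_rep x r s q -> cdist (x s) q <= l.
  move=> c lr nq; have [|s' [n' le' _]] := walk _ _ _ c s0 n0.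
    by rewrite xs0 cdist_refl add0r.
  by rewrite (lmod_uniq L nq n'); move: le'; rewrite xs0 cdist_refl add0r.
have Near q (e : R) : (sdist (to_space T x0) (to_space T q) < e%:E)%E -> e <= r ->
    exists s, near_rep x r s q /\ cdist (x s) q < e.
  rewrite sdistE => /gdist_lt[l c le] er; have lr : l < r by exact: lt_le_trans er.
  have [|s' [n' le' _]] := walk _ _ _ c s0 n0; first by rewrite xs0 cdist_refl add0r.
  exists s'; split => //; move: le'; rewrite xs0 cdist_refl add0r => ?; lra.
(* [f] picks one development of one nearby representative, and the default value [a] for points
   without any. *)
have [f fP] : exists f : X -> M, forall Q,
    (exists s q, [/\ near_rep x r s q, to_space T q = Q & Rel s q (f Q)]) \/
    ~ (exists s q, near_rep x r s q /\ to_space T q = Q).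
  have C Q : exists w, (exists s q, [/\ near_rep x r s q, to_space T q = Q & Rel s q w]) \/
      ~ (exists s q, near_rep x r s q /\ to_space T q = Q).
    have [[s [q [nq qQ]]]|H] := pselect (exists s q, near_rep x r s q /\ to_space T q = Q).
      have [w hw] := lmod_ex L nq; exists w; left; exists s, q.
      by split.
    by exists a; right.
  have [f fP] := choice C; by exists f.
have fB Q (e : R) : (sdist (to_space T x0) Q < e%:E)%E -> e <= r ->
    exists s q, [/\ near_rep x r s q, to_space T q = Q, Rel s q (f Q) & cdist (x s) q < e].
  move=> hQ er; have hQ' := hQ; rewrite -(space_repK Q) in hQ'.
  have [s1 [n1 _]] := Near _ _ hQ' er.
  have [[s [q [nq qQ hw]]]|H] := fP Q; last first.
    by exfalso; apply: H; exists s1, (space_rep Q); exact: (conj n1 (space_repK Q)).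
  exists s, q; split => //.
  move: hQ; rewrite -qQ sdistE => /gdist_lt[l c le].
  have lr := lt_le_trans le er; exact: le_lt_trans (U _ _ _ c lr nq) le.
exists (r / 3), f; split.
- by rewrite divr_gt0.
- have [|s [q [nq qQ hw _]]] := fB (to_space T x0) r _ (lexx r).
    by rewrite sdist_refl lte_fin.
  have c : chain T x0 q 0 by apply/glued_chain/to_spaceP.
  have h := U _ _ _ c r0 nq.
  rewrite (lmod_dist L nq hw); congr EFin; apply/eqP.
  by rewrite eq_le h cdist_ge0.
- move=> Q Q' hQ hQ'.
  have [|s [q [nq qQ hw cq]]] := fB _ _ hQ; first by lra.
  have [|s' [q' [nq' qQ' hw' cq']]] := fB _ _ hQ'; first by lra.
  have dw := lmod_dist L nq hw; have dw' := lmod_dist L nq' hw'.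
  have tri : (dM (f Q) (f Q') <= (cdist (x s) q + cdist (x s') q')%:E)%E.
    by apply: le_trans (lmod_tri L _ a _) _; rewrite (lmod_sym L _ a) dw dw' EFinD.
  rewrite -{2}qQ -{2}qQ'; apply/eqP; rewrite eq_le; apply/andP; split.
    rewrite sdistE; apply: le_ereal_inf_tmp => _ [l c <-].
    have [l2|l2] := ltP l (r / 3 + r / 3); last first.
      by apply: le_trans tri _; rewrite lee_fin; lra.
    have [|s2 [n2 _ h]] := walk _ _ _ c s nq; first by lra.
    by apply: h => //; rewrite (lmod_uniq L n2 nq').
  apply: (lmod_back L nq nq') => //; rewrite dw.
  apply: (@le_lt_trans _ _ ((cdist (x s) q)%:E + (cdist (x s) q + cdist (x s') q')%:E)%E).
    by rewrite leeD2l.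
  by rewrite -EFinD lte_fin; lra.
- move=> w hw; have [|s [q [nq hr]]] := lmod_surj L (w := w).
    by apply: lt_trans hw _; rewrite lte_fin; lra.
  have dq : (sdist (to_space T x0) (to_space T q) < (r / 3)%:E)%E.
    rewrite -(lmod_glued L s); apply: le_lt_trans (sdist_step _ _) _; first by case: nq.
    by rewrite -(lmod_dist L nq hr).
  exists (to_space T q) => //.
  have [|s' [q' [nq' qQ' hw' cq']]] := fB _ _ dq; first by lra.
  have c : chain T q' q 0 by apply/glued_chain/to_spaceP.
  have [|s2 [n2 _ h]] := walk _ _ _ c s' nq'; first by case: nq'; rewrite addr0.
  apply/eqP; rewrite eq_le (lmod_ge0 L) andbT; apply: h => //.
  by rewrite (lmod_uniq L n2 nq).
Qed.

End local_model.

(** * Interior points and face points *)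

Section reflection.
Variable R : realType.
Implicit Types (u v : 'rV[R]_4) (i : 'I_4).

(* The reflection for the form [mink] in the hyperplane u_i = 0, which contains
   the i-th face of the tetrahedron. *)
Definition refl i u : 'rV[R]_4 := \row_j (if j == i then - u 0 i else u 0 j + u 0 i).

Lemma reflK i : involutive (refl i).
Proof.
by move=> u; apply/rowP => j; rewrite !mxE eqxx; have [->|ji] := eqVneq j i; ring.
Qed.

Lemma reflZ i a u : refl i (a *: u) = a *: refl i u.
Proof. by apply/rowP => j; rewrite !mxE; case: ifPn => _; ring. Qed.

Lemma refl_id i u : u 0 i = 0 -> refl i u = u.
Proof.
move=> h; apply/rowP => j; rewrite !mxE; case: ifPn => [/eqP->|_].
  by rewrite h oppr0.
by rewrite h addr0.
Qed.

Lemma tsum_refl i u : tsum (refl i u) = tsum u + u 0 i.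
Proof.
by rewrite /tsum !sum4; move: i; apply: forall4; rewrite !mxE/=; ring.
Qed.

Lemma mink_refl i u v : mink (refl i u) (refl i v) = mink u v.
Proof.
rewrite /mink !tsum_refl /tsum /dot !sum4.
by move: i; apply: forall4; rewrite !mxE/=; ring.
Qed.

Lemma fcone_coordN u i : fcone u -> - tsum u < u 0 i.
Proof.
move=> [t0 m0]; rewrite /mink in m0.
have : u 0 i ^+ 2 <= dot u u.
  rewrite /dot (bigD1 i)//= expr2 lerDl; apply: sumr_ge0 => j _.
  by rewrite -expr2 sqr_ge0.
by nra.
Qed.

Lemma fcone_refl i u : fcone u -> fcone (refl i u).
Proof.
move=> fu; have := fcone_coordN i fu; case: fu => t0 m0 h.
by split; rewrite ?mink_refl// tsum_refl; lra.
Qed.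

Lemma pdist_refl2 i u v : pdist (refl i u) (refl i v) = pdist u v.
Proof. by rewrite /pdist !mink_refl. Qed.

Lemma fcone_normalize u : fcone u -> exists c, [/\ 0 < c, fcone (c *: u) & tsum (c *: u) = 1].
Proof.
move=> fu; have [t0 _] := fu; exists (tsum u)^-1; rewrite invr_gt0.
by split => //; [apply: fconeZ; rewrite ?invr_gt0|rewrite tsumZ mulVf// gt_eqF].
Qed.

End reflection.

Section radius.
Variables (R : realType) (n : nat) (T : ideal_triangulation n).
Local Notation cell := (cells R n).
Implicit Types (x y z : cell).

(** Unlike [good_radius], this also controls vectors outside the simplex: by [pos_radius_pos],
    coordinates positive at a representative remain positive within distance [r] in the whole
    hyperbolic space. *)
Definition pos_radius x0 (r : R) :=
  0 < r /\ forall i, bary x0 i = 0 \/ sinh r <= bary x0 i.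

Lemma pos_radius_le x0 r r' : 0 < r' -> r' <= r -> pos_radius x0 r -> pos_radius x0 r'.
Proof.
move=> r0 rr [_ h]; split => // i; have [->|h'] := h i; first by left.
by right; apply: le_trans h'; exact: sinh_le.
Qed.

Lemma pos_radius_ex x0 : exists r, pos_radius x0 r.
Proof.
have [m m0 hm] : exists2 m, 0 < m & forall i, bary x0 i = 0 \/ m <= bary x0 i.
  apply: pos_min => [i a b b0 ba [|h]|i]; [by left|by right; exact: le_trans h|].
  have := coords_ge0 x0 i; rewrite le0r => /predU1P[h|h]; first by exists 1; rewrite // ; left.
  by exists (bary x0 i) => //; right.
have [r r0 rm] := sinh_small m0.
exists r; split => // i; have [->|h] := hm i; first by left.
by right; exact: le_trans h.
Qed.

Lemma pos_radius_pos x0 r x u i : pos_radius x0 r -> glued T x0 x -> fcone u ->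
  tsum u = 1 -> pdist (coords x) u < r -> bary x i != 0 -> 0 < u 0 i.
Proof.
move=> [r0 h] /glued_perm[s e] fu tu c xi.
have := h (s^-1%g i); rewrite !baryE e mxE permKV => -[h'|h'].
  by move: xi; rewrite baryE h' eqxx.
have := coord_le_sinh i (coords_fcone x) fu (coords_tsum x) tu.
rewrite ler_norml => /andP[h1 h2]; have := sinh_lt c; lra.
Qed.

Lemma pos_radius_face x0 r x q i : pos_radius x0 r -> glued T x0 x ->
  projT1 x = projT1 q -> cdist x q < r -> bary q i = 0 -> bary x i = 0.
Proof.
move=> pr g k c q0; apply/eqP/negPn/negP => xi.
have := pos_radius_pos pr g (coords_fcone q) (coords_tsum q) c xi.
by rewrite -baryE q0 ltxx.
Qed.

End radius.

Section face_points.
Variables (R : realType) (n : nat) (T : ideal_triangulation n).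
Local Notation cell := (cells R n).
Local Notation X := (ideal_space R T).
Implicit Types (x y z q : cell) (w : H3 R).

Definition developed (u : 'rV[R]_4) w := exists2 c : R, 0 < c & hvec w = c *: u.

Lemma developed_ex u : fcone u -> exists w, developed u w.
Proof. by move=> /hvec_surj[w [c [c0 e]]]; exists w, c. Qed.

Lemma hdist_developed u u' w w' : developed u w -> developed u' w' ->
  hdist w w' = pdist u u'.
Proof. by move=> [c c0 e] [c' c'0 e']; rewrite hdistE e e' pdistZl// pdistZr. Qed.

Lemma hedist_ge0 w w' : (0 <= hedist w w')%E.
Proof. by rewrite lee_fin hdist_ge0. Qed.

Lemma hedistC w w' : hedist w w' = hedist w' w.
Proof. by rewrite /hedist hdistC. Qed.

Lemma hedist_triangle w w' w'' : (hedist w w'' <= hedist w w' + hedist w' w'')%E.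
Proof. by rewrite -EFinD lee_fin hdist_triangle. Qed.

Lemma interior_isometric x0 : (forall i, bary x0 i != 0) ->
  exists a, locally_isometric (@sdist R n T) (to_space T x0) (@hedist R) a.
Proof.
move=> x0i; have [a ha] := developed_ex (coords_fcone x0).
have [r pr] := pos_radius_ex x0; have [r0 _] := pr.
exists a; apply: (@local_model_isometric _ _ _ _ _ _ _ r unit (fun=> x0)
  (fun _ q w => developed (coords q) w)).
split => //.
- exact: hedist_ge0.
- exact: hedistC.
- exact: hedist_triangle.
- by move=> _ q _; apply: developed_ex; exact: coords_fcone.
- by move=> _ q w _ hw; rewrite /hedist (hdist_developed ha hw).
- by move=> _ q q' w w' _ _ h h'; rewrite lee_fin (hdist_developed h h').
- move=> _ q q' [k c] /pairedP[i [q0 _ _]]; exfalso.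
  by have := x0i i; rewrite (pos_radius_face pr (glued_refl T x0) k c q0) eqxx.
- by move=> [] [].
- move=> w; rewrite lte_fin => hw.
  have [c [c0 fc tc]] := fcone_normalize (fcone_hvec w).
  have dw : developed (c *: hvec w) w.
    by exists c^-1; rewrite ?invr_gt0// scalerA mulVf ?scale1r// gt_eqF.
  rewrite (hdist_developed ha dw) in hw.
  have pp : punctured_simplex (c *: hvec w).
    apply: fcone_punct => // i; apply/ltW.
    exact: pos_radius_pos pr (glued_refl T x0) fc tc hw (x0i i).
  by exists tt, (mkcell (projT1 x0) pp).
- move=> _ _ q q' w w' [k _] [k' _] h h' _.
  by rewrite /hedist (hdist_developed h h'); apply: sdist_step; rewrite -k.
Qed.

Lemma face_isometric x0 i : bary x0 i = 0 -> (forall j, j != i -> bary x0 j != 0) ->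
  exists a, locally_isometric (@sdist R n T) (to_space T x0) (@hedist R) a.
Proof.
move=> x0i x0j; have [a ha] := developed_ex (coords_fcone x0).
have [x1 px] := paired_ex T x0i; have [_ kx vx] := px.
set v := vertex_map T (projT1 x0, i) in vx.
have g01 : glued T x0 x1 by apply/asboolP/rst_step/pairedP; exists i.
have x1j j : j != v i -> bary x1 j != 0.
  move=> ji; rewrite -(permKV v j); have := x0j (v^-1%g j).
  by rewrite baryE vx mxE; apply; apply: contra_neq ji => <-; rewrite permKV.
have vi : v i = (mate T (projT1 x0, i)).2 := vertex_map_opp T (projT1 x0, i).
(* Otherwise the unique vanishing coordinates would agree, and the face would be paired with itself,
   against [mate_neq]. *)
have x01 : x0 <> x1.
  move=> e; have := mate_neq T (projT1 x0, i); apply/negP/negPn/eqP.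
  rewrite [LHS]surjective_pairing -kx -e -vi; congr pair.
  apply/eqP/negPn/negP => /x0j; rewrite e.
  by move: x0i; rewrite !baryE vx mxE => ->; rewrite eqxx.
have [r1 pr1] := pos_radius_ex x0.
(* When both sides of the face lie in the same cell, half their distance separates the two sheets,
   as [lmod_uniq] demands. *)
have [r [r0 pr sep]] : exists r, [/\ 0 < r, pos_radius x0 r
    & projT1 x0 = projT1 x1 -> 2 * r <= cdist x0 x1].
  have r10 := proj1 pr1.
  have [c0|c0] := ltP 0 (cdist x0 x1).
    have m0 : 0 < Num.min r1 (cdist x0 x1 / 2) by rewrite lt_min r10 divr_gt0.
    exists (Num.min r1 (cdist x0 x1 / 2)); split => //.
      by apply: pos_radius_le pr1 => //; rewrite ge_min lexx.
    have : Num.min r1 (cdist x0 x1 / 2) <= cdist x0 x1 / 2 by rewrite ge_min lexx orbT.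
    lra.
  exists r1; split => // k; exfalso; apply: x01; apply: cdist_eq0 => //.
  by apply/eqP; rewrite eq_le c0 cdist_ge0.
pose x (s : bool) := if s then x0 else x1.
pose F (s : bool) q := if s then coords q else refl i (col_perm v (coords q)).
have FF s q : fcone (F s q).
  by case: s; [exact: coords_fcone|apply/fcone_refl/fcone_perm/coords_fcone].
have Fd s q q' : pdist (F s q) (F s q') = cdist q q'.
  by case: s => //; rewrite /F pdist_refl2 pdist_perm.
have Fx s : F s (x s) = coords x0.
  by case: s; rewrite /F/x//= -vx refl_id.
have gx s : glued T x0 (x s) by case: s => //; exact: glued_refl.
have hdx s q w : developed (F s q) w -> hdist a w = cdist (x s) q.
  by move=> hw; rewrite (hdist_developed ha hw) -(Fx s) Fd.
have Fpair q q' : projT1 q = projT1 x0 -> paired T i q q' -> F false q' = coords q.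
  by move=> k [q0 _ e]; rewrite /F /v -k -e refl_id.
have glue q q' : near_rep x r true q -> paired T i q q' ->
    [/\ near_rep x r false q', cdist x1 q' = cdist x0 q
    & forall w w', developed (F true q) w -> developed (F false q') w' -> hdist w w' = 0].
  move=> [k c] pq; have e := paired_cdist k px pq.
  split => //; first by split; [exact: paired_proj k px pq|rewrite e].
  move=> w w' h h'; rewrite (hdist_developed h h') (Fpair _ _ _ pq)//.
  by rewrite pdist_refl//; exact: coords_fcone.
have cross q q' w w' : near_rep x r true q -> near_rep x r false q' ->
    developed (F true q) w -> developed (F false q') w' ->
    hdist a w + hdist w w' < r \/ hdist a w' + hdist w w' < r ->
    (sdist (to_space T q) (to_space T q') <= (hdist w w')%:E)%E.
  move=> [k c] [k' c'] h h' hr.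
  set u := F true q in h; set u' := F false q' in h'.
  have fu : fcone u := FF _ _; have fu' : fcone u' := FF _ _.
  have u0 : 0 <= u 0 i := coords_ge0 q i.
  have u'0 : u' 0 i <= 0 by rewrite !mxE eqxx oppr_le0 coords_ge0.
  (* The developments lie on opposite sides of the plane of the face; [z] is where their geodesic
     crosses it. The bound [hr] keeps [z] within [r] of the centre, hence inside the face, where it
     can be glued. *)
  have [al [be [al0 be0 ab zi]]] : exists al be, [/\ 0 <= al, 0 <= be, 0 < al + be
      & al * u 0 i + be * u' 0 i = 0].
    have [e|e] := eqVneq (u 0 i) 0.
      by exists 1, 0; rewrite e ler01 lexx addr0 ltr01 mulr0 mul0r addr0.
    have ui : 0 < u 0 i by rewrite lt_neqAle eq_sym e u0.
    exists (- u' 0 i), (u 0 i); split; rewrite ?oppr_ge0//; last by ring.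
    by rewrite ltr_wpDl// oppr_ge0.
  have add := pdist_add fu fu' al0 be0 ab.
  have fz := fcone_comb fu fu' al0 be0 ab.
  have [d [d0 fdz tdz]] := fcone_normalize fz.
  set z := al *: u + be *: u' in add fz fdz tdz.
  have d1 := pdist_ge0 fu fz; have d2 := pdist_ge0 fz fu'.
  have fx0 := coords_fcone x0.
  have zr : pdist (coords x0) (d *: z) < r.
    rewrite pdistZr//; move: hr; rewrite (hdist_developed h h').
    rewrite (hdist_developed ha h) (hdist_developed ha h') -add => -[|] hr.
      by have := pdist_triangle fx0 fu fz; lra.
    by have := pdist_triangle fx0 fu' fz; rewrite (pdistC u'); lra.
  have zi' : (d *: z) 0 i = 0 by rewrite mxE /z mxE [X in X + _]mxE [X in _ + X]mxE zi mulr0.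
  have pz : punctured_simplex (d *: z).
    apply: fcone_punct => // j; have [->|ji] := eqVneq j i; first by rewrite zi'.
    by apply/ltW; exact: pos_radius_pos pr (glued_refl T x0) fdz tdz zr (x0j j ji).
  pose zc : cell := mkcell (projT1 x0) pz.
  have [z1 pz1] : exists y, paired T i zc y by apply: paired_ex.
  have [_ kz1 _] := pz1.
  apply: le_trans (sdist_triangle _ (to_space T zc) _) _.
  rewrite {2}(_ : to_space T zc = to_space T z1); last first.
    by apply/to_spaceP/asboolP/rst_step/pairedP; exists i.
  rewrite (hdist_developed h h') -add EFinD; apply: leeD.
    apply: le_trans (sdist_step _ _) _; first by rewrite -k.
    by rewrite /cdist coords_mkcell pdistZr.
  apply: le_trans (sdist_step _ _) _; first by rewrite -k' kz1 kx.
  by rewrite -(Fd false) (Fpair zc z1)// coords_mkcell pdistZl.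
exists a; apply: (@local_model_isometric _ _ _ _ _ _ _ r bool x
  (fun s q w => developed (F s q) w)).
split => //.
- exact: hedist_ge0.
- exact: hedistC.
- exact: hedist_triangle.
- by exists true.
- by move=> s; apply/esym/to_spaceP.
- by move=> s q _; exact: developed_ex.
- by move=> s q w _ hw; rewrite /hedist (hdx s q).
- by move=> s q q' w w' _ _ h h'; rewrite lee_fin (hdist_developed h h') Fd.
- move=> [] q q' nq /pairedP[j pq]; have [k c] := nq; have [q0 _ _] := pq.
    have ji : j = i.
      have := pos_radius_face pr (gx true) k c q0.
      by move=> h; apply/eqP/negPn/negP => /x0j; rewrite h eqxx.
    subst j; have [n' e h] := glue _ _ nq pq.
    by exists false; split => // w w' hw hw'; rewrite /hedist (h w w').
  have ji : j = v i.
    have := pos_radius_face pr (gx false) k c q0.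
    by move=> h; apply/eqP/negPn/negP => /x1j; rewrite h eqxx.
  subst j.
  have em : (projT1 q, v i) = mate T (projT1 x0, i).
    by rewrite -k /= kx vi -surjective_pairing.
  have pq' : paired T i q' q.
    by have := paired_sym pq; rewrite em mateK.
  have px' : paired T (v i) x1 x0 by have := paired_sym px; rewrite vi.
  have e := paired_cdist k px' pq.
  have nq' : near_rep x r true q'.
    by split; [exact: paired_proj k px' pq|rewrite /x e].
  have [_ _ h] := glue _ _ nq' pq'.
  by exists true; split => // w w' hw hw'; rewrite hedistC /hedist (h w' w).
- have ne q : near_rep x r true q -> near_rep x r false q -> False.
    move=> [k c] [k' c']; rewrite /x in k k' c c'.
    have := sep (etrans k (esym k')); have := cdist_triangle x0 q x1.
    by rewrite (cdistC q); lra.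
  by move=> [] [] q h h' //; exfalso; exact: ne h h' || exact: ne h' h.
- move=> w; rewrite lte_fin => hw.
  have [c [c0 fc tc]] := fcone_normalize (fcone_hvec w).
  set u := c *: hvec w in fc tc.
  have dw : developed u w.
    by exists c^-1; rewrite ?invr_gt0// scalerA mulVf ?scale1r// gt_eqF.
  rewrite (hdist_developed ha dw) in hw.
  have uj j : j != i -> 0 < u 0 j.
    by move=> /x0j; exact: pos_radius_pos pr (glued_refl T x0) fc tc hw.
  have [ui|ui] := leP 0 (u 0 i).
    have pp : punctured_simplex u.
      by apply: fcone_punct => // j; have [->//|/uj/ltW] := eqVneq j i.
    by exists true, (mkcell (projT1 x0) pp).
  (* A point beyond the face is reflected back into the simplex, then transported to the cell of
     [x1]. *)
  have fr := fcone_refl i fc; have [d [d0 fd td]] := fcone_normalize fr.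
  have hr : pdist (coords x0) (d *: refl i u) < r.
    by rewrite pdistZr// -[coords x0](refl_id x0i) pdist_refl2.
  have pp : punctured_simplex (d *: refl i u).
    apply: fcone_punct => // j; apply/ltW; have [->|ji] := eqVneq j i.
      by rewrite mxE mulr_gt0// mxE eqxx oppr_gt0.
    exact: pos_radius_pos pr (glued_refl T x0) fd td hr (x0j j ji).
  have pp' := punct_perm v^-1%g pp.
  exists false, (mkcell (projT1 x1) pp'); split.
    split => //; rewrite /x /cdist coords_mkcell -(pdist_perm v) -vx.
    by rewrite -col_permM mulgV col_perm1.
  exists (c * d)^-1; first by rewrite invr_gt0 mulr_gt0.
  rewrite /F coords_mkcell -col_permM mulgV col_perm1 reflZ reflK /u !scalerA.
  rewrite -[LHS]scale1r; congr (_ *: _); field; by rewrite !gt_eqF.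
- move=> s s' q q' w w' nq nq' h h'; rewrite -EFinD lte_fin => hr.
  have same t : near_rep x r t q -> near_rep x r t q' -> developed (F t q) w ->
      developed (F t q') w' -> (sdist (to_space T q) (to_space T q') <= hedist w w')%E.
    move=> [k _] [k' _] h1 h2; rewrite /hedist (hdist_developed h1 h2) Fd.
    by apply: sdist_step; rewrite -k.
  move: s s' nq nq' h h' => [] [] nq nq' h h'.
  + exact: (same true).
  + by apply: cross => //; left.
  + by rewrite sdistC hedistC; apply: cross => //; right; rewrite (hdistC w').
  + exact: (same false).
Qed.

End face_points.

(** * Cones and edges *)

Section wedges.
Variable R : realType.
Local Notation s3 := (Num.sqrt (3 : R)).
Local Notation al := (pi / 3 : R).

Lemma sextant_gt0 : 0 < al.
Proof. by rewrite divr_gt0// pi_gt0. Qed.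

Lemma cos_sextant : cos al = 1 / 2.
Proof.
have p0 := pi_gt0 R; have c0 : 0 < cos al by rewrite cos_gt0_pihalf//; lra.
have : cos (al *+ 2 + al) = -1 by rewrite -cospi; congr cos; field.
rewrite cosD cos_mulr2n sin_mulr2n => e.
(* The triple angle formula at [3 * al = pi] says that [4 c^3 - 3 c + 1 = 0], whose left side has
   this factorization. *)
have e' : (cos al + 1) * (2 * cos al - 1) ^+ 2 = 0.
  have e2 := cos2Dsin2 al; move: e e2; set c := cos al; set s := sin al => e e2.
  rewrite (_ : _ * _ = ((c ^+ 2 *+ 2 - 1) * c - (c * s) *+ 2 * s) + 1
    + 2 * c * (c ^+ 2 + s ^+ 2 - 1)); last by ring.
  by rewrite e e2; ring.
move: e' => /eqP; rewrite mulf_eq0 sqrf_eq0 => /orP[|] /eqP; lra.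
Qed.

Lemma sin_sextant : sin al = s3 / 2.
Proof.
have p0 := pi_gt0 R; have h0 := s3_gt0 R.
have si : 0 < sin al by rewrite sin_gt0_pi//; lra.
apply/eqP; rewrite -(@eqrXn2 _ 2%N)//; try lra.
rewrite sin2cos2 cos_sextant !expr_div_n s3_sqr; apply/eqP; lra.
Qed.

Lemma polar (x y : R) : 0 <= y -> y <= s3 * x ->
  exists rho b, [/\ 0 <= rho, 0 <= b <= al, x = rho * cos b & y = rho * sin b].
Proof.
move=> y0 yx; have h0 := s3_gt0 R; have a0 := sextant_gt0; have p0 := pi_gt0 R.
have x0 : 0 <= x by rewrite -(pmulr_rge0 _ h0); exact: le_trans yx.
have [xe|xn] := eqVneq x 0.
  have ye : y = 0 by apply/eqP; rewrite eq_le y0 andbT; move: yx; rewrite xe mulr0.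
  by exists 0, 0; rewrite lexx (ltW a0) !mul0r.
have xg : 0 < x by rewrite lt_neqAle eq_sym xn.
pose b := atan (y / x).
have b1 := atan_gtNpi2 (y / x); have b2 := atan_ltpi2 (y / x).
have c0 : 0 < cos b by rewrite cos_gt0_pihalf// b1 b2.
have sE : sin b = y / x * cos b.
  by rewrite -[in RHS](atanK (y / x)) /tan -/b divfK// gt_eqF.
have rE : y = x / cos b * sin b by rewrite sE; field; rewrite xn gt_eqF.
exists (x / cos b), b; split => //; last by rewrite divfK// gt_eqF.
  by rewrite divr_ge0// ltW.
have bge : 0 <= b.
  rewrite leNgt; apply/negP => bn.
  have : 0 < sin (- b) by rewrite sin_gt0_pi//; rewrite -/b in b1; lra.
  by rewrite sinN oppr_gt0 sE; apply/negP; rewrite -leNgt mulr_ge0// ?divr_ge0// ltW.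
rewrite bge/= leNgt; apply/negP => bg.
have : 0 < sin (b - al) by rewrite sin_gt0_pi//; rewrite -/b in b2; lra.
rewrite sinB cos_sextant sin_sextant sE.
rewrite (_ : _ - _ = cos b / (2 * x) * (y - s3 * x)); last by field.
by rewrite pmulr_rgt0 ?divr_gt0 ?mulr_gt0// subr_gt0 ltNge yx.
Qed.

Variable theta : R.
Implicit Types w : wedge theta.

(** Development after a rotation by [- psi], which brings the sector starting at angle [psi] to the
    standard position. *)
Definition wrot (psi : R) w : H3 R :=
  MkH3 (wrho w * cos (wphi w - psi)) (wrho w * sin (wphi w - psi)) (wt_gt0 w).

Lemma hdist_wrot psi w w' :
  hdist (wrot psi w) (wrot psi w') = hdist (wedge_dev w) (wedge_dev w').
Proof.
rewrite /hdist /=; congr arcosh; congr (1 + (_ + _) / _).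
rewrite !cosB !sinB; have := cos2Dsin2 psi.
set a := cos (wphi w); set b := sin (wphi w); set c := cos (wphi w').
set d := sin (wphi w'); set e := cos psi; set f := sin psi => h.
transitivity ((e ^+ 2 + f ^+ 2) * ((wrho w * a - wrho w' * c) ^+ 2
  + (wrho w * b - wrho w' * d) ^+ 2)); first by ring.
by rewrite h mul1r.
Qed.

Lemma hdist_axis (o : H3 R) psi w : hx o = 0 -> hy o = 0 ->
  hdist o (wrot psi w) = hdist o (wedge_dev w).
Proof.
move=> x0 y0; rewrite /hdist /= x0 y0 !add0r; congr arcosh; congr (1 + (_ + _) / _).
have e (u : R) : (- (wrho w * cos u)) ^+ 2 + (- (wrho w * sin u)) ^+ 2 = wrho w ^+ 2.
  rewrite !sqrrN !exprMn -mulrDr cos2Dsin2; ring.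
by rewrite !e.
Qed.

Lemma hdist_axis_eq (o : H3 R) w w' : hx o = 0 -> hy o = 0 -> wrho w = wrho w' ->
  wt w = wt w' -> hdist o (wedge_dev w) = hdist o (wedge_dev w').
Proof.
move=> x0 y0 er et; rewrite /hdist /= x0 y0 !add0r er et; congr arcosh; congr (1 + (_ + _) / _).
have e (u : R) : (- (wrho w' * cos u)) ^+ 2 + (- (wrho w' * sin u)) ^+ 2 = wrho w' ^+ 2.
  rewrite !sqrrN !exprMn -mulrDr cos2Dsin2; ring.
by rewrite !e.
Qed.

Lemma cone_chain_ge0 w w' l : cone_chain w w' l -> 0 <= l.
Proof. by elim=> [*|*|*|*]; rewrite ?hdist_ge0 ?addr_ge0. Qed.

Lemma cone_chain_sym w w' l : cone_chain w w' l -> cone_chain w' w l.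
Proof.
elim=> [{}w {}w' h|{}w {}w' h|{}w {}w' h|{}w {}w' w'' {}l l' _ h _ h'].
- by rewrite hdistC; apply: cone_chain_step; rewrite distrC.
- exact: cone_chain_unglue.
- exact: cone_chain_glue.
- by rewrite addrC; exact: cone_chain_trans h' h.
Qed.

Lemma cone_dist_ge0 w w' : (0 <= cone_dist w w')%E.
Proof. exact: chain_inf_ge0 cone_chain_ge0 _ _. Qed.

Lemma cone_distC w w' : cone_dist w w' = cone_dist w' w.
Proof. exact: chain_infC cone_chain_sym _ _. Qed.

Lemma cone_dist_triangle w w' w'' :
  (cone_dist w w'' <= cone_dist w w' + cone_dist w' w'')%E.
Proof. exact: chain_inf_triangle cone_chain_ge0 (@cone_chain_trans _ _) _ _ _. Qed.

Lemma cone_dist_le w w' l : cone_chain w w' l -> (cone_dist w w' <= l%:E)%E.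
Proof. exact: chain_inf_le. Qed.

Lemma cone_dist_lt w w' l : (cone_dist w w' < l)%E ->
  exists2 l', cone_chain w w' l' & (l'%:E < l)%E.
Proof. exact: chain_inf_lt. Qed.

(* Two names of the same point of the wedge: on the axis the angle is
   irrelevant. *)
Definition same_point w w' := [/\ wrho w = wrho w', wt w = wt w'
  & wrho w = 0 \/ wphi w = wphi w'].

Lemma same_point_dev w w' : same_point w w' -> wedge_dev w = wedge_dev w'.
Proof.
move=> [er et [r0|e]]; apply: H3_eq => //=; rewrite -er ?r0 ?mul0r//.
  by rewrite e.
by rewrite e.
Qed.

Lemma cone_chain0 w w' : same_point w w' -> `|wphi w - wphi w'| <= pi -> cone_chain w w' 0.
Proof.
move=> /same_point_dev e h; rewrite -(hdist_refl (wedge_dev w)) {2}e.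
exact: cone_chain_step.
Qed.

Lemma cone_chain_lip (o : H3 R) w w' l : hx o = 0 -> hy o = 0 -> cone_chain w w' l ->
  `|hdist o (wedge_dev w) - hdist o (wedge_dev w')| <= l.
Proof.
move=> x0 y0; have key (v v' : wedge theta) : sides_identified v v' ->
    hdist o (wedge_dev v) = hdist o (wedge_dev v').
  by move=> [_ _ er et]; exact: (hdist_axis_eq x0 y0 er et).
elim=> [{}w {}w' h|{}w {}w' h|{}w {}w' h|{}w {}w' w'' {}l l' _ h _ h'].
- have h1 := hdist_triangle o (wedge_dev w) (wedge_dev w').
  have := hdist_triangle o (wedge_dev w') (wedge_dev w).
  rewrite (hdistC (wedge_dev w') (wedge_dev w)) => h2.
  by rewrite ler_norml; apply/andP; split; lra.
- by rewrite (key _ _ h) subrr normr0.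
- by rewrite (key _ _ h) subrr normr0.
- apply: le_trans (lerD h h').
  rewrite -{1}(subrK (hdist o (wedge_dev w')) (hdist o (wedge_dev w))) -addrA.
  exact: ler_normD.
Qed.

(** The distance to an axis point is 1-Lipschitz along chains, since gluing the sides preserves it.
    In the other direction, the angle of a point of the axis is changed for free until it is that of
    [w'], and one step inside a half-plane suffices. *)
Lemma cone_dist_axis w w' : wrho w = 0 -> wphi w = 0 ->
  cone_dist w w' = (hdist (wedge_dev w) (wedge_dev w'))%:E.
Proof.
move=> r0 f0; set o := wedge_dev w.
have ox : hx o = 0 by rewrite /= r0 mul0r.
have oy : hy o = 0 by rewrite /= r0 mul0r.
apply/eqP; rewrite eq_le; apply/andP; split; last first.
  apply: le_ereal_inf_tmp => _ [l c <-]; rewrite lee_fin.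
  have := cone_chain_lip ox oy c; rewrite hdist_refl sub0r normrN.
  by rewrite ger0_norm ?hdist_ge0.
have p0 := pi_gt0 R.
(* A step changes the angle by at most [pi], so a large angle is reached in several free steps. *)
have axis (N : nat) (f : R) (hf : 0 <= f <= theta) : f <= N%:R * pi ->
    cone_chain w (MkWedge (lexx 0) hf (wt_gt0 w)) 0.
  elim: N f hf => [|N ih] f hf fN.
    apply: cone_chain0; first by split => //; left.
    by rewrite f0 /= sub0r normrN ger0_norm; case/andP: hf => *; nra.
  have [f1|f1] := leP f pi.
    apply: cone_chain0; first by split => //; left.
    by rewrite f0 /= sub0r normrN ger0_norm//; case/andP: hf.
  have hf' : 0 <= f - pi <= theta by case/andP: hf => *; lra.
  have c2 : cone_chain (MkWedge (lexx 0) hf' (wt_gt0 w)) (MkWedge (lexx 0) hf (wt_gt0 w)) 0.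
    apply: cone_chain0; first by split => //; left.
    by rewrite /= ler_norml; lra.
  have fN' : f - pi <= N%:R * pi by move: fN; rewrite -natr1; lra.
  by have := cone_chain_trans (ih _ hf' fN') c2; rewrite addr0.
have [N hN] : exists N : nat, wphi w' <= N%:R * pi.
  exists (Num.truncn (wphi w' / pi)).+1; rewrite -ler_pdivrMr//.
  by apply/ltW/real_truncnS_gt/num_real.
have c1 := axis N _ (wphi_bounds w') hN.
apply: le_trans (cone_dist_le (cone_chain_trans c1 (cone_chain_step _))) _.
  by rewrite /= subrr normr0 ltW.
rewrite add0r lee_fin (_ : wedge_dev _ = o)//.
by apply: H3_eq => //=; rewrite ?ox ?oy ?mul0r// r0 mul0r.
Qed.

Lemma sin_eq0_lt (x : R) : 0 <= x -> x < pi -> sin x = 0 -> x = 0.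
Proof.
move=> x0 xp sx; apply/eqP; rewrite eq_le x0 andbT leNgt; apply/negP => x1.
by have := sin_gt0_pi (x := x); rewrite x1 xp sx ltxx => /(_ isT).
Qed.

(* A geodesic between two points of a wedge of angle at most pi crosses the
   intermediate half-planes bounded by the axis. *)
Lemma wedge_cross w w' (f : R) : wphi w <= f -> f <= wphi w' -> wphi w' - wphi w <= pi ->
  exists w0 : wedge theta, wphi w0 = f /\
    hdist (wedge_dev w) (wedge_dev w0) + hdist (wedge_dev w0) (wedge_dev w')
    = hdist (wedge_dev w) (wedge_dev w').
Proof.
move=> f1 f2 f3; have r0 := wrho_ge0 w; have r'0 := wrho_ge0 w'.
have [a [b [k [a0 b0 ab k0]]]] : exists a b k, [/\ 0 <= a, 0 <= b, 0 < a + b, 0 <= k &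
    a * (wrho w * cos (wphi w)) + b * (wrho w' * cos (wphi w')) = k * cos f /\
    a * (wrho w * sin (wphi w)) + b * (wrho w' * sin (wphi w')) = k * sin f].
  have [e|e1] := eqVneq f (wphi w).
    exists 1, 0, (wrho w); rewrite ler01 lexx addr0 ltr01 e !mul1r !mul0r !addr0.
    by split.
  have [e|e2] := eqVneq f (wphi w').
    exists 0, 1, (wrho w'); rewrite ler01 lexx add0r ltr01 e !mul1r !mul0r !add0r.
    by split.
  have [e|e3] := eqVneq (wrho w) 0.
    exists 1, 0, 0; rewrite ler01 lexx addr0 ltr01 e !mul0r !mulr0 !addr0.
    by split.
  have f1' : wphi w < f by rewrite lt_neqAle eq_sym e1.
  have f2' : f < wphi w' by rewrite lt_neqAle e2.
  have r1 : 0 < wrho w by rewrite lt_neqAle eq_sym e3.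
  have s1 : 0 <= sin (wphi w' - f) by rewrite sin_ge0_pi//; lra.
  have s2 : 0 < sin (f - wphi w) by rewrite sin_gt0_pi//; lra.
  have s4 : 0 <= sin (wphi w' - wphi w) by rewrite sin_ge0_pi//; lra.
  (* The planar identity [sin (v - f) e(u) + sin (f - u) e(v) = sin (v - u) e(f)] for unit vectors
     [e], multiplied by both radii. *)
  exists (wrho w' * sin (wphi w' - f)), (wrho w * sin (f - wphi w)),
    (wrho w * wrho w' * sin (wphi w' - wphi w)); split.
  - by rewrite mulr_ge0.
  - by rewrite mulr_ge0// ltW.
  - by rewrite ltr_wpDl ?mulr_ge0// mulr_gt0.
  - by rewrite !mulr_ge0.
  - by rewrite !sinB; split; ring.
move=> [kc ks].
set u := hvec (wedge_dev w); set u' := hvec (wedge_dev w').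
have fu : fcone u := fcone_hvec _; have fu' : fcone u' := fcone_hvec _.
have fz := fcone_comb fu fu' a0 b0 ab.
have [W [c [c0 e]]] := hvec_surj fz.
have h3 := s3_gt0 R.
(* [hx] and [hy] are linear in [hvec], so a combination of [hvec]s has, up to the scale [c], the
   same combination of horizontal positions. *)
have xE v : hx v = hvec v 0 i3 + hvec v 0 i2 / 2.
  by rewrite !hvecE; field; rewrite gt_eqF.
have yE v : hy v = s3 / 2 * hvec v 0 i2.
  by rewrite !hvecE; field; rewrite gt_eqF.
have zE j : hvec W 0 j = c * (a * u 0 j + b * u' 0 j) by rewrite e !mxE.
have Wx : hx W = c * k * cos f.
  rewrite -mulrA -kc xE !zE -[_ * cos (wphi w)]/(hx (wedge_dev w)).
  rewrite -[_ * cos (wphi w')]/(hx (wedge_dev w')) !xE -/u -/u'; by field.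
have Wy : hy W = c * k * sin f.
  rewrite -mulrA -ks yE !zE -[_ * sin (wphi w)]/(hy (wedge_dev w)).
  rewrite -[_ * sin (wphi w')]/(hy (wedge_dev w')) !yE -/u -/u'; by field.
have ck : 0 <= c * k by rewrite mulr_ge0// ltW.
have hf : 0 <= f <= theta.
  have := wphi_bounds w; have := wphi_bounds w' => /andP[_ h1] /andP[h2 _].
  by rewrite (le_trans h2 f1) (le_trans f2 h1).
exists (MkWedge ck hf (ht_gt0 W)); split => //.
rewrite (_ : wedge_dev (MkWedge _ _ _) = W); last exact: H3_eq.
rewrite !hdistE e pdistZl// pdistZr//; exact: pdist_add.
Qed.

End wedges.

(** * The cycle of simplices around an edge *)

Section flags.
Variables (n : nat) (T : ideal_triangulation n).
Local Notation flag := ('I_n * 'S_4)%type.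
Implicit Types phi psi : flag.

Definition tau : 'S_4 := tperm i2 i3.
Definition tau' : 'S_4 := tperm i0 i1.

Lemma tauK : (tau * tau = 1)%g. Proof. exact: tperm2. Qed.
Lemma tau'K : (tau' * tau' = 1)%g. Proof. exact: tperm2. Qed.

Lemma tauC : (tau * tau' = tau' * tau)%g.
Proof.
apply/permP => j; rewrite !permM; move: j.
by apply: forall4; rewrite /tau /tau' !permE /=.
Qed.

(* A flag (k, s) is an oriented edge of the k-th simplex, from s 0 to s 1,
   followed by its two other vertices; [turn] crosses the face opposite to s 3,
   and so turns around the edge. *)
Definition turn phi : flag :=
  let f := (phi.1, phi.2 i3) in
  ((mate T f).1, tau * phi.2 * vertex_map T f)%g.

Definition unturn phi : flag :=
  let f := (phi.1, phi.2 i2) in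
  ((mate T f).1, tau * phi.2 * vertex_map T f)%g.

(** Reverses the edge and exchanges the two other vertices, so that the parity of the flag is
    unchanged. *)
Definition flip phi : flag := (phi.1, tau' * tau * phi.2)%g.

Lemma turn_mate phi : ((turn phi).1, (turn phi).2 i2) = mate T (phi.1, phi.2 i3).
Proof.
rewrite /turn /= !permM tpermL; have /= -> := vertex_map_opp T (phi.1, phi.2 i3).
by rewrite -surjective_pairing.
Qed.

Lemma turnK : cancel turn unturn.
Proof.
move=> phi; rewrite /unturn turn_mate mateK vertex_map_mate /=.
by rewrite !mulgA tauK mul1g mulgK -surjective_pairing.
Qed.

Lemma turn_inj : injective turn. Proof. exact: can_inj turnK. Qed.

(** Reversing the edge reverses the sense of rotation: [flip] conjugates [turn] to its inverse. *)
Lemma turn_flip_turn phi : turn (flip (turn phi)) = flip phi.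
Proof.
rewrite -[in RHS](turnK phi); move: (turn phi) => psi.
rewrite /unturn /turn /flip /= !permM.
have -> : tau (tau' i3) = i2.
  by rewrite /tau' (tpermD (z := i3))// /tau tpermR.
by congr pair; rewrite !mulgA tauC.
Qed.

Lemma flipK : involutive flip.
Proof.
move=> [k s]; rewrite /flip /=; congr pair.
by rewrite -!mulgA (mulgA tau tau') tauC !mulgA tau'K mul1g tauK mul1g.
Qed.

(* The edge is never glued to itself with its ends exchanged: a reflection of
   the cycle of flags would fix a flag or a face. *)
Lemma iter_turn_flip r phi : iter r turn phi <> flip phi.
Proof.
(* Cancelling a [turn] at both ends lowers [r] by 2, hence the induction on two consecutive values.
   For 0, [flip] would fix a flag; for 1, a face would be its own mate. *)
suff H : (forall phi, iter r turn phi <> flip phi) /\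
    (forall phi, iter r.+1 turn phi <> flip phi) by exact: H.1.
elim: r {phi} => [|r [ih1 ih2]].
  split=> [[k s] [] /permP /(_ i0)|phi e].
    by rewrite !permM /tau' tpermL /tau tpermD// => /perm_inj.
  have := mate_neq T (phi.1, phi.2 i3); rewrite -turn_mate {}[turn _]e.
  by rewrite /flip /= !permM /tau' (tpermD (z := i2))// /tau tpermL eqxx.
split=> // phi; rewrite iterS -turn_flip_turn => /turn_inj; rewrite iterSr.
exact: ih1.
Qed.

Lemma iter_turn_flip2 r r' phi : iter r turn phi <> flip (iter r' turn phi).
Proof.
have [rr|rr] := leqP r' r.
  by rewrite -(subnK rr) iterD; exact: iter_turn_flip.
move=> e; have := @iter_turn_flip (r' - r) (iter r turn phi).
rewrite -iterD subnK; last exact: ltnW.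
by rewrite e flipK.
Qed.

(** The odd [tau] in [turn] compensates the orientation reversal of a face pairing, so the sign of a
    flag relative to the orientation of its simplex is constant along the cycle. *)
Lemma turn_parity (o : 'I_n -> bool) :
  (forall f, odd_perm (vertex_map T f) = (o f.1 == o (mate T f).1)) ->
  forall phi r, odd_perm (iter r turn phi).2 (+) o (iter r turn phi).1 =
                odd_perm phi.2 (+) o phi.1.
Proof.
move=> oP phi; elim=> [//|r <-]; rewrite iterS; move: (iter r turn phi) => psi.
rewrite /turn /= !odd_permM oP /= odd_tperm /=.
by case: (odd_perm _); case: (o psi.1); case: (o _).
Qed.

Lemma perm_fix01 (s : 'S_4) : s i0 = i0 -> s i1 = i1 -> s = 1%g \/ s = tau.
Proof.
move=> e0 e1; have H (j k : 'I_4) : s j = s k -> j = k by exact: perm_inj.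
have n20 : s i2 <> i0 by rewrite -[X in _ <> X]e0 => /H.
have n21 : s i2 <> i1 by rewrite -[X in _ <> X]e1 => /H.
have n30 : s i3 <> i0 by rewrite -[X in _ <> X]e0 => /H.
have n31 : s i3 <> i1 by rewrite -[X in _ <> X]e1 => /H.
have n23 : s i2 <> s i3 by move=> /H.
have [e2|e3] : s i2 = i2 \/ s i2 = i3.
  by move: (s i2) n20 n21 {n23}; apply: forall4 => //; [left|right].
- have e3 : s i3 = i3.
    by move: n30 n31 n23; rewrite e2; move: (s i3); apply: forall4.
  by left; apply/permP; apply: forall4; rewrite ?permE ?e0 ?e1 ?e2 ?e3.
- have e2 : s i3 = i2.
    by move: n30 n31 n23; rewrite e3; move: (s i3); apply: forall4.
  right; apply/permP; apply: forall4.
  + by rewrite e0 /tau tpermD.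
  + by rewrite e1 /tau tpermD.
  + by rewrite e3 /tau tpermL.
  + by rewrite e2 /tau tpermR.
Qed.

(** Preserving the edge and orientation leaves only the identity and the half-turn used in
    [flip]. *)
Lemma perm_pairs (s : 'S_4) : (s i0 = i0 \/ s i0 = i1) ->
  (s i1 = i0 \/ s i1 = i1) -> ~~ odd_perm s -> s = 1%g \/ s = (tau' * tau)%g.
Proof.
have H (j k : 'I_4) : s j = s k -> j = k by exact: perm_inj.
move=> [e0|e0] [e1|e1] od.
- by have /H := etrans e0 (esym e1).
- have [->|e] := perm_fix01 e0 e1; first by left.
  by move: od; rewrite e /tau odd_tperm.
- have [||e|e] := @perm_fix01 (tau' * s)%g.
  + by rewrite permM /tau' tpermL.
  + by rewrite permM /tau' tpermR.
  + have e' : s = tau' by rewrite -[s]mul1g -tau'K -mulgA e mulg1.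
    by move: od; rewrite e' /tau' odd_tperm.
  + by right; rewrite -e mulgA tau'K mul1g.
- by have /H := etrans e0 (esym e1).
Qed.

End flags.

(** * A tetrahedron as a sector of angle pi / 3 around its edge from 0 to oo *)

Section sector.
Variable R : realType.
Local Notation s3 := (Num.sqrt (3 : R)).
Local Notation al := (pi / 3 : R).

(** The faces opposite to vertices 2 and 3 lie in the half-planes of angles 0 and [pi / 3]. *)
Lemma hvec_polar (rho b t : R) (t0 : 0 < t) :
  hvec (MkH3 (rho * cos b) (rho * sin b) t0) 0 i2 = 2 / s3 * (rho * sin b) /\
  hvec (MkH3 (rho * cos b) (rho * sin b) t0) 0 i3 = 2 / s3 * (rho * sin (al - b)).
Proof.
have h0 := s3_gt0 R; rewrite !hvecE /=; split; first by field; rewrite gt_eqF.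
rewrite sinB cos_sextant sin_sextant; by field; rewrite gt_eqF.
Qed.

(** The rotation taking one side of the sector to the other acts on that side as the transposition
    [tau], the one built into [turn]. *)
Lemma hvec_turn (rho t : R) (t0 : 0 < t) :
  hvec (MkH3 rho 0 t0) = col_perm tau (hvec (MkH3 (rho * cos al) (rho * sin al) t0)).
Proof.
have h0 := s3_gt0 R; have h2 := s3_sqr R.
have e : rho * sin al / s3 = rho / 2 by rewrite sin_sextant; field; rewrite gt_eqF.
have e2 : 2 * (rho * sin al) / s3 = rho by rewrite sin_sextant; field; rewrite gt_eqF.
apply/rowP; apply: forall4; rewrite [RHS]mxE.
- by rewrite /tau tpermD// !hvecE /= e cos_sextant; field; rewrite gt_eqF.
- rewrite /tau tpermD// !hvecE /= e cos_sextant sin_sextant !exprMn h2.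
  by field; rewrite gt_eqF.
- by rewrite /tau tpermL !hvecE /= e cos_sextant; field; rewrite gt_eqF.
- by rewrite /tau tpermR !hvecE /= e2; field; rewrite gt_eqF.
Qed.

End sector.

(** * Points of an edge and the cone around them *)

Section edge_points.
Variables (R : realType) (n : nat) (T : ideal_triangulation n).
Hypothesis T_orientable : orientable T.
Local Notation cell := (cells R n).
Local Notation X := (ideal_space R T).
Local Notation s3 := (Num.sqrt (3 : R)).
Local Notation al := (pi / 3 : R).
Local Notation flag := ('I_n * 'S_4)%type.
Local Notation turn := (turn T).
Variables (phi : flag) (x0 : cell).
Hypothesis x0_cell : projT1 x0 = phi.1.
Hypothesis x0_edge : bary x0 (phi.2 i0) + bary x0 (phi.2 i1) = 1.
Implicit Types (f : flag) (q x y : cell) (s : nat).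

Local Notation m := (fingraph.order turn phi).
Definition edge_angle : R := m%:R * al.
Local Notation theta := edge_angle.
Implicit Types w : wedge theta.

(** The coordinates of [x0] in the vertex order of its flag. Only the first two are nonzero, so they
    are fixed by [tau] and all the [rep_at s] share them. *)
Definition axis_vec : 'rV[R]_4 := col_perm phi.2 (coords x0).

Lemma axis_punct : punctured_simplex axis_vec.
Proof. exact/punct_perm/coords_punct. Qed.

Lemma axis_vecE : [/\ 0 < axis_vec 0 i0, 0 < axis_vec 0 i1, axis_vec 0 i2 = 0
  & axis_vec 0 i3 = 0].
Proof.
have [p0 p1 _] := axis_punct; have := p0 i2; have := p0 i3.
have := punct_lt1 i0 axis_punct; have := punct_lt1 i1 axis_punct.
have e : axis_vec 0 i0 + axis_vec 0 i1 = 1 by rewrite !mxE.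
by move: p1; rewrite sum4 => *; split; lra.
Qed.

Lemma axis_vec_tau : col_perm tau axis_vec = axis_vec.
Proof.
have [_ _ e2 e3] := axis_vecE; apply/rowP; apply: forall4; rewrite mxE /tau.
- by rewrite tpermD.
- by rewrite tpermD.
- by rewrite tpermL e2 e3.
- by rewrite tpermR e2 e3.
Qed.

Definition flag_at s := iter s turn phi.
Definition rep_at s : cell := mkcell (flag_at s).1 (punct_perm (flag_at s).2^-1%g axis_punct).
Definition flag_coords f q : 'rV[R]_4 := col_perm f.2 (coords q).

Lemma flag_at_order s : flag_at (s + m) = flag_at s.
Proof. by rewrite /flag_at iterD iter_order//; exact: turn_inj. Qed.

Lemma rep_at_coords s : flag_coords (flag_at s) (rep_at s) = axis_vec.
Proof. by rewrite /flag_coords coords_mkcell -col_permM mulgV col_perm1. Qed.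

Lemma rep_at_flag s s' : flag_at s = flag_at s' -> rep_at s = rep_at s'.
Proof.
by move=> e; apply: cell_eq; rewrite /rep_at ?projT1_mkcell ?coords_mkcell e.
Qed.

Lemma rep_at0 : rep_at 0 = x0.
Proof.
apply: cell_eq; first by rewrite projT1_mkcell.
by rewrite coords_mkcell -col_permM mulVg col_perm1.
Qed.

Lemma rep_at_bary s j : bary (rep_at s) ((flag_at s).2 j) = axis_vec 0 j.
Proof.
have := congr1 (fun u : 'rV[R]_4 => u 0 j) (rep_at_coords s).
by rewrite /= mxE.
Qed.

Lemma flag_coords_turn f q q1 :
  coords q = col_perm (vertex_map T (f.1, f.2 i3)) (coords q1) ->
  flag_coords (turn f) q1 = col_perm tau (flag_coords f q).
Proof. by move=> e; rewrite /flag_coords e /turn /= !col_permM. Qed.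

Lemma rep_at_paired s : paired T ((flag_at s).2 i3) (rep_at s) (rep_at s.+1).
Proof.
have [_ _ e2 e3] := axis_vecE.
split; first by rewrite rep_at_bary.
  by rewrite !projT1_mkcell /flag_at iterS.
have := rep_at_coords s.+1; rewrite {1}/flag_at iterS -/(flag_at s).
rewrite /flag_coords /turn [in X in X -> _]/= projT1_mkcell !col_permM -axis_vec_tau.
move=> /col_perm_inj; rewrite -(rep_at_coords s) => /col_perm_inj.
by [].
Qed.

Lemma rep_at_glued s : glued T x0 (rep_at s).
Proof.
elim: s => [|s ih]; first by rewrite rep_at0 glued_refl.
apply: glued_trans ih _; apply/asboolP/rst_step/pairedP.
by eexists; exact: rep_at_paired.
Qed.

(** Two flags with the same representative differ by a permutation that preserves the edge and, by
    [turn_parity], is even. It is the identity, or else it relates the flags by [flip], which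
    [iter_turn_flip2] excludes. *)
Lemma rep_at_inj s s' : (s < m)%N -> (s' < m)%N -> rep_at s = rep_at s' -> s = s'.
Proof.
move=> sm sm' e; have [h0 h1 e2 e3] := axis_vecE.
have k : (flag_at s).1 = (flag_at s').1 := congr1 (fun x : cell => projT1 x) e.
set a := (flag_at s).2; set b := (flag_at s').2.
have H j : axis_vec 0 ((b * a^-1)%g j) = axis_vec 0 j.
  by rewrite -(rep_at_bary s) e permM permKV rep_at_bary.
have pos j : 0 < axis_vec 0 j -> j = i0 \/ j = i1.
  by move: j; apply: forall4; rewrite ?e2 ?e3 ?ltxx//; [left|right].
have [|||ab|ab] := @perm_pairs (b * a^-1)%g.
- by apply: pos; rewrite H.
- by apply: pos; rewrite H.
- have [ori oP] := T_orientable.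
  have := turn_parity oP phi s; rewrite -(turn_parity oP phi s').
  rewrite -/(flag_at s) -/(flag_at s') k => /addIb; rewrite -/a -/b => p.
  by rewrite odd_permM odd_permV p addbb.
- have fs : flag_at s = flag_at s'.
    rewrite [LHS]surjective_pairing [RHS]surjective_pairing k; congr pair.
    by rewrite -/a -/b -[b]mulg1 -(mulVg a) mulgA ab mul1g.
  by rewrite -(findex_iter sm) -/(flag_at s) fs /flag_at findex_iter.
- exfalso; apply: (@iter_turn_flip2 _ T s' s phi).
  rewrite -/(flag_at s) -/(flag_at s') [LHS]surjective_pairing /flip k; congr pair.
  by rewrite -/a -/b -ab mulgKV.
Qed.

(** A relation, since a point of the axis has one name for each angle of the sector; by
    [rel_at_dist] these have the same image under [wedge_dev]. *)
Definition rel_at s q w := [/\ s%:R * al <= wphi w, wphi w <= s.+1%:R * al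
  & developed (flag_coords (flag_at s) q) (wrot (s%:R * al) w)].

Lemma flag_coords_dist f q q' : pdist (flag_coords f q) (flag_coords f q') = cdist q q'.
Proof. exact: pdist_perm. Qed.

Lemma rel_at_dist s q q' w w' : rel_at s q w -> rel_at s q' w' ->
  hdist (wedge_dev w) (wedge_dev w') = cdist q q'.
Proof.
move=> [_ _ h] [_ _ h']; rewrite -(hdist_wrot (s%:R * al)).
by rewrite (hdist_developed h h') flag_coords_dist.
Qed.

Lemma coords_face f q : projT1 q = f.1 -> flag_coords f q 0 i3 = 0 -> forall q1,
  projT1 q1 = (turn f).1 -> flag_coords (turn f) q1 = col_perm tau (flag_coords f q) ->
  paired T (f.2 i3) q q1.
Proof.
move=> k q0 q1 k1; rewrite /flag_coords /turn /= !col_permM => /col_perm_inj/col_perm_inj e.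
split; [by move: q0; rewrite mxE baryE|by rewrite k1 k|by rewrite k e].
Qed.

Lemma tsum_flag f q : tsum (flag_coords f q) = 1.
Proof. by rewrite /flag_coords tsum_perm coords_tsum. Qed.

(** On the common side of consecutive sectors, [hvec_turn] turns equality of wedge positions into
    the face pairing. Only the flags need be consecutive, which includes passing from the last
    sector to the first. *)
Lemma cross_same s s1 q q1 w w1 : flag_at s1 = turn (flag_at s) ->
  projT1 q = (flag_at s).1 -> projT1 q1 = (flag_at s1).1 ->
  rel_at s q w -> rel_at s1 q1 w1 -> wphi w = s.+1%:R * al -> wphi w1 = s1%:R * al ->
  wrho w = wrho w1 -> wt w = wt w1 -> to_space T q = to_space T q1.
Proof.
move=> fs k k1 [_ _ [c c0 h]] [_ _ [c1 c10 h1]] e e1 er et.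
have E : wrot (s%:R * al) w = MkH3 (wrho w1 * cos al) (wrho w1 * sin al) (wt_gt0 w1).
  by apply: H3_eq; rewrite //= -?er ?et// e -mulrBl -natrB// subSnn mul1r.
have E1 : wrot (s1%:R * al) w1 = MkH3 (wrho w1) 0 (wt_gt0 w1).
  by apply: H3_eq; rewrite //= e1 subrr ?cos0 ?sin0 ?mulr1 ?mulr0.
rewrite E in h; rewrite E1 hvec_turn h in h1.
have cc : c = c1.
  by have := congr1 (@tsum R) h1; rewrite tsum_perm !tsumZ !tsum_flag !mulr1.
apply/to_spaceP/asboolP/rst_step/pairedP; exists ((flag_at s).2 i3).
apply: coords_face => //; last 2 first.
- by rewrite -fs.
- rewrite -fs; apply: (scalerI (lt0r_neq0 c10)); rewrite -h1 cc.
  by apply/rowP => j; rewrite !mxE.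
have [_] := hvec_polar (wrho w1) al (wt_gt0 w1); rewrite subrr sin0 !mulr0 h mxE.
by move=> /eqP; rewrite mulf_eq0 gt_eqF//= => /eqP.
Qed.

(** Converse of [cross_same]: the vanishing coordinate puts [w] on the far side of its sector or on
    the axis, and [hvecZ_inj] then locates [w1]. *)
Lemma pair_same s s1 q q1 w w1 : flag_at s1 = turn (flag_at s) ->
  projT1 q = (flag_at s).1 -> paired T ((flag_at s).2 i3) q q1 ->
  rel_at s q w -> rel_at s1 q1 w1 -> [/\ wrho w = wrho w1, wt w = wt w1
    & wrho w = 0 \/ (wphi w = s.+1%:R * al /\ wphi w1 = s1%:R * al)].
Proof.
move=> fs k [q0 _ v] [a1 a2 [c c0 h]] [b1 b2 [c1 c10 h1]].
have a0 := sextant_gt0 R; have h0 := s3_gt0 R; have p0 := pi_gt0 R.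
rewrite k -natr1 mulrDl mul1r in v a2; rewrite -natr1 mulrDl mul1r in b2.
have H : wrho w = 0 \/ wphi w = s%:R * al + al.
  have [_] := hvec_polar (wrho w) (wphi w - s%:R * al) (wt_gt0 w).
  rewrite -[X in hvec X]/(wrot (s%:R * al) w) h !mxE -baryE q0 mulr0 => /esym/eqP.
  rewrite mulf_eq0 (_ : (2 / s3 == 0) = false) /=; last by rewrite gt_eqF// divr_gt0.
  rewrite mulf_eq0 => /orP[/eqP|/eqP e]; first by left.
  by right; have := sin_eq0_lt _ _ e; lra.
have E : wrot (s%:R * al) w = MkH3 (wrho w * cos al) (wrho w * sin al) (wt_gt0 w).
  apply: H3_eq => //=; case: H => [->|->]; rewrite ?mul0r//.
    by congr (_ * cos _); ring.
  by congr (_ * sin _); ring.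
have E1 : wrot (s1%:R * al) w1 = MkH3 (wrho w) 0 (wt_gt0 w).
  apply: (@hvecZ_inj _ (c1 / c)); rewrite hvec_turn -E h h1 fs (flag_coords_turn v).
  apply/rowP => j; rewrite !mxE mulrA divfK// gt_eqF//.
have := congr1 (@ht R) E1; have := congr1 (@hx R) E1; have := congr1 (@hy R) E1 => /=.
move=> sy sx ->; have r1 := wrho_ge0 w1.
have [e|e] := eqVneq (wrho w1) 0.
  by move: sx; rewrite e mul0r => <-; split => //; left.
move: sy => /eqP; rewrite mulf_eq0 (negbTE e) /= => /eqP sy.
have z : wphi w1 - s1%:R * al = 0 by apply: sin_eq0_lt => //; lra.
move: sx; rewrite z cos0 mulr1 => sx; rewrite sx; split => //.
case: H => [H|H]; last by right; rewrite -natr1 mulrDl mul1r; split => //; lra.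
by left.
Qed.

Definition axis_pt_rel (o : H3 R) := [/\ hx o = 0, hy o = 0 & developed axis_vec o].

Lemma axis_pt_ex : exists o, axis_pt_rel o.
Proof.
have [_ _ e2 e3] := axis_vecE; have h0 := s3_gt0 R.
have [ o [c [c0 e]]] := hvec_surj (punct_fcone axis_punct).
have z2 : hvec o 0 i2 = 0 by rewrite e mxE e2 mulr0.
have z3 : hvec o 0 i3 = 0 by rewrite e mxE e3 mulr0.
have y0 : hy o = 0.
  by have := hvec2 o; rewrite z2 => h; have : hy o = s3 / 2 * (2 * hy o / s3);
    [by field; rewrite gt_eqF|rewrite -h mulr0].
exists o; split => //; last by exists c.
by have := hvec3 o; rewrite z3 y0 mul0r subr0.
Qed.

Lemma rel_at_axis o s q w : axis_pt_rel o -> rel_at s q w ->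
  hdist o (wedge_dev w) = cdist (rep_at s) q.
Proof.
move=> [x0' y0' ho] [_ _ h]; rewrite -(hdist_axis (s%:R * al))//.
by rewrite (hdist_developed ho h) -(rep_at_coords s) flag_coords_dist.
Qed.

Lemma sextantS s : s.+1%:R * al = s%:R * al + al.
Proof. by rewrite -[s.+1%:R]natr1 mulrDl mul1r. Qed.

Lemma theta_gt0 : 0 < theta.
Proof. by rewrite /theta mulr_gt0 ?sextant_gt0// ltr0n fingraph.order_gt0. Qed.

Lemma rel_at_ex s q : (s < m)%N -> exists w, rel_at s q w.
Proof.
move=> sm; have h0 := s3_gt0 R; have a0 := sextant_gt0 R.
have [W [c [c0 e]]] : exists W c, 0 < c /\ hvec W = c *: flag_coords (flag_at s) q.
  by apply: hvec_surj; apply/fcone_perm/coords_fcone.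
have nn j : 0 <= hvec W 0 j by rewrite e !mxE mulr_ge0 ?coords_ge0// ltW.
have y0 : 0 <= hy W.
  by have := nn i2; rewrite hvecE mulrAC pmulr_rge0// divr_gt0.
have yx : hy W <= s3 * hx W.
  by have := nn i3; rewrite hvecE subr_ge0 ler_pdivrMr// mulrC.
have [rho [b [r0 /andP[b0 ba] xE yE]]] := polar y0 yx.
have e1 : s.+1%:R * al = s%:R * al + al by rewrite -natr1 mulrDl mul1r.
have hb : 0 <= b + s%:R * al <= theta.
  have sa : 0 <= s%:R * al by rewrite mulr_ge0// ltW.
  rewrite addr_ge0//=.
  apply: (@le_trans _ _ (s.+1%:R * al)).
    by rewrite e1; lra.
  by rewrite /theta ler_pM2r// ler_nat.
exists (MkWedge r0 hb (ht_gt0 W)); split => /=.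
- by rewrite lerDr.
- by rewrite e1; lra.
- rewrite (_ : wrot _ _ = W); first by exists c.
  by apply: H3_eq; rewrite //= addrK.
Qed.

(** The first two flag coordinates are positive because [w] is close to [o], the last two are
    nonnegative because the angle is in the sector. *)
Lemma rel_at_surj o r s w : axis_pt_rel o -> pos_radius x0 r ->
  s%:R * al <= wphi w -> wphi w <= s.+1%:R * al -> hdist o (wedge_dev w) < r ->
  exists q, [/\ projT1 q = (flag_at s).1, cdist (rep_at s) q < r & rel_at s q w].
Proof.
move=> ho pr b1 b2 hr; have [x0' y0' dv] := ho.
have h0 := s3_gt0 R; have a0 := sextant_gt0 R; have p0 := pi_gt0 R.
have h2 := hr; rewrite -(hdist_axis (s%:R * al))// in h2.
set W := wrot (s%:R * al) w in h2.
have [d [d0 fd td]] := fcone_normalize (fcone_hvec W).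
set u := d *: hvec W in fd td.
have dW : developed u W.
  by exists d^-1; rewrite ?invr_gt0// scalerA mulVf ?scale1r// gt_eqF.
rewrite (hdist_developed dv dW) in h2.
pose v := col_perm (flag_at s).2^-1%g u.
have vE j : v 0 ((flag_at s).2 j) = u 0 j by rewrite mxE permK.
have hv : pdist (coords (rep_at s)) v < r.
  by rewrite -(pdist_perm (flag_at s).2) -/(flag_coords _ _) rep_at_coords
    -col_permM mulgV col_perm1.
have fv : fcone v by exact: fcone_perm.
have tv : tsum v = 1 by rewrite tsum_perm.
have [p0' p1' _ _] := axis_vecE.
have pos j : 0 < axis_vec 0 j -> 0 <= u 0 j.
  move=> hj; rewrite -vE; apply/ltW; apply: (pos_radius_pos pr (rep_at_glued s) fv tv hv).
  by rewrite rep_at_bary gt_eqF.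
have [W2 W3] := hvec_polar (wrho w) (wphi w - s%:R * al) (wt_gt0 w).
rewrite -natr1 mulrDl mul1r in b2.
have r0 := wrho_ge0 w.
have c0 : 0 <= 2 / s3 by rewrite divr_ge0// ltW.
have nn j : 0 <= u 0 j.
  move: j; apply: forall4; [exact: pos|exact: pos| |]; rewrite mxE mulr_ge0 ?(ltW d0)//.
    by rewrite W2 mulr_ge0// mulr_ge0// sin_ge0_pi//; lra.
  by rewrite W3 mulr_ge0// mulr_ge0// sin_ge0_pi//; lra.
have pv : punctured_simplex v.
  by apply: fcone_punct => // j; rewrite -(permKV (flag_at s).2 j) vE.
exists (mkcell (flag_at s).1 pv); split => //.
split => //; first by rewrite -natr1 mulrDl mul1r.
by rewrite /flag_coords coords_mkcell /v -col_permM mulgV col_perm1.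
Qed.

Lemma sector_ex (N : nat) (f : R) : 0 <= f -> f <= N%:R * al -> (0 < N)%N ->
  exists2 s, (s < N)%N & s%:R * al <= f /\ f <= s.+1%:R * al.
Proof.
move=> f0; elim: N => // N ih fN _.
have [fl|fl] := leP f (N%:R * al); last by exists N => //; split => //; exact: ltW.
have [N0|N0] := posnP N.
  move: fl; rewrite N0 mul0r => fl; exists 0%N => //; rewrite mul0r mul1r; split => //.
  by have := sextant_gt0 R; lra.
by have [s sN h] := ih fl N0; exists s => //; exact: ltn_trans sN _.
Qed.

Lemma same_cell (s s1 : nat) q q1 : flag_at s1 = turn (flag_at s) ->
  projT1 q = (flag_at s).1 -> paired T ((flag_at s).2 i3) q q1 ->
  projT1 q1 = (flag_at s1).1 /\ cdist (rep_at s1) q1 = cdist (rep_at s) q.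
Proof.
move=> fs k pq; have e : rep_at s1 = rep_at s.+1 by apply: rep_at_flag; rewrite fs /flag_at iterS.
have pr := rep_at_paired s; rewrite -e in pr.
have k' : projT1 (rep_at s) = projT1 q by rewrite k.
split; last exact: paired_cdist k' pr pq.
exact: esym (paired_proj k' pr pq).
Qed.

(* Distances in the glued space are bounded above by lengths in the wedge:
   cut the geodesic at each face that it crosses. *)
Lemma step_back o r N s s' q q' w w' : axis_pt_rel o -> pos_radius x0 r ->
  s' = (s + N)%N -> projT1 q = (flag_at s).1 -> projT1 q' = (flag_at s').1 ->
  rel_at s q w -> rel_at s' q' w' -> `|wphi w - wphi w'| <= pi ->
  hdist o (wedge_dev w) + hdist (wedge_dev w) (wedge_dev w') < r \/
  hdist o (wedge_dev w') + hdist (wedge_dev w) (wedge_dev w') < r ->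
  (sdist (to_space T q) (to_space T q') <= (hdist (wedge_dev w) (wedge_dev w'))%:E)%E.
Proof.
move=> ho pr; have a0 := sextant_gt0 R.
elim: N s q w => [|N ih] s q w sE k k' h h' hp hr.
  rewrite addn0 in sE; subst s'; rewrite (rel_at_dist h h').
  by apply: sdist_step; rewrite k k'.
have [b1 b2 _] := h; have [b3 b4 _] := h'.
have ss : s.+1%:R * al <= s'%:R * al by rewrite ler_pM2r// ler_nat sE addnS ltnS leq_addr.
have [w0 [e hw0]] := wedge_cross b2 (le_trans ss b3)
  (le_trans (ler_norm _) (eq_ind _ (fun z => z <= pi) hp _ (distrC _ _))).
have d1 := hdist_ge0 (wedge_dev w) (wedge_dev w0).
have d2 := hdist_ge0 (wedge_dev w0) (wedge_dev w').
have hw0r : hdist o (wedge_dev w0) < r.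
  have t1 := hdist_triangle o (wedge_dev w) (wedge_dev w0).
  have := hdist_triangle o (wedge_dev w') (wedge_dev w0).
  rewrite (hdistC (wedge_dev w') (wedge_dev w0)) => t2.
  by case: hr; lra.
have l1 : s%:R * al <= wphi w0 by rewrite e ler_pM2r// ler_nat.
have l2 : wphi w0 <= s.+1%:R * al by rewrite e.
have l3 : s.+1%:R * al <= wphi w0 by rewrite e.
have l4 : wphi w0 <= s.+2%:R * al by rewrite e ler_pM2r// ler_nat.
have [q0 [k0 _ h00]] := rel_at_surj ho pr l1 l2 hw0r.
have [q1 [k1 _ h1]] := rel_at_surj ho pr l3 l4 hw0r.
have fs : flag_at s.+1 = turn (flag_at s) by rewrite /flag_at iterS.
have qq := cross_same fs k0 k1 h00 h1 e e erefl erefl.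
apply: le_trans (sdist_triangle _ (to_space T q0) _) _.
rewrite -hw0 EFinD; apply: leeD.
  by rewrite (rel_at_dist h h00); apply: sdist_step; rewrite k k0.
rewrite qq; apply: (ih s.+1) => //; first by rewrite sE addSnnS.
  move: hp; rewrite !ler_norml e => /andP[p1 p2]; apply/andP; split; last by have := pi_gt0 R; lra.
  by lra.
case: hr => hr; last by right; lra.
by left; have := hdist_triangle o (wedge_dev w) (wedge_dev w0); lra.
Qed.

(** By [cone_chain_lip], the bound on the distance from [o] plus the cost passes to every
    intermediate point of the chain, which is therefore developed from a point of some cell. *)
Lemma chain_back o r w w' l : axis_pt_rel o -> pos_radius x0 r -> cone_chain w w' l ->
  forall s s' q q', (s < m)%N -> (s' < m)%N ->
  projT1 q = (flag_at s).1 -> projT1 q' = (flag_at s').1 ->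
  rel_at s q w -> rel_at s' q' w' -> hdist o (wedge_dev w) + l < r ->
  (sdist (to_space T q) (to_space T q') <= l%:E)%E.
Proof.
move=> ho pr; have [x0' y0' _] := ho; have a0 := sextant_gt0 R.
have glue v v' s s' q q' : sides_identified v v' -> (s < m)%N -> (s' < m)%N ->
    projT1 q = (flag_at s).1 -> projT1 q' = (flag_at s').1 ->
    rel_at s q v -> rel_at s' q' v' -> to_space T q = to_space T q'.
  move=> [e e' er et] sm sm' k k' h h'; have [b1 _ _] := h; have [_ b4 _] := h'.
  (* The identified sides belong to the first and the last sectors, whose flags are consecutive in
     the cycle. *)
  have s0 : s = 0.
    by move: b1; rewrite e pmulr_lle0// lern0 => /eqP.
  have s'm : s'.+1 = m.
    apply/eqP; rewrite eqn_leq sm' /=.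
    by move: b4; rewrite e' /theta ler_pM2r// ler_nat.
  apply/esym; apply: (@cross_same s' s q' q v' v) => //.
  - by rewrite s0 -(flag_at_order 0) add0n -s'm /flag_at iterS.
  - by rewrite s'm e'.
  - by rewrite e s0 mul0r.
elim=> [{}w {}w' hp|{}w {}w' g|{}w {}w' g|{}w w1 {}w' {}l l' c ih c' ih'] s s' q q' sm sm' k k' h h' hr.
- have [ss|ss] := leqP s s'.
    apply: (@step_back o r (s' - s) s s' q q' w w') => //; first by rewrite subnKC.
    by left.
  rewrite sdistC hdistC; apply: (@step_back o r (s - s') s' s q' q w' w) => //.
  + by rewrite subnKC// ltnW.
  + by rewrite distrC.
  + by right; rewrite (hdistC (wedge_dev w')).
- by rewrite (glue _ _ _ _ _ _ g sm sm' k k' h h') sdist_refl.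
- by rewrite (glue _ _ _ _ _ _ g sm' sm k' k h' h) sdist_refl.
- have l0 := cone_chain_ge0 c; have l'0 := cone_chain_ge0 c'.
  have := cone_chain_lip x0' y0' c; rewrite ler_norml => /andP[h1 h2].
  have w1r : hdist o (wedge_dev w1) < r by lra.
  have /andP[f0 ft] := wphi_bounds w1.
  have [s1 s1m [b1 b2]] := sector_ex f0 ft (fingraph.order_gt0 turn phi).
  have [q1 [k1 _ hq1]] := rel_at_surj ho pr b1 b2 w1r.
  apply: le_trans (sdist_triangle _ (to_space T q1) _) _; rewrite EFinD.
  apply: leeD; first by apply: (ih s s1) => //; lra.
  by apply: (ih' s1 s') => //; lra.
Qed.

Lemma next_cone_dist0 s s' q q' w w' : (s < m)%N -> (s' < m)%N ->
  (s' = s.+1 \/ (s.+1 = m /\ s' = 0)) -> flag_at s' = turn (flag_at s) ->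
  projT1 q = (flag_at s).1 -> paired T ((flag_at s).2 i3) q q' ->
  rel_at s q w -> rel_at s' q' w' -> cone_dist w w' = 0%E.
Proof.
move=> sm sm' ss fs k pq h h'; have a0 := sextant_gt0 R; have p0 := pi_gt0 R.
have [er et H] := pair_same fs k pq h h'.
have [b1 b2 _] := h; have [b3 b4 _] := h'.
suff c : cone_chain w w' 0.
  by apply/eqP; rewrite eq_le cone_dist_ge0 andbT; exact: cone_dist_le c.
case: ss => [e|[e e']].
  apply: cone_chain0.
    split => //; case: H => [->|[-> ->]]; first by left.
    by right; rewrite e.
  move: b2 b3 b4; rewrite e !sextantS => b2 b3 b4.
  by rewrite ler_norml; lra.
have t0 : 0 <= theta <= theta by rewrite lexx (ltW theta_gt0).
have t1 : 0 <= (0 : R) <= theta by rewrite lexx (ltW theta_gt0).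
(* Passage from the last sector to the first: [w1] and [w2] name the point on the two sides of the
   wedge. They are needed as intermediate names because on the axis [w] and [w'] may have other
   angles. *)
pose w1 := MkWedge (wrho_ge0 w) t0 (wt_gt0 w).
pose w2 := MkWedge (wrho_ge0 w) t1 (wt_gt0 w).
have c1 : cone_chain w w1 0.
  apply: cone_chain0.
    by split => //; case: H => [->|[-> _]]; [left|right; rewrite e].
  have thE : theta = s%:R * al + al by rewrite -sextantS e.
  rewrite sextantS -thE in b2; rewrite /= ler0_norm; last by rewrite subr_le0.
  by move: thE b1; set th := edge_angle; lra.
have c2 : cone_chain w1 w2 0 by apply: cone_chain_unglue.
have c3 : cone_chain w2 w' 0.
  apply: cone_chain0.
    by split => //; case: H => [->|[_ ->]]; [left|right; rewrite e' mul0r].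
  move: b3 b4; rewrite e' mul0r mul1r => b3 b4.
  by rewrite /= sub0r normrN ger0_norm//; lra.
by have := cone_chain_trans c1 (cone_chain_trans c2 c3); rewrite !addr0.
Qed.

Lemma edge_isometric : exists2 a : wedge theta, wrho a = 0 &
  locally_isometric (@sdist R n T) (to_space T x0) (@cone_dist R theta) a.
Proof.
have [ o ho] := axis_pt_ex; have [ox oy od] := ho.
have t1 : 0 <= (0 : R) <= theta by rewrite lexx (ltW theta_gt0).
pose a := MkWedge (lexx 0) t1 (ht_gt0 o).
exists a; first by [].
have ao : wedge_dev a = o by apply: H3_eq; rewrite //= ?mul0r ?ox ?oy.
have aE w : cone_dist a w = (hdist o (wedge_dev w))%:E.
  by rewrite cone_dist_axis// ao.
have [r1 pr1] := pos_radius_ex x0.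
(* Half the distance between representatives in the same cell, positive by [rep_at_inj]; it makes
   the sheets disjoint. *)
have [r2 r20 sep] : exists2 r2 : R, 0 < r2 & forall ss : 'I_m * 'I_m,
    ss.1 = ss.2 \/ (projT1 (rep_at ss.1) = projT1 (rep_at ss.2) ->
      2 * r2 <= cdist (rep_at ss.1) (rep_at ss.2)).
  apply: pos_min => [ss b c c0 cb [h|h]|[s s'] /=]; [by left|by right => k; have := h k; lra|].
  have [->|ne] := eqVneq s s'; first by exists 1; rewrite // ; left.
  have [c0|c0] := ltP 0 (cdist (rep_at s) (rep_at s')).
    by exists (cdist (rep_at s) (rep_at s') / 2); [rewrite divr_gt0|right => _; lra].
  exists 1 => //; right => k; exfalso; move/eqP: ne; apply; apply: val_inj.
  apply: (rep_at_inj (ltn_ord s) (ltn_ord s')); apply: (@cdist_eq0 _ _ (rep_at s) (rep_at s') k).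
  by apply/eqP; rewrite eq_le c0 cdist_ge0.
pose r := Num.min r1 r2.
have r0 : 0 < r by rewrite lt_min r20 (proj1 pr1).
have pr : pos_radius x0 r by apply: pos_radius_le pr1 => //; rewrite ge_min lexx.
have rr2 : r <= r2 by rewrite ge_min lexx orbT.
pose x (s : 'I_m) : cell := rep_at s.
apply: (@local_model_isometric R n T _ _ a x0 r 'I_m x (fun (s : 'I_m) q w => rel_at s q w)).
have m0 : (0 < m)%N := fingraph.order_gt0 turn phi.
split => //.
- exact: cone_dist_ge0.
- exact: cone_distC.
- exact: cone_dist_triangle.
- by exists (Ordinal m0); exact: rep_at0.
- by move=> s; apply/esym/to_spaceP/rep_at_glued.
- by move=> s q _; exact: rel_at_ex.
- by move=> s q w _ h; rewrite aE (rel_at_axis ho h).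
- move=> s q q' w w' _ _ h h'; rewrite -(rel_at_dist h h'); apply: cone_dist_le.
  apply: cone_chain_step; have [b1 b2 _] := h; have [b3 b4 _] := h'.
  have a0 := sextant_gt0 R; have p0 := pi_gt0 R.
  by move: b2 b4; rewrite sextantS => *; rewrite ler_norml; lra.
- move=> s q q' [k c] /pairedP[j pq]; have [q0 _ _] := pq.
  have nx (s2 : 'I_m) : exists s' : 'I_m, (val s' = s2.+1 \/ (s2.+1 = m /\ val s' = 0)) /\
      flag_at s' = turn (flag_at s2).
    have [sm|sm] := ltnP s2.+1 m.
      by exists (Ordinal sm); split; [left|rewrite /flag_at iterS].
    have e : s2.+1 = m by apply/eqP; rewrite eqn_leq sm ltn_ord.
    exists (Ordinal m0); split; first by right.
    rewrite -(flag_at_order 0) add0n (_ : flag_at m = flag_at s2.+1); last by rewrite e.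
    by rewrite /flag_at iterS.
  have pv (s' : 'I_m) : exists s1 : 'I_m, (val s' = s1.+1 \/ (s1.+1 = m /\ val s' = 0)) /\
      flag_at s' = turn (flag_at s1).
    have [s0|s0] := posnP s'.
      have m1 : (m.-1 < m)%N by rewrite prednK.
      exists (Ordinal m1); split; first by right; rewrite /= prednK.
      by rewrite /= s0 -(flag_at_order 0) add0n -{1}(prednK m0) /flag_at iterS.
    have s1 : (s'.-1 < m)%N by apply: leq_ltn_trans (leq_pred _) (ltn_ord s').
    exists (Ordinal s1); split; first by left; rewrite /= prednK.
    by rewrite /= -{1}(prednK s0) /flag_at iterS.
  have x0j : bary (x s) j = 0 by exact: pos_radius_face pr (rep_at_glued s) k c q0.
  (* Near the edge only the two faces containing it can be crossed: one leads to the next sector,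
     the other to the previous one. *)
  have [jE|jE] : j = (flag_at s).2 i3 \/ j = (flag_at s).2 i2.
    have [p0 p1 _ _] := axis_vecE.
    move: x0j; rewrite -(permKV (flag_at s).2 j) rep_at_bary.
    move: ((flag_at s).2^-1%g j); apply: forall4 => h; [| |by right|by left].
      by move: p0; rewrite h ltxx.
    by move: p1; rewrite h ltxx.
  + subst j; have [s' [ss fs]] := nx s.
    have [k' c'] := same_cell fs (esym k) pq.
    exists s'; split => //; first by split => //; rewrite /x c'.
    by move=> w w' h h'; exact: next_cone_dist0 (ltn_ord s) (ltn_ord s') ss fs (esym k) pq h h'.
  + subst j; have [s1 [ss fs]] := pv s.
    have tm : (projT1 q, (flag_at s).2 i2) = mate T ((flag_at s1).1, (flag_at s1).2 i3).
      by rewrite -k -turn_mate -fs.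
    have pq' : paired T ((flag_at s1).2 i3) q' q.
      by have := paired_sym pq; rewrite tm mateK.
    have k' : projT1 q' = (flag_at s1).1.
      by have [_ -> _] := pq; rewrite tm mateK.
    have [_ c'] := same_cell fs k' pq'.
    exists s1; split => //; first by split; rewrite ?k'// /x -c'.
    move=> w w' h h'; rewrite cone_distC.
    exact: next_cone_dist0 (ltn_ord s1) (ltn_ord s) ss fs k' pq' h' h.
- move=> s s' q [k c] [k' c']; have [//|h] := sep (s, s').
  exfalso; have /= le := h (etrans k (esym k')).
  have := cdist_triangle (x s) q (x s'); rewrite (cdistC q) /x => tri.
  by rewrite /x in c c'; lra.
- move=> w; rewrite aE lte_fin => hw; have /andP[f0 ft] := wphi_bounds w.
  have [s sm [b1 b2]] := sector_ex f0 ft m0.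
  have [q [k c h]] := rel_at_surj ho pr b1 b2 hw.
  by exists (Ordinal sm), q; split => //; split => //; rewrite k.
- move=> s s' q q' w w' [k c] [k' c'] h h'; rewrite aE => hr.
  rewrite leNgt; apply/negP => lt.
  (* The chain must be short enough to contradict [lt] and also to satisfy the radius bound of
     [chain_back]. *)
  have [l cl ll] : exists2 l, cone_chain w w' l &
      (l%:E < Order.min (sdist (to_space T q) (to_space T q')) (r - hdist o (wedge_dev w))%:E)%E.
    apply: cone_dist_lt; rewrite lt_min lt/= EFinB lteBrDl//.
  move: ll; rewrite lt_min lte_fin => /andP[l1 l2].
  have := chain_back ho pr cl (ltn_ord s) (ltn_ord s') (esym k) (esym k') h h' ltac:(lra).
  by rewrite leNgt l1.
Qed.

End edge_points.

(** * The cone-manifold structure *)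

Section cone_structure.
Variables (R : realType) (n : nat) (T : ideal_triangulation n).

Lemma two_zeros (p : 'rV[R]_4) i j : tsum p = 1 -> i != j -> p 0 i = 0 -> p 0 j = 0 ->
  exists a b : 'I_4, a != b /\ p 0 a + p 0 b = 1.
Proof.
rewrite /tsum sum4 => p1; move: i j.
by apply: forall4; apply: forall4 => // _ h h'; first
  [ by exists i0, i1; split => //; lra | by exists i0, i2; split => //; lra
  | by exists i0, i3; split => //; lra | by exists i1, i2; split => //; lra
  | by exists i1, i3; split => //; lra | by exists i2, i3; split => //; lra ].
Qed.

Lemma space_cone_structure : orientable T -> hyperbolic_cone_structure (@sdist R n T).
Proof.
move=> To; split.
- exact: space_length_metric.
- move=> p; rewrite -(space_repK p); set x := space_rep p => ns.
  have [[i xi]|H] := pselect (exists i, bary x i = 0); last first.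
    apply: interior_isometric => i; apply/eqP => e; apply: H; by exists i.
  apply: (face_isometric T xi) => j ji; apply/eqP => xj; apply: ns.
  have [a [b [ab e]]] := two_zeros (coords_tsum x) ji xj xi.
  by exists (projT1 x), a, b; split => //; exists x.
- move=> k i j ij.
  have [s [si sj]] : exists s : 'S_4, s i0 = i /\ s i1 = j.
    (* The first transposition sends 0 to [i]; the second sends the image of 1 to [j] and fixes
       [i]. *)
    exists (tperm i0 i * tperm (tperm i0 i i1) j)%g.
    have h : tperm i0 i i1 != i.
      by rewrite -[X in _ != X](tpermL i0 i) (inj_eq perm_inj).
    rewrite !permM tpermL; split; last exact: tpermL.
    by apply: tpermD => //; rewrite eq_sym.
  exists (edge_angle R T (k, s)); first exact: theta_gt0.
  move=> p [x [kx e] <-]; apply: (edge_isometric To (phi := (k, s))) => //.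
  by rewrite /= si sj.
Qed.

End cone_structure.

(** * Volume *)

Section hausdorff.
Local Open Scope ereal_scope.
Variables (R : realType) (X : Type) (d : X -> X -> \bar R).
Implicit Types (A B U : set X) (delta : R).

Lemma diameter_ge0 A : 0 <= diameter d A.
Proof. by apply: ereal_sup_ubound; left. Qed.

Lemma diameter_ub A x y : A x -> A y -> d x y <= diameter d A.
Proof. by move=> Ax Ay; apply: ereal_sup_ubound; right; exists (x, y). Qed.

Lemma diameter_le A (c : \bar R) : 0 <= c -> (forall x y, A x -> A y -> d x y <= c) ->
  diameter d A <= c.
Proof.
move=> c0 h; apply: ge_ereal_sup => _ [->//|[[x y] [Ax Ay] <-]].
exact: h.
Qed.

Lemma diameter0 : diameter d set0 = 0.
Proof. by apply/eqP; rewrite eq_le diameter_ge0 andbT; apply: diameter_le. Qed.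

Definition hterm U := (pi / 6)%:E * diameter d U ^+ 3.

Lemma pi6_ge0 : (0 <= pi / 6 :> R)%R.
Proof. by rewrite divr_ge0// pi_ge0. Qed.

Lemma hterm_ge0 U : 0 <= hterm U.
Proof. by rewrite mule_ge0 ?lee_fin ?pi6_ge0// expe_ge0// diameter_ge0. Qed.

Lemma hterm0 : hterm set0 = 0.
Proof. by rewrite /hterm diameter0 expeS mul0e mule0. Qed.

Lemma volume_delta_ge0 delta A : 0 <= volume_delta d delta A.
Proof.
apply: le_ereal_inf_tmp => _ [U _ <-]; apply: nneseries_ge0 => k _ _.
exact: hterm_ge0.
Qed.

Lemma volume_delta_le delta A (U : nat -> set X) : A `<=` \bigcup_i U i ->
  (forall i, diameter d (U i) <= delta%:E) ->
  volume_delta d delta A <= \sum_(0 <= i <oo) hterm (U i).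
Proof. by move=> h h'; apply: ereal_inf_lbound; exists U. Qed.

Lemma volume_delta_anti delta delta' A : (delta <= delta')%R ->
  volume_delta d delta' A <= volume_delta d delta A.
Proof.
move=> dd; apply: le_ereal_inf_tmp => _ [U [AU Ud] <-].
by apply: volume_delta_le => // i; apply: le_trans (Ud i) _; rewrite lee_fin.
Qed.

Lemma volume_delta_volume delta A : (0 < delta)%R ->
  volume_delta d delta A <= volume d A.
Proof. by move=> d0; apply: ereal_sup_ubound; exists delta. Qed.

Lemma volume_ge0 A : 0 <= volume d A.
Proof. exact: le_trans (volume_delta_ge0 1 A) (volume_delta_volume _ ltr01). Qed.

Lemma volume_le A (c : \bar R) :
  (forall delta, (0 < delta)%R -> volume_delta d delta A <= c) -> volume d A <= c.
Proof. by move=> h; apply: ge_ereal_sup => _ [delta d0 <-]; exact: h. Qed.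

Lemma volume_mono A B : A `<=` B -> volume d A <= volume d B.
Proof.
move=> AB; apply: volume_le => delta d0.
apply: le_trans (volume_delta_volume B d0).
apply: le_ereal_inf_tmp => _ [U [BU Ud] <-].
by apply: volume_delta_le => //; exact: subset_trans BU.
Qed.

Lemma volume0 : volume d set0 = 0.
Proof.
apply/eqP; rewrite eq_le volume_ge0 andbT; apply: volume_le => delta d0.
apply: le_trans (volume_delta_le (U := fun=> set0) _ _) _ => //.
  by move=> _; rewrite diameter0 lee_fin ltW.
by rewrite eseries0// => i _ _; exact: hterm0.
Qed.

(** Covers of the [A k], optimal up to [e / 2 ^ k.+1], are merged into one along a bijection between
    [nat] and its square. *)
Lemma volume_delta_bigcup delta (A : nat -> set X) : (0 < delta)%R ->
  volume_delta d delta (\bigcup_k A k) <= \sum_(0 <= k <oo) volume_delta d delta (A k).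
Proof.
move=> d0; have [[k koo]|noo] := pselect (exists k, volume_delta d delta (A k) = +oo).
  rewrite (nneseries_pinfty (k := k)) ?leey// => i _; exact: volume_delta_ge0.
apply/lee_addgt0Pr => e e0.
apply: le_trans (epsilon_trick (fun=> true) _ (ltW e0)); last first.
  by move=> k; exact: volume_delta_ge0.
have G k : exists U : nat -> set X, [/\ A k `<=` \bigcup_i U i,
    forall i, diameter d (U i) <= delta%:E
  & \sum_(0 <= i <oo) hterm (U i) <= volume_delta d delta (A k) + (e / (2 ^ k.+1)%:R)%:E].
  have e1 : (0 < e / (2 ^ k.+1)%:R)%R by rewrite divr_gt0// ltr0n expn_gt0.
  have fn : volume_delta d delta (A k) \is a fin_num.
    rewrite fin_numE; apply/andP; split; last by apply/eqP => h; apply: noo; exists k.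
    by rewrite gt_eqF// (lt_le_trans _ (volume_delta_ge0 _ _))// ltNy0.
  have [_ [U [AU Ud] <-] h] := lb_ereal_inf_adherent e1 fn.
  by exists U; split => //; exact: ltW.
have [U UP] := choice G.
have /card_esym/ppcard_eqP[f] := card_nat2.
pose V i := U (f i).1 (f i).2.
have VE : \sum_(0 <= i <oo) hterm (V i) = \sum_(0 <= k <oo) \sum_(0 <= i <oo) hterm (U k i).
  rewrite nneseries_esumT; last by move=> *; exact: hterm_ge0.
  rewrite -(@reindex_esum _ _ _ [set: nat] [set: nat * nat] f
    (fun ki => hterm (U ki.1 ki.2))); last exact: 'bij_f.
  rewrite nneseries_esumT; last first.
    by move=> k; apply: nneseries_ge0 => i _ _; exact: hterm_ge0.
  rewrite [RHS](@eq_esum _ _ _ _ (fun k => \esum_(i in [set: nat]) hterm (U k i))); last first.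
    by move=> k _; rewrite nneseries_esumT// => i; exact: hterm_ge0.
  rewrite esum_esum; last by move=> *; exact: hterm_ge0.
  by congr esum; apply/seteqP; split.
apply: (@le_trans _ _ (\sum_(0 <= i <oo) hterm (V i))).
  apply: volume_delta_le => [x [k _ Akx]|i]; last by have [_ h _] := UP (f i).1; exact: h.
  have [AU _ _] := UP k; have [i _ Ux] := AU _ Akx.
  by exists (f^-1%FUN (k, i)) => //; rewrite /V invK ?inE.
rewrite VE; apply: lee_nneseries => k.
  by move=> _ _; apply: nneseries_ge0 => i _ _; exact: hterm_ge0.
by move=> _; have [] := UP k.
Qed.

Lemma volume_bigcup (A : nat -> set X) :
  volume d (\bigcup_k A k) <= \sum_(0 <= k <oo) volume d (A k).
Proof.
apply: volume_le => delta d0; apply: le_trans (volume_delta_bigcup _ d0) _.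
apply: lee_nneseries => [k _ _|k _]; first exact: volume_delta_ge0.
exact: volume_delta_volume.
Qed.

Lemma volume_finite_cover (N : nat) (A : nat -> set X) B :
  B `<=` \bigcup_(k < N) A k -> volume d B <= \sum_(0 <= k < N) volume d (A k).
Proof.
move=> BA; pose A' k := if (k < N)%N then A k else set0.
apply: (@le_trans _ _ (volume d (\bigcup_k A' k))).
  apply: volume_mono => x /BA[k /= kN Ax]; exists k => //.
  by rewrite /A' kN.
apply: le_trans (volume_bigcup _) _.
rewrite (nneseries_split _ N) ?add0n; last by move=> *; exact: volume_ge0.
rewrite [X in _ + X]eseries0 ?adde0; last first.
  by move=> i Ni _; rewrite /A' ltnNge Ni/= volume0.
by rewrite !big_nat; apply: lee_sum => k /andP[_ kN]; rewrite /A' kN.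
Qed.

Lemma volume_setU A B : volume d (A `|` B) <= volume d A + volume d B.
Proof.
have h : A `|` B `<=` \bigcup_(k < 2) (if k is 0%N then A else B).
  by move=> x [Ax|Bx]; [exists 0%N|exists 1%N].
apply: (le_trans (volume_finite_cover h)).
by rewrite big_nat_recr/= ?big_nat1.
Qed.

(** For sets of dimension 2: [N ^ 2] pieces of diameter at most [c / N] contribute at most a
    constant times [1 / N]. *)
Lemma volume_grid0 A (c : R) : (0 <= c)%R ->
  (forall N, (0 < N)%N -> exists U : nat -> set X,
     A `<=` \bigcup_(i < N ^ 2) U i /\ forall i, diameter d (U i) <= (c / N%:R)%:E) ->
  volume d A = 0.
Proof.
move=> c0 h; apply/eqP; rewrite eq_le volume_ge0 andbT.
apply: volume_le => delta d0.
pose K : R := (pi / 6 * c ^+ 3)%R.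
have K0 : (0 <= K)%R by rewrite mulr_ge0 ?exprn_ge0// pi6_ge0.
have key N : (0 < N)%N -> (c / delta <= N%:R)%R -> volume_delta d delta A <= (K / N%:R)%:E.
  move=> N0 cN; have [U [AU Ud]] := h N N0.
  have n0 : (0 < N%:R :> R)%R by rewrite ltr0n.
  pose V i := if (i < N ^ 2)%N then U i else set0.
  apply: le_trans (volume_delta_le (U := V) _ _) _.
  - move=> x /AU[i /= iN Ux]; exists i => //; by rewrite /V iN.
  - move=> i; rewrite /V; case: ifP => _; last by rewrite diameter0 lee_fin ltW.
    apply: le_trans (Ud i) _; rewrite lee_fin ler_pdivrMr// mulrC -ler_pdivrMr//.
  rewrite (nneseries_split _ (N ^ 2)) ?add0n; last by move=> *; exact: hterm_ge0.
  rewrite [X in _ + X]eseries0 ?adde0; last first.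
    by move=> i Ni _; rewrite /V ltnNge Ni/= hterm0.
  apply: (@le_trans _ _ (\sum_(0 <= i < N ^ 2) (pi / 6 * (c / N%:R) ^+ 3)%:E)).
    rewrite !big_nat; apply: lee_sum => i /andP[_ iN]; rewrite /V iN /hterm [leRHS]EFinM.
    apply: lee_wpmul2l; first by rewrite lee_fin pi6_ge0.
    rewrite EFin_expe !expeS !expe0 !mule1.
    by do !apply: lee_pmul => //; rewrite ?mule_ge0 ?diameter_ge0.
  rewrite sumEFin lee_fin big_const_nat subn0 iter_addr_0 -[(_ *+ _)%R]mulr_natr natrX.
  rewrite /K le_eqVlt; apply/orP; left; apply/eqP; field; by rewrite gt_eqF.
apply/lee_addgt0Pr => e e0; rewrite add0e.
pose N := (Num.truncn (c / delta + K / e)).+1.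
have hN : (c / delta + K / e < N%:R)%R by apply: real_truncnS_gt; exact: num_real.
have cd : (0 <= c / delta)%R by rewrite divr_ge0// ltW.
have Ke : (0 <= K / e)%R by rewrite divr_ge0// ltW.
apply: le_trans (key N _ _) _ => //; first by lra.
rewrite lee_fin ler_pdivrMr ?ltr0n// mulrC -ler_pdivrMr//; lra.
Qed.

End hausdorff.

(** * Comparison of volumes *)

Section lipschitz.
Local Open Scope ereal_scope.
Variables (R : realType) (X Y : Type) (dX : X -> X -> \bar R) (dY : Y -> Y -> \bar R).

Lemma hterm_le (V : set Y) (U : set X) : diameter dY V <= diameter dX U ->
  hterm dY V <= hterm dX U.
Proof.
move=> h; rewrite /hterm; apply: lee_wpmul2l; first by rewrite lee_fin pi6_ge0.
have h0 := diameter_ge0 dX U; have h1 := diameter_ge0 dY V.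
by rewrite !expeS !expe0 !mule1; do !apply: lee_pmul => //; rewrite ?mule_ge0.
Qed.

Lemma volume_lipschitz (phi : X -> Y) (A : set X) :
  (forall x y, A x -> A y -> dY (phi x) (phi y) <= dX x y) ->
  volume dY (phi @` A) <= volume dX A.
Proof.
move=> lip; apply: volume_le => delta d0; apply: le_trans (volume_delta_volume dX A d0).
apply: le_ereal_inf_tmp => _ [U [AU Ud] <-].
have dU i : diameter dY (phi @` (A `&` U i)) <= diameter dX (U i).
  apply: diameter_le; first exact: diameter_ge0.
  move=> _ _ [x [Ax Ux] <-] [y [Ay Uy] <-].
  by apply: le_trans (lip _ _ Ax Ay) _; exact: diameter_ub.
apply: le_trans (volume_delta_le (U := fun i => phi @` (A `&` U i)) _ _) _.
- move=> _ [x Ax <-]; have [i _ Ux] := AU _ Ax.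
  by exists i => //; exists x.
- by move=> i; exact: le_trans (dU i) (Ud i).
- apply: lee_nneseries => [i _ _|i _]; first exact: hterm_ge0.
  exact: hterm_le.
Qed.

End lipschitz.

Section separated.
Local Open Scope ereal_scope.
Variables (R : realType) (X Y : Type) (dX : X -> X -> \bar R) (dY : Y -> Y -> \bar R).

(** Since [volume_delta] grows as [delta] shrinks, the summands can be replaced by their suprema one
    at a time, the remaining ones being evaluated at a smaller [delta]. *)
Lemma sup_sum_le (N : nat) (B : nat -> set Y) (M : \bar R) :
  (forall delta : R, (0 < delta)%R ->
     \sum_(0 <= k < N) volume_delta dY delta (B k) <= M) ->
  \sum_(0 <= k < N) volume dY (B k) <= M.
Proof.
move=> h.
have key j delta : (j <= N)%N -> (0 < delta)%R ->
    \sum_(0 <= k < j) volume dY (B k) + \sum_(j <= k < N) volume_delta dY delta (B k) <= M.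
  elim: j delta => [|j ih] delta jN d0.
    by rewrite big_geq// add0e; exact: h.
  rewrite big_nat_recr//=.
  set P := \sum_(0 <= k < j) _; set S := \sum_(j.+1 <= k < N) _.
  have P0 : 0 <= P by apply: sume_ge0 => k _; exact: volume_ge0.
  have S0 : 0 <= S by apply: sume_ge0 => k _; exact: volume_delta_ge0.
  rewrite -addeA (addeC (volume _ _)) addeA.
  have [e|PS] := eqVneq (P + S) +oo.
    have := ih delta (ltnW jN) d0; rewrite -/P big_ltn// -/S addeCA addeA => le.
    suff -> : M = +oo by rewrite leey.
    apply/eqP; rewrite -leye_eq; apply: le_trans le.
    by rewrite -addeA e addey// gt_eqF// (lt_le_trans _ (volume_delta_ge0 _ _ _))// ltNy0.
  have fn : P + S \is a fin_num.
    by rewrite fin_numE PS andbT gt_eqF// (lt_le_trans _ (adde_ge0 P0 S0))// ltNy0.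
  rewrite addeC -leeBrDr//; apply: volume_le => delta' d'0; rewrite leeBrDr//.
  pose m := Num.min delta delta'.
  have m0 : (0 < m)%R by rewrite lt_min d0 d'0.
  apply: le_trans (ih m (ltnW jN) m0); rewrite -/P big_ltn// [leRHS]addeCA.
  apply: leeD; first by apply: volume_delta_anti; rewrite ge_min lexx orbT.
  apply: leeD => //; apply: lee_sum => k _.
  by apply: volume_delta_anti; rewrite ge_min lexx.
case: N h key => [|N] h key; first by have := h 1%R ltr01; rewrite !big_geq.
have := key N.+1 1%R (leqnn _) ltr01.
by rewrite [X in _ + X]big_geq// adde0.
Qed.

(** A set of diameter below [r] meets the image of at most one [B k] and pulls back to it without
    increase of diameter, so each set in a fine cover of [S] is charged to a single summand. *)
Lemma separated_volume (N : nat) (phi : nat -> Y -> X) (B : nat -> set Y)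
    (S : set X) (r : R) : (0 < r)%R ->
  (forall k, (k < N)%N -> phi k @` B k `<=` S) ->
  (forall k b b', (k < N)%N -> B k b -> B k b' -> dX (phi k b) (phi k b') < r%:E ->
     dY b b' <= dX (phi k b) (phi k b')) ->
  (forall k l b b', (k < N)%N -> (l < N)%N -> B k b -> B l b' -> k <> l ->
     r%:E <= dX (phi k b) (phi l b')) ->
  \sum_(0 <= k < N) volume dY (B k) <= volume dX S.
Proof.
move=> r0 BS iso sep; apply: sup_sum_le => delta d0.
pose e := Num.min delta (r / 2)%R.
have e0 : (0 < e)%R by rewrite lt_min d0 divr_gt0.
have ed : (e <= delta)%R by rewrite ge_min lexx.
have er : (e < r)%R by rewrite gt_min; apply/orP; right; lra.
apply: le_trans (volume_delta_volume dX S e0).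
apply: le_ereal_inf_tmp => _ [U [SU Ud] <-].
pose W k i := [set b | B k b /\ U i (phi k b)].
have dU i x y : U i x -> U i y -> dX x y < r%:E.
  move=> Ux Uy; apply: le_lt_trans (diameter_ub dX Ux Uy) _.
  by apply: le_lt_trans (Ud i) _; rewrite lte_fin.
have dW k i : (k < N)%N -> diameter dY (W k i) <= diameter dX (U i).
  move=> kN; apply: diameter_le; first exact: diameter_ge0.
  move=> b b' [Bb Ub] [Bb' Ub']; apply: le_trans (iso _ _ _ kN Bb Bb' (dU _ _ _ Ub Ub')) _.
  exact: diameter_ub.
apply: (@le_trans _ _ (\sum_(0 <= k < N) \sum_(0 <= i <oo) hterm dY (W k i))).
  rewrite !big_nat; apply: lee_sum => k /andP[_ kN]; apply: volume_delta_le.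
    move=> b Bb; have [i _ Ui] : (\bigcup_i U i) (phi k b) by apply/SU/(BS k kN); exists b.
    by exists i.
  by move=> i; apply: le_trans (dW k i kN) _; apply: le_trans (Ud i) _; rewrite lee_fin.
rewrite -nneseries_sum; last by move=> *; exact: hterm_ge0.
apply: lee_nneseries => [i _ _|i _]; first by apply: sume_ge0 => k _; exact: hterm_ge0.
have [[k [kN [b Wb]]]|H] := pselect (exists k, (k < N)%N /\ W k i !=set0).
  rewrite (bigD1_seq k) ?mem_index_iota ?iota_uniq//=.
  rewrite big1_seq ?adde0; first by apply: hterm_le; exact: dW.
  move=> l /andP[lk]; rewrite mem_index_iota => /andP[_ lN].
  rewrite (_ : W l i = set0) ?hterm0//; apply/seteqP; split => // b' Wb'.
  case: Wb Wb' => Bb Ub [Bb' Ub'].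
  have kl : k <> l by move=> e'; move: lk; rewrite e' eqxx.
  by have := sep _ _ _ _ kN lN Bb Bb' kl; rewrite leNgt (dU i).
rewrite big1_seq ?hterm_ge0// => k /andP[_]; rewrite mem_index_iota => /andP[_ kN].
rewrite (_ : W k i = set0) ?hterm0//; apply/seteqP; split => // b Wb.
by apply: H; exists k; split => //; exists b.
Qed.

End separated.

Section exhaustion.
Variables (R : realType) (Y : Type) (d : Y -> Y -> \bar R).

(* Continuity of a metric outer measure along an exhaustion: the layers of the
   same parity are at positive distance from each other. *)
Lemma volume_exhaustion (K : nat -> set Y) (M : \bar R) :
  (forall x y, d x y = d y x) ->
  (forall m, K m `<=` K m.+1) ->
  (forall m, exists2 c : R, 0 < c & forall x y, K m x -> ~ K m.+1 y -> (c%:E <= d x y)%E) ->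
  (forall m, (volume d (K m) <= M)%E) -> (volume d (\bigcup_m K m) <= M)%E.
Proof.
move=> dC Kinc Ksep KM.
have [->|Moo] := eqVneq M +oo%E; first exact: leey.
have M0 : (0 <= M)%E by apply: le_trans (KM 0%N); exact: volume_ge0.
have Mfin : M \is a fin_num by rewrite fin_numE Moo andbT gt_eqF// (lt_le_trans _ M0)// ltNy0.
have Kle m p : (m <= p)%N -> K m `<=` K p.
  by move=> /subnK <-; elim: (p - m)%N => [//|j ih]; rewrite addSn; exact: subset_trans ih (Kinc _).
pose B j := K j.+1 `\` K j.
have rsep (N : nat) : exists2 r : R, 0 < r & forall m x y, (m <= N)%N -> K m x -> ~ K m.+1 y ->
    (r%:E <= d x y)%E.
  elim: N => [|N [r r0 h]].
    by have [c c0 h] := Ksep 0%N; exists c => // m x y; rewrite leqn0 => /eqP ->; exact: h.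
  have [c c0 h'] := Ksep N.+1; exists (Num.min r c); first by rewrite lt_min r0 c0.
  move=> m x y; rewrite leq_eqVlt => /predU1P[->|mN] Kx Ky.
    by apply: le_trans (h' _ _ Kx Ky); rewrite lee_fin ge_min lexx orbT.
  by apply: le_trans (h _ _ _ mN Kx Ky); rewrite lee_fin ge_min lexx.
have par (b : bool) N : (\sum_(0 <= j < N) volume d (if odd j == b then B j else set0) <= M)%E.
  apply: le_trans (KM N); have [r r0 h] := rsep N.
  have far k l x y : (k < l)%N -> odd k = odd l -> (l < N)%N -> B k x -> B l y -> (r%:E <= d x y)%E.
    move=> kl kol lN [Kx _] [_ Ky].
    have kl' : (k.+2 <= l)%N.
      by rewrite ltn_neqAle kl andbT; apply/eqP => e; move: kol; rewrite -e /=; case: (odd k).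
    apply: (h k.+1) => //; first exact: leq_trans (ltnW kl') (ltnW lN).
    by move=> Ky'; apply: Ky; exact: Kle kl' _ Ky'.
  apply: (separated_volume (phi := fun _ y => y) (r := r)) => //.
  - move=> k kN _ [x + <-]; case: ifP => // _ [Kx _]; exact: Kle kN _ Kx.
  - move=> k l x y kN lN; case: ifP => // /eqP ok; case: ifP => // /eqP ol Bx By kl.
    have [lt|lt|//] := ltngtP k l; first by apply: far lt _ lN Bx By; rewrite ok ol.
    by rewrite dC; apply: far lt _ kN By Bx; rewrite ok ol.
have tot N : (\sum_(0 <= j < N) volume d (B j) <= M + M)%E.
  apply: le_trans (leeD (par true N) (par false N)); rewrite -big_split /=.
  apply: lee_sum => j _; case: (odd j) => /=; first by rewrite volume0 adde0.
  by rewrite volume0 add0e.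
have V0 j : (0 <= volume d (B j))%E := volume_ge0 _ _.
have fin : (\sum_(0 <= j <oo) volume d (B j) < +oo)%E.
  apply: (@le_lt_trans _ _ (M + M)%E); last first.
    by rewrite -ge0_fin_numE ?adde_ge0// fin_numD Mfin.
  apply: lime_le; first exact: is_cvg_nneseries.
  by apply: nearW => N; exact: tot.
have tail := nneseries_tail_cvg fin (fun j _ => V0 j).
(* The two parities only give [M + M], but this makes the series of layers converge; discarding
   [K m] and letting [m] grow brings the bound down to [M]. *)
have bound m : (volume d (\bigcup_m K m) <= M + \sum_(m <= j <oo) volume d (B j))%E.
  apply: (@le_trans _ _ (volume d (K m `|` \bigcup_j B (j + m)%N))).
    apply: volume_mono => x [p _ Kx].
    have : K (p + m)%N x by apply: Kle Kx; exact: leq_addr.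
    elim: p {Kx} => [|p ih] Kx; first by left.
    have [/ih//|nK] := pselect (K (p + m)%N x).
    by right; exists p.
  apply: le_trans (volume_setU _ _ _) _; apply: leeD; first exact: KM.
  apply: le_trans (volume_bigcup _ _) _.
  by rewrite (nneseries_addn (f := fun j => volume d (B j))).
have lim : (M + \sum_(m <= j <oo) volume d (B j))%E @[m --> \oo] --> M.
  rewrite -[X in _ --> X]adde0; apply: cvgeD => //; first by rewrite fin_num_adde_defr.
  exact: cvg_cst.
rewrite -(cvg_lim _ lim)//; apply: lime_ge; first by apply/cvg_ex; exists M.
by apply: nearW.
Qed.

End exhaustion.

(** * Volume of the regular ideal tetrahedron *)

Section tetrahedron.
Variable R : realType.
Implicit Types (w : H3 R).
Local Notation hd := (@hedist R).
Local Notation Tet := (@regular_ideal_tetrahedron R).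

Definition bvec w : 'rV[R]_4 := (tsum (hvec w))^-1 *: hvec w.

Lemma tsumV_gt0 w : 0 < (tsum (hvec w))^-1.
Proof. by rewrite invr_gt0 tsum_hvec_gt0. Qed.

Lemma fcone_bvec w : fcone (bvec w).
Proof. exact: fconeZ (tsumV_gt0 w) (fcone_hvec w). Qed.

Lemma tsum_bvec w : tsum (bvec w) = 1.
Proof. by rewrite tsumZ mulVf// gt_eqF// tsum_hvec_gt0. Qed.

Lemma hdist_bvec w w' : hdist w w' = pdist (bvec w) (bvec w').
Proof. by rewrite hdistE pdistZl ?tsumV_gt0// pdistZr ?tsumV_gt0. Qed.

Lemma tet_bvec w : Tet w <-> forall i, 0 <= bvec w 0 i.
Proof.
rewrite tetrahedronE; split => h i; have := h i; rewrite !mxE.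
  by rewrite pmulr_rge0// tsumV_gt0.
by rewrite pmulr_rge0// tsumV_gt0.
Qed.

Lemma tet_punct w : Tet w -> punctured_simplex (bvec w).
Proof. by move=> /tet_bvec h; apply: fcone_punct (tsum_bvec w) h (fcone_bvec w). Qed.

Definition tet_core (m : nat) : set (H3 R) :=
  [set w | forall i, (m.+2%:R)^-1 <= bvec w 0 i].

Lemma tet_core_tet m : tet_core m `<=` Tet.
Proof.
by move=> w h; apply/tet_bvec => i; apply: le_trans (h i); rewrite invr_ge0.
Qed.

Lemma bvec_le_sinh w w' i : `|bvec w 0 i - bvec w' 0 i| <= sinh (hdist w w').
Proof.
by rewrite hdist_bvec; apply: coord_le_sinh => //; [exact: fcone_bvec|exact: fcone_bvec
  |exact: tsum_bvec|exact: tsum_bvec].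
Qed.

(** The face is exhausted by the parts [F m] away from the ideal vertices, on which distances are
    Lipschitz in the coordinates and a square grid in two coordinates can be used. *)
Lemma volume_face i : volume hd [set w | Tet w /\ bvec w 0 i = 0] = 0%E.
Proof.
pose F m := [set w | [/\ Tet w, bvec w 0 i = 0 & (m.+1%:R)^-1 <= mink (bvec w) (bvec w)]].
have FV m : volume hd (F m) = 0%E.
  have [j [k [l [e ijk]]]] : exists j k l : 'I_4, (forall p : 'rV[R]_4,
      tsum p = p 0 i + p 0 j + p 0 k + p 0 l) /\ forall x, [\/ x = i, x = j, x = k | x = l].
    rewrite /tsum; move: i {F}; apply: forall4.
    - exists i1, i2, i3; split; first by move=> p; rewrite sum4.
      by apply: forall4; [constructor 1|constructor 2|constructor 3|constructor 4].
    - exists i0, i2, i3; split; first by move=> p; rewrite sum4; ring.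
      by apply: forall4; [constructor 2|constructor 1|constructor 3|constructor 4].
    - exists i0, i1, i3; split; first by move=> p; rewrite sum4; ring.
      by apply: forall4; [constructor 2|constructor 3|constructor 1|constructor 4].
    - exists i0, i1, i2; split; first by move=> p; rewrite sum4; ring.
      by apply: forall4; [constructor 2|constructor 3|constructor 4|constructor 1].
  (* In a grid square two coordinates vary by at most [1 / N], so the last one by at most [2 / N];
     [pdist_lip] multiplies this by [4 * m.+1]. *)
  apply: (@volume_grid0 _ _ _ _ (8 * m.+1%:R)); first by rewrite mulr_ge0.
  move=> N N0; have n0 : 0 < N%:R :> R by rewrite ltr0n.
  pose U t := [set w | [/\ F m w,
    (t %/ N)%:R <= N%:R * bvec w 0 j <= (t %/ N).+1%:R
    & (t %% N)%:R <= N%:R * bvec w 0 k <= (t %% N).+1%:R]].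
  exists U; split.
    move=> w Fw; have [Tw _ _] := Fw; have pw := tet_punct Tw; have [p0 _ _] := pw.
    have tr (x : 'I_4) : [/\ (Num.truncn (N%:R * bvec w 0 x)%R < N)%N,
        (Num.truncn (N%:R * bvec w 0 x))%:R <= N%:R * bvec w 0 x
        & N%:R * bvec w 0 x <= (Num.truncn (N%:R * bvec w 0 x)).+1%:R].
      have b0 : 0 <= N%:R * bvec w 0 x by rewrite mulr_ge0.
      have /andP[h1 h2] := truncn_itv b0; split => //; last exact: ltW.
      rewrite -(ltr_nat R); apply: le_lt_trans h1 _.
      by rewrite gtr_pMr// punct_lt1.
    have [s1 s2 s3] := tr j; have [t1 t2 t3] := tr k.
    set s := Num.truncn _ in s1 s2 s3; set t := Num.truncn _ in t1 t2 t3.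
    exists (s * N + t)%N => /=.
      by rewrite -mulnn; apply: leq_trans (_ : s.+1 * N <= _)%N;
        [rewrite mulSn addnC ltn_add2r|rewrite leq_mul2r s1 orbT].
    rewrite /U /= divnMDl// (divn_small t1) addn0 modnMDl (modn_small t1).
    by split => //; apply/andP.
  move=> t; apply: diameter_le.
    by rewrite lee_fin divr_ge0// mulr_ge0.
  move=> w w' [[Tw wi wm] /andP[a1 a2] /andP[a3 a4]] [[Tw' wi' wm'] /andP[b1 b2] /andP[b3 b4]].
  rewrite lee_fin hdist_bvec.
  have m0 : 0 < (m.+1%:R : R)^-1 by rewrite invr_gt0.
  have hx x : `|bvec w 0 x - bvec w' 0 x| <= 2 / N%:R.
    rewrite ler_pdivlMr// -[N%:R]gtr0_norm// -normrM mulrBl !(mulrC _ N%:R).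
    have ew : N%:R * bvec w 0 i + N%:R * bvec w 0 j + N%:R * bvec w 0 k + N%:R * bvec w 0 l = N%:R.
      by rewrite -!mulrDr -e tsum_bvec mulr1.
    have ew' : N%:R * bvec w' 0 i + N%:R * bvec w' 0 j + N%:R * bvec w' 0 k + N%:R * bvec w' 0 l = N%:R.
      by rewrite -!mulrDr -e tsum_bvec mulr1.
    rewrite wi mulr0 in ew; rewrite wi' mulr0 in ew'.
    rewrite -[(t %/ N).+1%:R]natr1 in a2 b2; rewrite -[(t %% N).+1%:R]natr1 in a4 b4.
    rewrite ler_norml; have [->|->|->|->] := ijk x; rewrite ?wi ?wi'; lra.
  apply: le_trans (pdist_lip (tet_punct Tw) (tet_punct Tw') m0 wm wm' hx) _.
  by rewrite invrK; lra.
apply/eqP; rewrite eq_le volume_ge0 andbT.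
apply: (@le_trans _ _ (volume hd (\bigcup_m F m))).
  apply: volume_mono => w [Tw wi]; have [_ mw] := fcone_bvec w.
  exists (Num.truncn (mink (bvec w) (bvec w))^-1) => //; split => //.
  rewrite -[leRHS]invrK lef_pV2 ?posrE ?invr_gt0//.
  by apply/ltW/real_truncnS_gt/num_real.
apply: le_trans (volume_bigcup _ _) _.
by rewrite eseries0// => m _ _; exact: FV.
Qed.

Lemma volume_tet_le (M : \bar R) : (forall m, (volume hd (tet_core m) <= M)%E) ->
  (volume hd Tet <= M)%E.
Proof.
move=> hM.
(* The faces are indexed by all naturals to form a countable union; [inord] repeats one of them from
   4 on. *)
have cover : Tet `<=` (\bigcup_m tet_core m) `|`
    \bigcup_k [set w | Tet w /\ bvec w 0 (inord k : 'I_4) = 0].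
  move=> w Tw; have [[i wi]|H] := pselect (exists i, bvec w 0 i = 0).
    by right; exists (val i) => //; split => //; rewrite inord_val.
  left; have [e e0 he] : exists2 e : R, 0 < e & forall i, e <= bvec w 0 i.
    apply: pos_min => [i a b _ ba h|i]; first exact: le_trans h.
    exists (bvec w 0 i) => //; rewrite lt_neqAle (proj1 (tet_bvec w) Tw) andbT.
    by apply/eqP => h; apply: H; exists i.
  exists (Num.truncn e^-1) => // i; apply: le_trans (he i).
  rewrite -[leRHS]invrK lef_pV2 ?posrE ?invr_gt0//.
  apply: le_trans (ltW (real_truncnS_gt (num_real _))) _.
  by rewrite ler_nat.
apply: le_trans (volume_mono hd cover) _; apply: le_trans (volume_setU _ _ _) _.
rewrite [X in (_ + X)%E](_ : _ = 0%E); last first.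
  apply/eqP; rewrite eq_le volume_ge0 andbT; apply: le_trans (volume_bigcup _ _) _.
  by rewrite eseries0// => k _ _; exact: volume_face.
rewrite adde0; apply: volume_exhaustion => //.
- exact: hedistC.
- move=> m w h i; apply: le_trans (h i); rewrite lef_pV2 ?posrE//.
  by rewrite ler_nat.
- move=> m; have e0 : 0 < (m.+2%:R)^-1 - (m.+3%:R)^-1 :> R.
    by rewrite subr_gt0 ltf_pV2 ?posrE// ltr_nat.
  have [r r0 hr] := sinh_small e0; exists r => // x y Kx /existsNP[i /negP].
  rewrite -ltNge => yi; rewrite lee_fin leNgt; apply/negP => /sinh_lt lt.
  have := bvec_le_sinh x y i; have := Kx i; have := ler_norm (bvec x 0 i - bvec y 0 i).
  move: yi lt hr; set a := (m.+2%:R)^-1; set b := (m.+3%:R)^-1; lra.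
Qed.

End tetrahedron.

(** * Volume of the glued space *)

Section total_volume.
Variables (R : realType) (n : nat) (T : ideal_triangulation n).
Local Notation cell := (cells R n).
Local Notation hd := (@hedist R).
Local Notation Tet := (@regular_ideal_tetrahedron R).
Implicit Types x y : cell.

Lemma glued_interior x y : glued T x y -> (forall i, bary x i != 0) -> x = y.
Proof.
move=> /asboolP h; suff : (forall i, bary x i != 0) \/ (forall i, bary y i != 0) -> x = y.
  by move=> H xi; apply: H; left.
elim: h => {x y} [x y /pairedP[i [xi _ v]]|//|x y _ ih|x y z _ ih _ ih'].
- move=> [/(_ i)|/(_ (vertex_map T (projT1 x, i) i))]; first by rewrite xi eqxx.
  by move: xi; rewrite !baryE v mxE => ->; rewrite eqxx.
- by move=> [h|h]; apply/esym/ih; [right|left].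
- move=> [h|h].
    by have e := ih (or_introl h); rewrite e; apply: ih'; left; rewrite -e.
  by have e := ih' (or_intror h); rewrite -e; apply: ih; right; rewrite e.
Qed.

(** An interior point is its only representative, so the one that [chain_near] carries along a short
    chain is always [x] itself. *)
Lemma interior_near x y r : pos_radius x r -> (forall i, bary x i != 0) ->
  (sdist (to_space T x) (to_space T y) < r%:E)%E ->
  projT1 x = projT1 y /\ ((cdist x y)%:E <= sdist (to_space T x) (to_space T y))%E.
Proof.
move=> pr xi; have [r0 _] := pr.
have gr : good_radius T x r.
  by split => // x' q i g k c; exact: pos_radius_face pr g k c.
have key l : chain T x y l -> l < r -> projT1 x = projT1 y /\ cdist x y <= l.
  move=> c lr; have [|x' [g k le]] := chain_near gr c (glued_refl T x) erefl.
    by rewrite cdist_refl add0r.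
  by rewrite -(glued_interior g xi) cdist_refl add0r in k le.
rewrite sdistE => h; have [l c lr] := gdist_lt h; split; first by have [] := key _ c lr.
rewrite leNgt; apply/negP => h'.
have [l' c' l'r] := gdist_lt h'.
have [l'r'|l'r'] := ltP l' r; first by have [_] := key _ c' l'r'; lra.
by have [_ ?] := key _ c lr; lra.
Qed.

Lemma total_volume (n_gt0 : (0 < n)%N) :
  volume (@sdist R n T) [set: ideal_space R T] = ((n%:R)%:E * volume hd Tet)%E.
Proof.
have nr : 0 < n%:R :> R by rewrite ltr0n.
(* Cells are numbered by naturals for the sums; indices from [n] on get the default cell 0. *)
pose kk (k : nat) : 'I_n := odflt (Ordinal n_gt0) (insub k).
have kkE k (kn : (k < n)%N) : kk k = Ordinal kn by rewrite /kk insubT.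
have [psi psiP] : exists psi : nat -> H3 R -> cell, forall k w, Tet w ->
    projT1 (psi k w) = kk k /\ coords (psi k w) = bvec w.
  have C kw : exists x : cell, Tet kw.2 -> projT1 x = kk kw.1 /\ coords x = bvec kw.2.
    have [Tw|nT] := pselect (Tet kw.2); first by exists (mkcell (kk kw.1) (tet_punct Tw)).
    have pc : punctured_simplex (@barycenter R).
      split => [i||i]; rewrite ?mxE//; first exact: tsum_center.
      by apply/eqP; lra.
    by exists (mkcell (kk kw.1) pc).
  have [f fP] := choice C; exists (fun k w => f (k, w)) => k w.
  exact: (fP (k, w)).
pose phi k w := to_space T (psi k w).
have dist k w w' : Tet w -> Tet w' -> cdist (psi k w) (psi k w') = hdist w w'.
  move=> Tw Tw'; have [_ e] := psiP k _ Tw; have [_ e'] := psiP k _ Tw'.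
  by rewrite hdist_bvec /cdist e e'.
have sumE (c : \bar R) : (0 <= c)%E -> (\sum_(0 <= k < n) c = (n%:R)%:E * c)%E.
  move=> c0; rewrite big_const_nat subn0; elim: (n) => [|j ih].
    by rewrite mul0e.
  by rewrite iterS ih -natr1 EFinD ge0_muleDl ?lee_fin// mul1e addeC.
apply/eqP; rewrite eq_le; apply/andP; split.
  rewrite -sumE ?volume_ge0//.
  have cov : [set: ideal_space R T] `<=` \bigcup_(k < n) (phi k @` Tet).
    move=> P _; set x := space_rep P.
    have [w [c [c0 e]]] := hvec_surj (coords_fcone x).
    have bw : bvec w = coords x.
      rewrite /bvec e tsumZ coords_tsum mulr1 scalerA mulVf ?scale1r// gt_eqF//.
    have Tw : Tet w by apply/tet_bvec => i; rewrite bw coords_ge0.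
    exists (projT1 x) => /=; first exact: ltn_ord.
    exists w => //; rewrite -(space_repK P); congr to_space.
    have [k' e'] := psiP (projT1 x) _ Tw; apply: cell_eq; last by rewrite e' bw.
    by rewrite k' kkE; apply: val_inj.
  apply: le_trans (volume_finite_cover (@sdist R n T) cov) _.
  apply: lee_sum => k _; apply: volume_lipschitz => w w' Tw Tw'.
  rewrite /hedist -(dist k)//; apply: sdist_step.
  by have [-> _] := psiP k _ Tw; have [-> _] := psiP k _ Tw'.
(* Dividing by [n] isolates a single tetrahedron, which can be replaced by its core; multiplying
   back gives [n] cores, separated in the glued space. *)
rewrite -lee_pdivlMl//; apply: volume_tet_le => m.
rewrite lee_pdivlMl// -sumE ?volume_ge0//.
have e0 : 0 < (m.+2%:R)^-1 :> R by rewrite invr_gt0.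
have [r r0 hr] := sinh_small e0.
have core k w : tet_core m w -> pos_radius (psi k w) r /\ forall i, bary (psi k w) i != 0.
  move=> Kw; have [_ e] := psiP k _ (tet_core_tet Kw).
  split; last by move=> i; rewrite baryE e gt_eqF// (lt_le_trans e0).
  by split => // i; right; rewrite baryE e (le_trans hr).
apply: (separated_volume (phi := phi) (r := r)) => //.
- move=> k w w' kn Kw Kw'; have [pr xi] := core k _ Kw.
  move=> /(interior_near pr xi)[_]; rewrite dist//; exact: tet_core_tet.
- move=> k l w w' kn ln Kw Kw' kl; have [pr xi] := core k _ Kw.
  rewrite leNgt; apply/negP => /(interior_near pr xi)[+ _].
  have [-> _] := psiP k _ (tet_core_tet Kw); have [-> _] := psiP l _ (tet_core_tet Kw').
  by rewrite !kkE => -[].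
Qed.

End total_volume.

Theorem mainTheorem4 (R : realType) (n : nat) (T : ideal_triangulation n)
    (n_gt0 : (0 < n)%N) (T_orientable : orientable T) :
  exists d : ideal_space R T -> ideal_space R T -> \bar R,
    [/\ hyperbolic_cone_structure d,
        metric_complete d,
        ~ compact [set: ideal_space R T]%classic
      & volume d [set: ideal_space R T]%classic =
        ((n%:R)%:E * volume (@hedist R) (@regular_ideal_tetrahedron R))%E].
Proof.
exists (@sdist R n T); split.
- exact: space_cone_structure.
- exact: space_complete.
- exact: space_not_compact.
- exact: total_volume.
Qed.
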